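(* Let $\mathbb{F}\in\{\mathbb{R},\mathbb{C}\}$ and let $A_1,\dots,A_n$ be fixed positive-semidefinite $d\times d$ matrices with entries in $\mathbb{F}$. Let $W_1,\dots,W_n$ be independent real random variables with $W_i\ge 0$ and $\mathbb{E}[W_i^2]<+\infty$ for each $i$. Define the random matrices \[ Y=\sum_{i=1}^n W_iA_i,\qquad Z=\sum_{i=1}^n X_iA_i, \] where $X_1,\dots,X_n$ are independent real Gaussian random variables with $X_i\sim\textsc{normal}_{\mathbb{R}}(\mathbb{E}[W_i],\ \mathbb{E}[W_i^2])$ (mean $\mathbb{E}[W_i]$, variance $\mathbb{E}[W_i^2]$). Set \[ \sigma_*^2(Z)=\max_{\|u\|=1}\sum_{i=1}^n \mathbb{E}[W_i^2]\,(u^*A_iu)^2 , \] the maximum over unit vectors $u\in\mathbb{F}^d$. Then \[ \mathbb{E}\,\lambda_{\min}(Y)\ \ge\ \mathbb{E}\,\lambda_{\min}(Z)-\sqrt{2\sigma_*^2(Z)\log d}, \] and for all $t\ge 0$, \[ \mathbb{P}\big\{\lambda_{\min}(Y)\le \mathbb{E}\,\lambda_{\min}(Z)-t\big\}\le d\cdot e^{-t^2/(2\sigma_*^2(Z))}. \]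
   Context: $\lambda_{\min}$ denotes the minimum eigenvalue of a self-adjoint matrix; $u^*$ is the conjugate transpose. The quantity $\sigma_*^2(Z)$ equals $\max_{\|u\|=1}\operatorname{Var}[u^*Zu]$, the weak variance of $Z$. *)

(* Defs.v *)
From HB Require Import structures.
From mathcomp Require Import all_boot all_order all_algebra.
From mathcomp Require Import all_classical all_reals all_analysis.
From mathcomp Require Import complex.

Set Implicit Arguments.
Unset Strict Implicit.
Unset Printing Implicit Defensive.

Import Order.TTheory GRing.Theory Num.Theory.
Local Open Scope classical_set_scope.
Local Open Scope ring_scope.

Section LinAlg.
(* F is the scalar field (R or C); conj its conjugation, re : F -> R the real
   part, emb : R -> F the embedding of the reals. *)
Variables (R : realType) (F : numFieldType)
  (conj : F -> F) (re : F -> R) (emb : R -> F).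

Definition adjv (d : nat) (u : 'cV[F]_d) : 'rV[F]_d := \row_j conj (u j 0).

Definition quadf (d : nat) (A : 'M[F]_d) (u : 'cV[F]_d) : F :=
  (adjv u *m A *m u) 0 0.

Definition selfadjoint (d : nat) (A : 'M[F]_d) : Prop :=
  map_mx conj A^T = A.

Definition psd (d : nat) (A : 'M[F]_d) : Prop :=
  selfadjoint A /\ forall u : 'cV[F]_d, 0 <= quadf A u.

Definition unitv (d : nat) (u : 'cV[F]_d) : Prop := (adjv u *m u) 0 0 = 1.

(* minimum eigenvalue of a self-adjoint matrix (its eigenvalues are real) *)
Definition lmin (d : nat) (A : 'M[F]_d) : R :=
  inf [set x : R | eigenvalue A (emb x)].

Definition sigma_star2 (n d : nat) (v : 'I_n -> R) (A : 'I_n -> 'M[F]_d) : R :=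
  sup [set s : R | exists u : 'cV[F]_d,
        unitv u /\ s = \sum_(i < n) v i * (re (quadf (A i) u)) ^+ 2].

End LinAlg.

Section Prob.
Variable R : realType.
Local Open Scope ereal_scope.

Definition indep_rvs (dT : measure_display) (T : measurableType dT)
    (P : probability T R) (n : nat) (X : 'I_n -> T -> R) : Prop :=
  (forall i, measurable_fun setT (X i)) /\
  forall B : 'I_n -> set R, (forall i, measurable (B i)) ->
    P (\bigcap_i (X i @^-1` B i)) = \prod_(i < n) P (X i @^-1` B i).

Definition has_normal_law (dT : measure_display) (T : measurableType dT)
    (P : probability T R) (X : T -> R) (m v : R) : Prop :=
  forall B : set R, measurable B ->
    P (X @^-1` B) = if v == 0%R then \d_m B
                    else normal_prob m (Num.sqrt v) B.
End Prob.

Definition thm21_for (R : realType) (F : numFieldType)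
    (conj : F -> F) (re : F -> R) (emb : R -> F) : Prop :=
  forall (n d : nat) (A : 'I_n -> 'M[F]_d),
  (0 < d)%N ->
  (forall i, psd conj (A i)) ->
  forall (dT : measure_display) (T : measurableType dT) (P : probability T R)
         (W : 'I_n -> T -> R),
  indep_rvs P W ->
  (forall i x, 0 <= W i x) ->
  (forall i, ('E_P[fun x => (W i x ^+ 2)%R] < +oo)%E) ->
  forall (dT' : measure_display) (T' : measurableType dT')
         (P' : probability T' R) (X : 'I_n -> T' -> R),
  indep_rvs P' X ->
  (forall i, has_normal_law P' (X i) (fine 'E_P[W i])
                                     (fine 'E_P[fun x => (W i x ^+ 2)%R])) ->
  let v := fun i => fine 'E_P[fun x => (W i x ^+ 2)%R] in
  let Y := fun x => \sum_(i < n) emb (W i x) *: A i in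
  let Z := fun x => \sum_(i < n) emb (X i x) *: A i in
  let s2 := sigma_star2 conj re v A in
  ('E_P[fun x => (lmin emb (Y x))%R] >=
     'E_P'[fun x => (lmin emb (Z x))%R] - (Num.sqrt (2 * s2 * ln d%:R))%:E)%E /\
  forall t : R, 0 <= t ->
    (P [set x | (lmin emb (Y x))%:E <= 'E_P'[fun x => (lmin emb (Z x))%R] - t%:E]
       <= (d%:R * expR (- t ^+ 2 / (2 * s2)))%:E)%E.

Definition id_R (R : realType) (x : R) : R := x.
Definition conj_C (R : realType) (z : R[i]) : R[i] := conjc z.
Definition re_C (R : realType) (z : R[i]) : R := complex.Re z.
Definition emb_C (R : realType) (x : R) : R[i] := (x%:C)%C.

(* Main.v *)
(* Let H be Hermitian, A positive semidefinite.  The function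
     phi(w) = tr exp(H - w A)
   is the limit of tr (1 + (H - w A) / N)^N.  For N odd and large, the fourth derivative of
   the latter in w is a sum over cyclic words with four letters A and an odd number of
   letters B = 1 + (H - w A) / N >= 0, which groups into terms tr (B^d V B^(d+1) V^* ) >= 0.
   As phi is also bounded at +oo, Hermite interpolation at m - s and m + s, with
   m = E W and s^2 = E W^2, gives a quadratic above phi on [m - s, +oo[, which contains
   [0, +oo[, and a cubic below phi on the line.  Both agree with phi at the nodes, hence
     E phi(W) <= (phi(m - s) + phi(m + s)) / 2 <= E phi(X),   X ~ N(m, s^2).
   Replacing the coordinates one at a time yields, for th >= 0,
     E tr exp(- th Y) <= E tr exp(- th Z).
   The minimum eigenvalue of Z is Lipschitz in the Gaussian coordinates with constant
   sigma_star(Z), so the Gaussian concentration inequality, obtained from the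
   Prekopa-Leindler inequality, gives
     E exp(- th lmin(Y)) <= d exp(- th E lmin(Z) + th^2 sigma_star^2(Z) / 2),
   and the theorem follows from Markov's and Jensen's inequalities by choosing th. *)

Require Import Defs.
From HB Require Import structures.
From mathcomp Require Import all_boot all_order all_algebra.
From mathcomp Require Import all_classical all_reals all_analysis.
From mathcomp Require Import complex.
From mathcomp Require Import polyrcf measurable_realfun ring lra zify.

Set Implicit Arguments.
Unset Strict Implicit.
Unset Printing Implicit Defensive.

Import Order.TTheory GRing.Theory Num.Theory.
Import numFieldNormedType.Exports.
Local Open Scope classical_set_scope.
Local Open Scope ring_scope.
Local Open Scope sesquilinear_scope.

(** * Traces of powers of a Hermitian pencil *)

(** By Stahl's theorem w -> tr exp(H - w A), with A >= 0, is the Laplace transform of a positive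
    measure. Only the sign of the fourth derivative is used here, and that sign is elementary: four
    letters A cut a cyclic word into four gaps, and words are grouped by comparing sums of
    neighbouring gaps.

    The cubic lies below phi because the interpolation remainder with two double nodes is a fourth
    divided difference times a square. The quadratic above needs a third-order sign: by the
    fourth-order sign the third divided differences increase, and since phi is bounded at +oo they
    vanish there, hence they are nonpositive.

    The variance E W^2, instead of Var W, comes from the quadratic bound, which holds only to the
    right of its left node: m <= s places the node m - s at or below 0, hence below all values of W.

    Everything is stated through divided differences of values and derivatives at the nodes, so that
    the inequalities pass from the polynomials tr (1 + (H - w A) / N)^N to phi by pointwise
    limits. *)

Section Words.
Variable S : pzRingType.
Implicit Types q a : S.

(* The sum of all words with [k] letters [a] and [n] letters [q]. *)
Fixpoint wordsum q a (k n : nat) {struct k} : S :=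
  if k is k'.+1 then
    (fix aux n := if n is n'.+1 then q * aux n' + a * wordsum q a k' n
                  else a * wordsum q a k' 0) n
  else q ^+ n.

Arguments wordsum : simpl never.

Lemma wordsum0 q a n : wordsum q a 0 n = q ^+ n. Proof. by []. Qed.
Lemma wordsumS0 q a k : wordsum q a k.+1 0 = a * wordsum q a k 0.
Proof. by []. Qed.
Lemma wordsumSS q a k n :
  wordsum q a k.+1 n.+1 = q * wordsum q a k.+1 n + a * wordsum q a k n.+1.
Proof. by []. Qed.

(** Words are sorted by the number of letters [q] before their first [a]. *)
Lemma wordsum_sum q a k n :
  wordsum q a k.+1 n = \sum_(i < n.+1) q ^+ i * a * wordsum q a k (n - i).
Proof.
elim: n => [|n IH]; first by rewrite big_ord_recl big_ord0 expr0 mul1r addr0.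
rewrite wordsumSS IH [RHS]big_ord_recl expr0 mul1r subn0 addrC; congr (_ + _).
rewrite mulr_sumr; apply: eq_bigr => i _.
by rewrite lift0 subSS exprS !mulrA.
Qed.

(** The derivation turns one letter [q] into [a], and a word with k + 1 letters [a] arises in this
    way from k + 1 words. In the application [D] is d/dw entrywise, [q] a linear pencil and [a] its
    slope. *)
Lemma wordsum_deriv (D : S -> S) q a :
  (forall x y, D (x + y) = D x + D y) ->
  (forall x y, D (x * y) = D x * y + x * D y) -> D q = a -> D a = 0 ->
  forall k, D (wordsum q a k 0) = 0 /\
    forall n, D (wordsum q a k n.+1) = wordsum q a k.+1 n *+ k.+1.
Proof.
move=> DD DM Dq Da.
have D1 : D 1 = 0.
  by have := DM 1 1; rewrite !mulr1 mul1r => /eqP; rewrite -subr_eq0 opprD addNKr oppr_eq0 => /eqP.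
elim=> [|k [IH0 IH]].
  split=> //; elim=> [|n IHn]; first by rewrite wordsumS0 !wordsum0 expr1 mulr1.
  rewrite wordsum0 exprS DM Dq -[_ ^+ _]/(wordsum q a 0 n.+1) IHn wordsumSS.
  by rewrite addrC !mulr1n.
have D0 : D (wordsum q a k.+1 0) = 0 by rewrite wordsumS0 DM Da IH0 mul0r mulr0 addr0.
split=> //; elim=> [|n IHn].
  rewrite wordsumSS DD [D (q * _)]DM D0 Dq mulr0 addr0 [D (a * _)]DM Da mul0r add0r IH.
  by rewrite [in RHS]wordsumS0 -mulrDr -mulrS mulrnAr.
rewrite wordsumSS DD [D (q * _)]DM IHn Dq [D (a * _)]DM Da mul0r add0r IH.
by rewrite addrAC -mulrDr -mulrS addrC !mulrnAr -mulrnDl.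
Qed.

End Words.
Arguments wordsum : simpl never.

Lemma wordsum_morph (S S' : pzRingType) (f : {rmorphism S -> S'}) (q a : S) k n :
  f (wordsum q a k n) = wordsum (f q) (f a) k n.
Proof.
elim: k n => [|k IH] n; first by rewrite rmorphXn.
elim: n => [|n IHn]; first by rewrite !wordsumS0 rmorphM IH.
by rewrite !wordsumSS rmorphD !rmorphM IHn IH.
Qed.

Section Cyclic.
Variable V : nmodType.

Lemma triangle_sum (G : nat -> nat -> V) n N : (n < N)%N ->
  \sum_(i < n.+1) G i (n - i)%N
  = \sum_(i < N) \sum_(j < N | (i + j == n)%N) G i j.
Proof.
move=> nN; rewrite (big_ord_widen _ (fun i => G i (n - i)%N) nN).
rewrite [RHS](bigID (fun i : 'I_N => (i < n.+1)%N)) /= [X in _ + X]big1 ?addr0.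
  apply: eq_bigr => i ilt; have jN : (n - i < N)%N by lia.
  rewrite (big_pred1 (Ordinal jN)) //= => j.
  by rewrite /= -val_eqE /=; apply/eqP/eqP; lia.
by move=> i ni; rewrite big_pred0 // => j; apply/negbTE/eqP; lia.
Qed.

(* Each quadruple with odd sum has exactly one index whose two neighbours
   both add up with it to less than half of the total: a + b, c + d lie on
   different sides of the half, and so do b + c, d + a. *)
Lemma cyclic_quadruples (T : nat -> nat -> nat -> nat -> V) q m :
  m = (q.*2.+1)%N ->
  (forall a b c d, T a b c d = T b c d a) ->
  \sum_(a < m.+1) \sum_(b < (m - a).+1) \sum_(c < (m - a - b).+1)
     T a b c (m - a - b - c)%N
  = (\sum_(d < q.+1) \sum_(a < (q - d).+1) \sum_(c < (q - d).+1)
       T a (m - a - c - d)%N c d) *+ 4.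
Proof.
move=> mE Tcyc.
pose S (P : nat -> nat -> nat -> nat -> bool) :=
  \sum_(a < m.+1) \sum_(b < m.+1) \sum_(c < m.+1)
     \sum_(d < m.+1 | (a + b + c + d == m)%N && P a b c d) T a b c d.
have -> : \sum_(a < m.+1) \sum_(b < (m - a).+1) \sum_(c < (m - a - b).+1)
     T a b c (m - a - b - c)%N = S (fun _ _ _ _ => true).
  apply: eq_bigr => a _; rewrite (big_ord_widen m.+1 (fun b =>
     \sum_(c < (m - a - b).+1) T a b c (m - a - b - c)%N)); last by lia.
  rewrite big_mkcond; apply: eq_bigr => b _; case: ifPn => bm.
    rewrite (@triangle_sum _ _ m.+1); last by lia.
    by apply: eq_bigr => c _; apply: eq_bigl => d; have aN := ltn_ord a; lia.
  rewrite big1 // => c _; rewrite big_pred0 // => d.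
  by apply/negbTE/eqP; lia.
(* [J] selects the quadruples whose distinguished index is the last one. *)
pose J (a b c d : nat) := (a + d <= q)%N && (c + d <= q)%N.
have rot P : S (fun a b c d => P b c d a) = S P.
  rewrite /S exchange_big; apply: eq_bigr => b _.
  rewrite exchange_big; apply: eq_bigr => c _.
  rewrite (exchange_big_dep predT) //=; apply: eq_bigr => d _.
  apply: eq_big => a; last by rewrite Tcyc.
  by congr (_ && _); apply/eqP/eqP; lia.
have splitS P Q : S P = S (fun a b c d => P a b c d && Q a b c d)
    + S (fun a b c d => P a b c d && ~~ Q a b c d).
  rewrite /S -big_split; apply: eq_bigr => a _.
  rewrite -big_split; apply: eq_bigr => b _.
  rewrite -big_split; apply: eq_bigr => c _.
  by rewrite /= (bigID (fun d : 'I_(m.+1) => Q a b c d)) /=; congr (_ + _);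
    apply: eq_bigl => d; rewrite andbA.
have eqS P Q : (forall a b c d, (a + b + c + d == m)%N -> P a b c d = Q a b c d) -> S P = S Q.
  move=> PQ; rewrite /S; do 3 (apply: eq_bigr => ? _); apply: eq_bigl => d.
  by case: (boolP (_ == m)) => //= /PQ ->.
have -> : S (fun _ _ _ _ => true) = S J *+ 4.
  (* As the total is 2q + 1, a + b <= q holds exactly when c + d <= q fails, and likewise for b + c
     and d + a. The two tests cut out four classes, each a rotation of [J]. *)
  rewrite (splitS _ (fun a b c d => a + b <= q)%N) /=.
  rewrite (splitS (fun a b c d => a + b <= q)%N (fun a b c d => b + c <= q)%N).
  rewrite (splitS (fun a b c d => ~~ (a + b <= q))%N (fun a b c d => b + c <= q)%N) /=.
  rewrite -[S (fun a b c d => (a + b <= q)%N && (b + c <= q)%N)](eqS (fun a b c d => J c d a b)); last first.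
    by move=> a b c d; rewrite /J; lia.
  rewrite -[S (fun a b c d => (a + b <= q)%N && ~~ (b + c <= q)%N)](eqS (fun a b c d => J b c d a)); last first.
    by move=> a b c d; rewrite /J; lia.
  rewrite -[S (fun a b c d => ~~ (a + b <= q)%N && (b + c <= q)%N)](eqS (fun a b c d => J d a b c)); last first.
    by move=> a b c d; rewrite /J; lia.
  rewrite -[S (fun a b c d => ~~ (a + b <= q)%N && ~~ (b + c <= q)%N)](eqS (fun a b c d => J a b c d)); last first.
    by move=> a b c d; rewrite /J; lia.
  rewrite (rot (fun a b c d => J b c d a)) (rot J) (rot (fun a b c d => J c d a b)).
  by rewrite (rot (fun a b c d => J b c d a)) (rot J) !mulrS mulr0n addr0 !addrA.
congr (_ *+ 4); rewrite /S.
transitivity (\sum_(d < m.+1) \sum_(a < m.+1) \sum_(c < m.+1)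
   \sum_(b < m.+1 | (a + b + c + d == m)%N && J a b c d) T a b c d).
  rewrite [RHS]exchange_big; apply: eq_bigr => a _.
  rewrite exchange_big [RHS]exchange_big; apply: eq_bigr => c _.
  by rewrite (exchange_big_dep predT).
rewrite (big_ord_widen m.+1 (fun d => \sum_(a < (q - d).+1) \sum_(c < (q - d).+1)
       T a (m - a - c - d)%N c d)); last by lia.
rewrite [RHS]big_mkcond; apply: eq_bigr => d _; case: ifPn => dq; last first.
  by do 2 (rewrite big1 // => ? _); rewrite big_pred0 // => b; rewrite /J; lia.
rewrite (big_ord_widen m.+1 (fun a => \sum_(c < (q - d).+1)
       T a (m - a - c - d)%N c d)); last by lia.
rewrite [RHS]big_mkcond; apply: eq_bigr => a _; case: ifPn => aq; last first.
  by rewrite big1 // => ? _; rewrite big_pred0 // => b; rewrite /J; lia.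
rewrite (big_ord_widen m.+1 (fun c => T a (m - a - c - d)%N c d)); last by lia.
rewrite [RHS]big_mkcond; apply: eq_bigr => c _; case: ifPn => cq; last first.
  by rewrite big_pred0 // => b; rewrite /J; lia.
have bN : (m - a - c - d < m.+1)%N by lia.
rewrite (big_pred1 (Ordinal bN)) => [|b]; first by [].
by rewrite /J -[pred1 _ b]/(nat_of_ord b == (m - a - c - d)%N); lia.
Qed.

End Cyclic.

(** * Functional calculus of Hermitian matrices and positivity of word sums *)

Section Spectral.
Variables (C : numClosedFieldType) (n : nat).
Implicit Types A B M U V : 'M[C]_n.+1.

Definition lam A (k : 'I_n.+1) : C := spectral_diag A 0 k.
Definition diagR (f : 'I_n.+1 -> C) : 'M[C]_n.+1 := diag_mx (\row_k f k).

Lemma diagRM f g : diagR f *m diagR g = diagR (fun k => f k * g k).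
Proof.
rewrite /diagR mulmx_diag; congr diag_mx.
by apply/rowP => k; rewrite !mxE.
Qed.

Definition specP A := spectralmx A.

Lemma specPV A : (specP A)^t* *m specP A = 1%:M.
Proof.
rewrite -invmx_unitary ?spectral_unitarymx // mulVmx //.
exact: unitarymx_unit (spectral_unitarymx A).
Qed.

Lemma specVP A : specP A *m (specP A)^t* = 1%:M.
Proof. by have /unitarymxP := spectral_unitarymx A. Qed.

(** Functional calculus, with [f] a function of the index of an eigenvalue and not of its value. *)
Definition spec_apply A f := (specP A)^t* *m diagR f *m specP A.

Lemma spectralE A : A^t* = A -> A = spec_apply A (lam A).
Proof.
move=> Ah.
have H : A \is hermsymmx by apply/is_hermitianmxP; rewrite expr0 scale1r Ah.
have /orthomx_spectralP E := hermitian_normalmx H.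
rewrite {1}E /spec_apply invmx_unitary ?spectral_unitarymx //.
by congr (_ *m _ *m _); congr diag_mx; apply/rowP => k; rewrite !mxE.
Qed.

Lemma lam_real A k : A^t* = A -> lam A k \is Num.real.
Proof.
move=> Ah; have H : A \is hermsymmx by apply/is_hermitianmxP; rewrite expr0 scale1r Ah.
by have /mxOverP := hermitian_spectral_diag_real H; apply.
Qed.

Lemma spec_applyM A f g :
  spec_apply A f *m spec_apply A g = spec_apply A (fun k => f k * g k).
Proof.
rewrite /spec_apply -diagRM !mulmxA; congr (_ *m _ *m _).
by rewrite -mulmxA specVP mulmx1.
Qed.

Lemma spec_apply1 A : spec_apply A (fun=> 1) = 1%:M.
Proof.
rewrite /spec_apply; have -> : diagR (fun=> 1) = 1%:M.
  by apply/matrixP => i j; rewrite !mxE.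
by rewrite mulmx1 specPV.
Qed.

Lemma spec_applyX A f m : spec_apply A f ^+ m = spec_apply A (fun k => f k ^+ m).
Proof.
elim: m => [|m IH]; first by rewrite expr0 -[LHS](spec_apply1 A).
rewrite exprS IH -mulmxE spec_applyM; congr spec_apply.
by apply/funext => k; rewrite exprS.
Qed.

Lemma tr_spec_apply A f : \tr (spec_apply A f) = \sum_k f k.
Proof.
rewrite /spec_apply mxtrace_mulC mulmxA specVP mul1mx /mxtrace.
by apply: eq_bigr => k _; rewrite !mxE eqxx mulr1n.
Qed.

Lemma tr_spec_apply2 A V f g :
  \tr (spec_apply A f *m V *m spec_apply A g *m V^t*)
  = \sum_k \sum_l (f k * g l) * `| (specP A *m V *m (specP A)^t*) k l | ^+ 2.
Proof.
set X := specP A *m V *m _.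
have -> : \tr (spec_apply A f *m V *m spec_apply A g *m V^t*)
    = \tr (diagR f *m X *m (diagR g *m X^t*)).
  have -> : X^t* = specP A *m V^t* *m (specP A)^t*.
    by rewrite /X !trmx_mul !map_mxM trmxCK mulmxA.
  by rewrite /spec_apply /X -!mulmxA mxtrace_mulC !mulmxA.
rewrite /mxtrace; apply: eq_bigr => k _; rewrite mxE; apply: eq_bigr => l _.
rewrite /diagR !mul_diag_mx.
by rewrite !mxE normCK mulrACA.
Qed.

(** In the eigenbasis of [A] the trace is a sum of squared moduli with weights f k g l. Since [V] is
    arbitrary, it can be a sum of words that is not Hermitian. *)
Lemma tr_psd_ge0 A V f g : (forall k, 0 <= f k) -> (forall k, 0 <= g k) ->
  0 <= \tr (spec_apply A f *m V *m spec_apply A g *m V^t*).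
Proof.
move=> f0 g0; rewrite tr_spec_apply2; apply: sumr_ge0 => k _; apply: sumr_ge0 => l _.
by rewrite mulr_ge0 ?exprn_ge0 // mulr_ge0.
Qed.

Lemma hermX A m : A^t* = A -> (A ^+ m)^t* = A ^+ m.
Proof.
move=> Ah; elim: m => [|m IH]; first by rewrite expr0 trmx1 map_mx1.
by rewrite {1}exprSr -mulmxE trmx_mul map_mxM IH Ah mulmxE exprS.
Qed.

(* Up to a cyclic rotation every word of the trace reads [B^d V B^(d+1) V^*], with [V]
   summed over the positions of its letters; the odd number of letters [B] makes the
   choice of the rotation unique. *)
Lemma tr_wordsum_ge0 B A q :
  B^t* = B -> (forall k, 0 <= lam B k) -> A^t* = A ->
  0 <= \tr (A * wordsum B A 3 q.*2.+1).
Proof.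
move=> Bh B0 Ah; set m := q.*2.+1.
pose T a b c d := \tr (A *m (B ^+ a *m A *m (B ^+ b *m A *m (B ^+ c *m A *m B ^+ d)))).
have -> : \tr (A * wordsum B A 3 m) =
    \sum_(a < m.+1) \sum_(b < (m - a).+1) \sum_(c < (m - a - b).+1)
     T a b c (m - a - b - c)%N.
  rewrite wordsum_sum mulr_sumr raddf_sum; apply: eq_bigr => a _ /=.
  rewrite wordsum_sum !mulr_sumr raddf_sum; apply: eq_bigr => b _ /=.
  by rewrite wordsum_sum !mulr_sumr raddf_sum; apply: eq_bigr => c _ /=.
rewrite (cyclic_quadruples (erefl m)); last first.
  move=> a b c d; rewrite /T.
  rewrite -!mulmxA mulmxA mxtrace_mulC; congr mxtrace.
  by rewrite !mulmxA.
apply: mulrn_wge0; apply: sumr_ge0 => d _.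
pose V := \sum_(a < (q - d).+1) A *m B ^+ a *m A *m B ^+ (q - d - a).
have VJ : V^t* = \sum_(c < (q - d).+1) B ^+ (q - d - c) *m A *m B ^+ c *m A.
  rewrite /V raddf_sum raddf_sum; apply: eq_bigr => c _ /=.
  by rewrite !trmx_mul !map_mxM Ah !hermX // !mulmxA.
have -> : \sum_(a < (q - d).+1) \sum_(c < (q - d).+1) T a (m - a - c - d)%N c d
    = \tr (B ^+ d *m V *m B ^+ d.+1 *m V^t*).
  rewrite /V mulmx_sumr 2!mulmx_suml raddf_sum; apply: eq_bigr => a _.
  rewrite VJ mulmx_sumr raddf_sum; apply: eq_bigr => c _ /=; rewrite /T.
  (* The gap opposite to [d] is cut in three: its outer pieces complete a summand of [V] and one of
     its adjoint to q - d letters [B] each, and exactly d + 1 letters remain between them. *)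
  have -> : (m - a - c - d = (q - d - a) + (d.+1 + (q - d - c)))%N.
    by have := ltn_ord a; have := ltn_ord c; have := ltn_ord d; rewrite /m; lia.
  rewrite !exprD -!mulmxE.
  by rewrite !mulmxA mxtrace_mulC !mulmxA.
by rewrite (spectralE Bh) !spec_applyX; apply: tr_psd_ge0 => k; rewrite exprn_ge0.
Qed.
End Spectral.

(** * Hermite interpolation *)

Section DivDiff.
Variable R : rcfType.
Implicit Types (p g : {poly R}) (x y z w lo hi : R).

Definition nonneg_on p lo hi := forall x, lo <= x <= hi -> 0 <= p.[x].

Lemma derivn_factor g x0 k :
  (('X - x0%:P) * g)^`(k.+1) = ('X - x0%:P) * g^`(k.+1) + g^`(k) *+ k.+1.
Proof.
elim: k => [|k IH].
  by rewrite !derivn1 derivn0 derivM derivXsubC mul1r addrC.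
rewrite derivnS IH derivD derivM derivXsubC mul1r derivMn -!derivnS.
by rewrite addrAC addrC -mulrS addrC.
Qed.

(* [(x - x0)^(k+1) * G(x)] with [G] the k-th derivative of [g] has derivative
   [(x - x0)^k] times the (k+1)-st derivative of [p]. *)
Lemma div_diff_step p g x0 lo hi k : lo <= x0 <= hi ->
  p = p.[x0]%:P + ('X - x0%:P) * g ->
  nonneg_on p^`(k.+1) lo hi -> nonneg_on g^`(k) lo hi.
Proof.
move=> x0I pE p0 x xI; set G := g^`(k).
have pkE : p^`(k.+1) = ('X - x0%:P) * G^`() + G *+ k.+1.
  rewrite pE derivnD derivn_factor -derivnS derivSn derivC.
  by rewrite linear0 add0r.
have h0 y : lo <= y <= hi -> 0 <= (y - x0) * G^`().[y] + G.[y] *+ k.+1.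
  by move=> /p0; rewrite pkE !hornerE hornerMn.
case: (ltrgtP x x0) => xx0.
(* Left of [x0] the powers of x0 - x are the nonnegative ones; the sign in front makes [h]
   nondecreasing. *)
- pose h : {poly R} := - ((x0%:P - 'X) ^+ k.+1 * G).
  have hd : h^`() = (x0%:P - 'X) ^+ k * (('X - x0%:P) * G^`() + G *+ k.+1).
    rewrite /h derivN derivM deriv_exp derivB derivC derivX sub0r /=.
    have -> : 'X - x0%:P = - (x0%:P - 'X) by rewrite opprB.
    move: (x0%:P - 'X) => v; rewrite mulN1r mulNrn mulNr opprD opprK mulrnAl.
    by rewrite mulrDr mulNr mulrN mulrA -exprSr mulrnAr addrC.
  have hle : h.[x] <= h.[x0].
    apply: (@ler_hornerW _ x x0); rewrite ?in_itv /= ?lexx ?(ltW xx0) // => y.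
    rewrite in_itv /= => /andP[xy yx0]; rewrite hd hornerM mulr_ge0 //.
      by rewrite !hornerE exprn_ge0 // subr_ge0 ltW.
    by rewrite !hornerE hornerMn h0 //; lra.
  move: hle; rewrite /h !hornerE subrr expr0n /= mul0r oppr0 oppr_le0.
  by rewrite pmulr_rge0 // exprn_gt0 // subr_gt0.
- pose h : {poly R} := ('X - x0%:P) ^+ k.+1 * G.
  have hd : h^`() = ('X - x0%:P) ^+ k * (('X - x0%:P) * G^`() + G *+ k.+1).
    rewrite /h derivM deriv_exp derivB derivC derivX subr0 /=.
    by rewrite mul1r mulrDr mulrA -exprSr mulrnAr mulrnAl addrC.
  have hle : h.[x0] <= h.[x].
    apply: (@ler_hornerW _ x0 x); rewrite ?in_itv /= ?lexx ?(ltW xx0) // => y.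
    rewrite in_itv /= => /andP[xy yx0]; rewrite hd hornerM mulr_ge0 //.
      by rewrite !hornerE exprn_ge0 // subr_ge0 ltW.
    by rewrite !hornerE hornerMn h0 //; lra.
  move: hle; rewrite /h !hornerE subrr expr0n /= mul0r.
  by rewrite pmulr_rge0 // exprn_gt0 // subr_gt0.
- by have := h0 x0 x0I; rewrite subrr mul0r add0r pmulrn_lge0 // -xx0.
Qed.

Lemma factor_at p x0 : {g | p = p.[x0]%:P + ('X - x0%:P) * g}.
Proof.
have /factor_theorem/sig_eqW[g gE] : root (p - p.[x0]%:P) x0.
  by rewrite rootE !hornerE subrr.
by exists g; rewrite mulrC -gE addrC subrK.
Qed.

(** Newton's expansion: the [g] are the divided differences of [p] at the first nodes and a running
    point, and nodes may coincide. Each division costs one derivative, so the sign of the fourth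
    derivative reaches [g4]. *)
Lemma div_diff4 p lo hi x1 x2 x3 x4 : nonneg_on p^`(4) lo hi ->
  lo <= x1 <= hi -> lo <= x2 <= hi -> lo <= x3 <= hi -> lo <= x4 <= hi ->
  exists g1 g2 g3 g4, [/\ p = p.[x1]%:P + ('X - x1%:P) * g1,
    g1 = g1.[x2]%:P + ('X - x2%:P) * g2,
    g2 = g2.[x3]%:P + ('X - x3%:P) * g3,
    g3 = g3.[x4]%:P + ('X - x4%:P) * g4 & nonneg_on g4 lo hi].
Proof.
move=> p0 x1I x2I x3I x4I.
have [g1 E1] := factor_at p x1; have [g2 E2] := factor_at g1 x2.
have [g3 E3] := factor_at g2 x3; have [g4 E4] := factor_at g3 x4.
exists g1, g2, g3, g4; split => //.
apply: (div_diff_step (k := 0) x4I E4); apply: (div_diff_step x3I E3).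
exact: (div_diff_step x2I E2 (div_diff_step x1I E1 p0)).
Qed.

Lemma horner_factor p g x0 w : p = p.[x0]%:P + ('X - x0%:P) * g ->
  p.[w] = p.[x0] + (w - x0) * g.[w].
Proof. by move=> {1}->; rewrite !hornerE. Qed.

Lemma deriv_factor p g x0 w : p = p.[x0]%:P + ('X - x0%:P) * g ->
  p^`().[w] = g.[w] + (w - x0) * g^`().[w].
Proof. by move=> ->; rewrite derivD derivC derivM derivXsubC !hornerE. Qed.

Definition slope (f1 f2 y1 y2 : R) := (f2 - f1) / (y2 - y1).

(** Second divided differences at the nodes y1, y1, y2 and, for [dd_right], y1, y2, y2; a double
    node brings in the derivative. *)
Definition dd_left (f1 f2 d1 y1 y2 : R) := (slope f1 f2 y1 y2 - d1) / (y2 - y1).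
Definition dd_right (f1 f2 d2 y1 y2 : R) := (d2 - slope f1 f2 y1 y2) / (y2 - y1).

(* The cubic with values [f1], [f2] and derivatives [d1], [d2] at [y1], [y2]. *)
Definition hermite3 (f1 f2 d1 d2 y1 y2 w : R) :=
  let k1 := dd_left f1 f2 d1 y1 y2 in let k2 := dd_right f1 f2 d2 y1 y2 in
  f1 + slope f1 f2 y1 y2 * (w - y1)
  + (k1 + (k2 - k1) / (y2 - y1) * (w - y1)) * ((w - y1) * (w - y2)).

(* The third divided difference at the nodes [y1], [y2], [y2], [z]; it vanishes as
   [z] tends to infinity when the function is bounded. *)
Definition dd_tail (f1 f2 f3 d2 y1 y2 z : R) :=
  ((slope f1 f3 y1 z - slope f1 f2 y1 y2) / (z - y2) - dd_right f1 f2 d2 y1 y2)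
  / (z - y2).

(* The quadratic with values [f1], [f2] at [y1], [y2] and derivative [d2] at [y2]. *)
Definition hermite2 (f1 f2 d2 y1 y2 w : R) :=
  f1 + slope f1 f2 y1 y2 * (w - y1)
  + dd_right f1 f2 d2 y1 y2 * ((w - y1) * (w - y2)).

Lemma hermite3_le p lo hi y1 y2 w : nonneg_on p^`(4) lo hi -> y1 < y2 ->
  lo <= y1 <= hi -> lo <= y2 <= hi -> lo <= w <= hi ->
  hermite3 p.[y1] p.[y2] p^`().[y1] p^`().[y2] y1 y2 w <= p.[w].
Proof.
move=> p0 y12 y1I y2I wI; rewrite /hermite3 /=.
have [g1 [g2 [g3 [g4 [E1 E2 E3 E4 g0]]]]] := div_diff4 p0 y1I y2I y1I y2I.
have d0 : y2 - y1 != 0 by rewrite subr_eq0 gt_eqF.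
have sE : slope p.[y1] p.[y2] y1 y2 = g1.[y2].
  by rewrite /slope (horner_factor y2 E1); field.
have k1E : dd_left p.[y1] p.[y2] p^`().[y1] y1 y2 = g2.[y1].
  by rewrite /dd_left sE (deriv_factor y1 E1) (horner_factor y1 E2); field.
have k2E : dd_right p.[y1] p.[y2] p^`().[y2] y1 y2 = g2.[y2].
  by rewrite /dd_right sE (deriv_factor y2 E1) (deriv_factor y2 E2); field.
have bE : (g2.[y2] - g2.[y1]) / (y2 - y1) = g3.[y2].
  by rewrite (horner_factor y2 E3); field.
rewrite k1E k2E bE sE (horner_factor w E1) (horner_factor w E2).
rewrite (horner_factor w E3) (horner_factor w E4) -subr_ge0.
rewrite [leRHS](_ : _ = ((w - y1) * (w - y2)) ^+ 2 * g4.[w]); last by ring.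
by rewrite mulr_ge0 ?sqr_ge0 // g0.
Qed.

(** With nodes y1, y2, y2, z the remainder carries (w - y1)(w - y2)^2 (w - z), nonpositive between
    y1 and z. Sending z to infinity later removes the cubic term. *)
Lemma hermite2_ge p lo hi y1 y2 z w : nonneg_on p^`(4) lo hi -> y1 < y2 -> y2 < z ->
  lo <= y1 -> z <= hi -> y1 <= w <= z ->
  p.[w] <= hermite2 p.[y1] p.[y2] p^`().[y2] y1 y2 w
   + dd_tail p.[y1] p.[y2] p.[z] p^`().[y2] y1 y2 z * ((w - y1) * (w - y2) ^+ 2).
Proof.
move=> p0 y12 y2z loy zhi /andP[y1w wz].
have [||||g1 [g2 [g3 [g4 [E1 E2 E3 E4 g0]]]]] :=
  @div_diff4 p lo hi y1 y2 y2 z p0; try by apply/andP; split; lra.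
have d0 : y2 - y1 != 0 by rewrite subr_eq0 gt_eqF.
have d1 : z - y1 != 0 by rewrite subr_eq0 gt_eqF // (lt_trans y12).
have d2 : z - y2 != 0 by rewrite subr_eq0 gt_eqF.
have sE : slope p.[y1] p.[y2] y1 y2 = g1.[y2].
  by rewrite /slope (horner_factor y2 E1); field.
have k2E : dd_right p.[y1] p.[y2] p^`().[y2] y1 y2 = g2.[y2].
  by rewrite /dd_right sE (deriv_factor y2 E1) (deriv_factor y2 E2); field.
have tE : dd_tail p.[y1] p.[y2] p.[z] p^`().[y2] y1 y2 z = g3.[z].
  rewrite /dd_tail sE k2E /slope (horner_factor z E1) (horner_factor z E2).
  by rewrite (horner_factor z E3); field; rewrite d1 d2.
rewrite /hermite2 tE k2E sE (horner_factor w E1) (horner_factor w E2).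
rewrite (horner_factor w E3) (horner_factor w E4) -subr_ge0.
rewrite [leRHS](_ : _ = ((w - y1) * (z - w)) * (w - y2) ^+ 2 * g4.[w]); last by ring.
apply: mulr_ge0; last by apply: g0; apply/andP; split; lra.
by apply: mulr_ge0; [apply: mulr_ge0; rewrite subr_ge0 | exact: sqr_ge0].
Qed.
End DivDiff.

(** * Traces of powers of a pencil, as polynomials in the parameter *)

Section TracePoly.
Variables (C : numClosedFieldType) (n : nat).
Implicit Types (A B : 'M[C]_n.+1) (w : C).

Definition pencil B A : 'M[{poly C}]_n.+1 := map_mx polyC B - 'X *: map_mx polyC A.

Definition mxderiv (Q : 'M[{poly C}]_n.+1) := map_mx (@deriv C) Q.

Lemma mxderivD P Q : mxderiv (P + Q) = mxderiv P + mxderiv Q.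
Proof. by apply/matrixP => i j; rewrite !mxE derivD. Qed.

Lemma mxderivM P Q : mxderiv (P * Q) = mxderiv P * Q + P * mxderiv Q.
Proof.
apply/matrixP => i j; rewrite -!mulmxE !mxE (raddf_sum (@deriv C)) -big_split.
by apply: eq_bigr => k _; rewrite /= derivM !mxE.
Qed.

Lemma mxderiv_tr Q : \tr (mxderiv Q) = (\tr Q)^`().
Proof. by rewrite /mxtrace (raddf_sum (@deriv C)); apply: eq_bigr => k _; rewrite mxE. Qed.

Lemma mxderiv_pencil B A : mxderiv (pencil B A) = - map_mx polyC A.
Proof.
by apply/matrixP => i j; rewrite !mxE derivB derivC derivM derivX derivC mulr0 addr0 mul1r sub0r.
Qed.

Lemma mxderivC A : mxderiv (- map_mx polyC A) = 0.
Proof. by apply/matrixP => i j; rewrite !mxE derivN derivC oppr0. Qed.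

Definition trpow B A N : {poly C} := \tr (pencil B A ^+ N).

Lemma tr_mulC (S : comNzRingType) (P Q : 'M[S]_n.+1) : \tr (P * Q) = \tr (Q * P).
Proof. by rewrite -!mulmxE mxtrace_mulC. Qed.

Lemma trpow_deriv B A N :
  (trpow B A N.+1)^`() = \tr (- map_mx polyC A * pencil B A ^+ N) *+ N.+1.
Proof.
have [_ H] := wordsum_deriv mxderivD mxderivM (mxderiv_pencil B A) (mxderivC A) 0.
rewrite /trpow -mxderiv_tr -[_ ^+ _]/(wordsum (pencil B A) (- map_mx polyC A) 0 N.+1).
rewrite H mulr1n wordsum_sum raddf_sum /=.
transitivity (\sum_(i < N.+1) \tr (- map_mx polyC A * pencil B A ^+ N)).
  apply: eq_bigr => i _; rewrite wordsum0 tr_mulC mulrA tr_mulC -exprD.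
  by rewrite subnK // -ltnS.
by rewrite sumr_const card_ord.
Qed.

(** By cyclicity the first derivative is N + 4 equal traces starting with the letter [a]. This
    letter stays in place while the next three derivatives give 3! times the words with three
    more. *)
Lemma trpow_deriv4 B A N : (trpow B A N.+4)^`(4) =
  \tr (- map_mx polyC A * wordsum (pencil B A) (- map_mx polyC A) 3 N) *+ 6 *+ N.+4.
Proof.
have H k := (wordsum_deriv mxderivD mxderivM (mxderiv_pencil B A) (mxderivC A) k).2.
set a := - map_mx polyC A in H *.
have step k m : (\tr (a * wordsum (pencil B A) a k m.+1))^`()
   = \tr (a * wordsum (pencil B A) a k.+1 m) *+ k.+1.
  by rewrite -mxderiv_tr mxderivM mxderivC mul0r add0r H mulrnAr raddfMn.
rewrite !derivnS derivn0 trpow_deriv -/a -[_ ^+ _]/(wordsum (pencil B A) a 0 N.+3).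
by rewrite !(derivMn, step) -!mulrnA; congr (_ *+ _); lia.
Qed.

Definition mxhorner w (Q : 'M[{poly C}]_n.+1) := map_mx (horner_eval w) Q.

Lemma mxhorner_tr w Q : (\tr Q).[w] = \tr (mxhorner w Q).
Proof. by rewrite -!/(horner_eval w _) /mxhorner -trace_map_mx. Qed.

Lemma mxhorner_pencil w B A : mxhorner w (pencil B A) = B - w *: A.
Proof. by apply/matrixP => i j; rewrite !mxE /horner_eval !hornerE. Qed.

Lemma mxhornerC w A : mxhorner w (- map_mx polyC A) = - A.
Proof. by apply/matrixP => i j; rewrite !mxE /horner_eval !hornerE. Qed.

Lemma trpowE B A N w : (trpow B A N).[w] = \tr ((B - w *: A) ^+ N).
Proof. by rewrite /trpow mxhorner_tr -mxhorner_pencil /mxhorner rmorphXn. Qed.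

Lemma trpow_derivE B A N w : (trpow B A N.+1)^`().[w] =
  - \tr (A * (B - w *: A) ^+ N) *+ N.+1.
Proof.
rewrite trpow_deriv hornerMn mxhorner_tr -mxhorner_pencil /mxhorner rmorphM rmorphXn /=.
by rewrite -/(mxhorner _ _) mxhornerC mulNr raddfN.
Qed.

Lemma trpow_deriv4_ge0 B A q w : w \is Num.real -> B^t* = B -> A^t* = A ->
  (forall k, 0 <= lam (B - w *: A) k) ->
  0 <= (trpow B A (q.*2.+1 + 4))^`(4).[w].
Proof.
move=> wr Bh Ah B0; rewrite addn4 trpow_deriv4 !hornerMn mxhorner_tr.
rewrite /mxhorner rmorphM /=.
have -> Q a : map_mx (horner_eval w) (wordsum Q a 3 q.*2.+1)
    = wordsum (mxhorner w Q) (mxhorner w a) 3 q.*2.+1 by exact: wordsum_morph.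
rewrite -/(mxhorner _ _) mxhorner_pencil mxhornerC.
apply: mulrn_wge0; apply: mulrn_wge0; apply: tr_wordsum_ge0 => //.
  apply/matrixP => i j; rewrite !mxE rmorphB rmorphM /= (CrealP wr).
  by rewrite -{2}Bh -{2}Ah !mxE.
by apply/matrixP => i j; rewrite !mxE rmorphN /= -{2}Ah !mxE.
Qed.
End TracePoly.

(** * Trace exponentials *)

Section ExpLimit.
Variable R : realType.

(** The inequality 1 - y <= exp(- y) at y = x / (N + x), inverted. It complements 1 + x / N <= exp(x
    / N). *)
Lemma ge_expR_div (x N : R) : 0 < N -> 0 < N + x -> expR (x / (N + x)) <= 1 + x / N.
Proof.
move=> N0 Nx; have : 1 - x / (N + x) <= expR (- (x / (N + x))) by exact: expR_ge1Dx.
have E : 1 - x / (N + x) = (1 + x / N)^-1.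
  by field; rewrite !gt_eqF //= addrC mulr1n.
rewrite E expRN lef_pV2 // posrE ?expR_gt0 //.
have -> : 1 + x / N = (N + x) / N by field; rewrite gt_eqF.
by rewrite divr_gt0.
Qed.

(** The exponent may differ from [N], because the derivative of an N-th power carries N - 1. *)
Lemma expR_cvg (x : R) (N m : nat -> nat) :
  (forall q, (0 < N q)%N) -> ((N q)%:R^-1 : R) @[q --> \oo] --> (0 : R) ->
  ((m q)%:R / (N q)%:R : R) @[q --> \oo] --> (1 : R) ->
  (1 + x / (N q)%:R) ^+ (m q) @[q --> \oo] --> expR x.
Proof.
move=> N0 iN mN.
have xN : 1 + x / (N q)%:R @[q --> \oo] --> (1 : R).
  rewrite -[X in _ --> X]addr0 -[X in _ --> _ + X](mulr0 x).
  by apply: cvgD; [exact: cvg_cst | apply: cvgM; [exact: cvg_cst | exact: iN]].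
have up : expR (x * ((m q)%:R / (N q)%:R)) @[q --> \oo] --> expR x.
  apply: continuous_cvg; first exact: continuous_expR.
  by rewrite -[X in _ --> X]mulr1; apply: cvgM => //; exact: cvg_cst.
have lo : expR (x * ((m q)%:R / (N q)%:R) / (1 + x / (N q)%:R)) @[q --> \oo] --> expR x.
  apply: continuous_cvg; first exact: continuous_expR.
  have : x * ((m q)%:R / (N q)%:R) * (1 + x / (N q)%:R)^-1 @[q --> \oo] --> x * 1 * 1^-1.
    apply: cvgM; first by apply: cvgM => //; exact: cvg_cst.
    by apply: cvgV => //; exact: oner_neq0.
  by rewrite invr1 !mulr1.
apply: (squeeze_cvgr _ lo up); near=> q.
have Nq0 : (0 : R) < (N q)%:R by rewrite ltr0n.
have p0 : 0 < 1 + x / (N q)%:R by near: q; exact: (cvgr_gt _ xN).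
have Np : 0 < (N q)%:R + x.
  by move: p0; rewrite -(pmulr_rgt0 _ Nq0) mulrDr mulr1 mulrCA divff ?mulr1 // gt_eqF.
apply/andP; split.
  have -> : x * ((m q)%:R / (N q)%:R) / (1 + x / (N q)%:R) = x / ((N q)%:R + x) * (m q)%:R.
    by field; rewrite !gt_eqF.
  rewrite expRM_natr lerXn2r ?nnegrE ?expR_ge0 // ?(ltW p0) //.
  exact: ge_expR_div.
have -> : x * ((m q)%:R / (N q)%:R) = x / (N q)%:R * (m q)%:R by rewrite mulrA mulrAC.
rewrite expRM_natr lerXn2r ?nnegrE ?expR_ge0 // ?(ltW p0) //.
by rewrite expR_ge1Dx.
Unshelve. all: by end_near. Qed.
End ExpLimit.

(** * Quadratic forms and the minimum eigenvalue *)

Section Quad.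
Variables (C : numClosedFieldType) (n : nat).
Implicit Types (A M : 'M[C]_n.+1) (u : 'cV[C]_n.+1).

Definition unit_vec u := (u^t* *m u) 0 0 = 1.
Definition quad A u : C := (u^t* *m A *m u) 0 0.

Lemma adjvE u : adjv Num.conj u = u^t*.
Proof. by apply/rowP => j; rewrite !mxE. Qed.

Lemma quadD A M u : quad (A + M) u = quad A u + quad M u.
Proof. by rewrite /quad mulmxDr mulmxDl mxE. Qed.

Lemma quadZ c A u : quad (c *: A) u = c * quad A u.
Proof. by rewrite /quad -scalemxAr -scalemxAl mxE. Qed.

Lemma quad_sum (I : finType) (F : I -> 'M[C]_n.+1) u :
  quad (\sum_i F i) u = \sum_i quad (F i) u.
Proof. by rewrite /quad mulmx_sumr mulmx_suml summxE. Qed.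

Lemma quad1 u : unit_vec u -> quad 1 u = 1.
Proof. by rewrite /quad mulmx1. Qed.

Lemma quad_lam M u : M^t* = M ->
  quad M u = \sum_k lam M k * `|(specP M *m u) k 0| ^+ 2.
Proof.
move=> Mh; rewrite /quad {1}(spectralE Mh) /spec_apply !mulmxA.
have -> : u^t* *m (specP M)^t* = (specP M *m u)^t* by rewrite trmx_mul map_mxM.
rewrite -mulmxA mxE; apply: eq_bigr => k _.
by rewrite mul_mx_diag !mxE normCK mulrAC mulrC mulrA mulrAC mulrA.
Qed.

Lemma unit_specP M u : unit_vec u -> \sum_k `|(specP M *m u) k 0| ^+ 2 = 1.
Proof.
rewrite /unit_vec => <-.
have <- : (specP M *m u)^t* *m (specP M *m u) = u^t* *m u.
  by rewrite trmx_mul map_mxM -mulmxA (mulmxA (specP M ^t*)) specPV mul1mx.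
by rewrite mxE; apply: eq_bigr => k _; rewrite !mxE normCK mulrC.
Qed.

Definition evec M k : 'cV[C]_n.+1 := (row k (specP M))^t*.

Lemma specP_evec M k : specP M *m evec M k = delta_mx k 0.
Proof.
have := specVP M => /matrixP H; apply/matrixP => i j.
have := H i k; rewrite !mxE ord1 eqxx andbT => <-.
by apply: eq_bigr => l _; rewrite !mxE.
Qed.

Lemma unit_evec M k : unit_vec (evec M k).
Proof.
have := specVP M => /matrixP /(_ k k); rewrite !mxE eqxx /= /unit_vec => H.
by rewrite mxE -[RHS]H; apply: eq_bigr => l _; rewrite !mxE conjCK.
Qed.

Lemma quad_evec M k : M^t* = M -> quad M (evec M k) = lam M k.
Proof.
move=> Mh; rewrite quad_lam // (bigD1 k) //= specP_evec mxE !eqxx normr1 expr1n mulr1.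
by rewrite big1 ?addr0 // => i ik; rewrite mxE (negbTE ik) normr0 expr0n mulr0.
Qed.

Lemma mul_specP M : M^t* = M -> specP M *m M = diagR (lam M) *m specP M.
Proof.
by move=> Mh; rewrite [in X in _ *m X](spectralE Mh) /spec_apply !mulmxA specVP mul1mx.
Qed.

Lemma mul_specPt M : M^t* = M -> M *m (specP M)^t* = (specP M)^t* *m diagR (lam M).
Proof.
by move=> Mh; rewrite [in X in X *m _](spectralE Mh) /spec_apply -!mulmxA specVP mulmx1.
Qed.

(** [eigenvalue] is about row vectors [v]; the coordinates [y] of [v] in the eigenbasis turn the
    equation into a diagonal one. *)
Lemma eigenvalue_lam M x : M^t* = M -> eigenvalue M x <-> exists k, lam M k = x.
Proof.
move=> Mh; split=> [/eigenvalueP[v vM v0]|[k <-]].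
- pose y := v *m (specP M)^t*.
  have yE : v = y *m specP M by rewrite /y -mulmxA specPV mulmx1.
  have /rV0Pn[k yk] : y != 0 by apply: contraNneq v0 => y0; rewrite yE y0 mul0mx.
  exists k; have : y *m diagR (lam M) = x *: y.
    by rewrite /y scalemxAl -vM -!mulmxA mul_specPt.
  clearbody y; move=> /rowP/(_ k); rewrite mul_mx_diag !mxE => /eqP.
  by rewrite mulrC -subr_eq0 -mulrBl mulf_eq0 (negbTE yk) orbF subr_eq0 => /eqP.
- apply/eigenvalueP; exists (row k (specP M)).
    by rewrite -row_mul mul_specP //; apply/rowP => j; rewrite mxE mul_diag_mx !mxE.
  apply: contraPneq (unit_evec M k) => rk; rewrite /unit_vec /evec rk.
  rewrite mxE big1 => [/esym/eqP|l _]; first by rewrite oner_eq0.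
  by rewrite !mxE conjC0 mulr0.
Qed.

End Quad.

(* The two instances of interest have [C := R[i]] with its real part; keeping [C]
   abstract avoids unfolding the field structure of [R[i]] during unification. *)
Record scalars (R : realType) (C : numClosedFieldType) := Scalars {
  re : C -> R;
  emb : {rmorphism R -> C};
  reD : forall x y, re (x + y) = re x + re y;
  re_embM : forall x z, re (emb x * z) = x * re z;
  re_ge0 : forall z, 0 <= z -> 0 <= re z;
  emb_re : forall z, z \is Num.real -> emb (re z) = z;
  emb_real : forall x, emb x \is Num.real;
  re1 : re 1 = 1 }.

Section LMin.
Variables (R : realType) (C : numClosedFieldType) (K : scalars R C) (n : nat).
Local Notation re := (re K).
Local Notation emb := (emb K).
Implicit Types (A M : 'M[C]_n.+1) (u : 'cV[C]_n.+1).

Lemma re_emb x : re (emb x) = x.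
Proof. by rewrite -[emb x]mulr1 re_embM re1 mulr1. Qed.

Lemma re0 : re 0 = 0.
Proof. by rewrite -(rmorph0 emb) re_emb. Qed.

Lemma re_sum (I : finType) (F : I -> C) : re (\sum_i F i) = \sum_i re (F i).
Proof. exact: (big_morph re (reD K) re0). Qed.

Lemma reN z : re (- z) = - re z.
Proof. by rewrite -mulN1r -(rmorphN1 emb) re_embM mulN1r. Qed.

Definition lamR M k := re (lam M k).
Definition qform M u := re (quad M u).

Lemma emb_lamR M k : M^t* = M -> emb (lamR M k) = lam M k.
Proof. by move=> Mh; rewrite emb_re // lam_real. Qed.

Lemma qD A M u : qform (A + M) u = qform A u + qform M u.
Proof. by rewrite /qform quadD reD. Qed.

Lemma qZ c A u : qform (emb c *: A) u = c * qform A u.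
Proof. by rewrite /qform quadZ re_embM. Qed.

Lemma q_sum (I : finType) (F : I -> 'M[C]_n.+1) u : qform (\sum_i F i) u = \sum_i qform (F i) u.
Proof. by rewrite /qform quad_sum re_sum. Qed.

Lemma q1 u : unit_vec u -> qform 1 u = 1.
Proof. by move=> u1; rewrite /qform quad1 // re1. Qed.

Lemma q_evec M k : M^t* = M -> qform M (evec M k) = lamR M k.
Proof. by move=> Mh; rewrite /qform quad_evec. Qed.

Definition argmin_lam M := [arg min_(k < ord0) lamR M k]%O.

Lemma lamR_ge M k : lamR M (argmin_lam M) <= lamR M k.
Proof. by rewrite /argmin_lam; case: arg_minP => // i _; apply. Qed.

Lemma lminE M : M^t* = M -> lmin emb M = lamR M (argmin_lam M).
Proof.
move=> Mh; rewrite /lmin; apply/eqP; rewrite eq_le; apply/andP; split.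
  apply: inf_lbound; last by apply/(eigenvalue_lam _ Mh); exists (argmin_lam M); rewrite emb_lamR.
  exists (lamR M (argmin_lam M)) => x /= /(eigenvalue_lam _ Mh)[k kx].
  by rewrite -[x]re_emb -kx lamR_ge.
apply: lb_le_inf => [|x /= /(eigenvalue_lam _ Mh)[k kx]].
  exists (lamR M (argmin_lam M)).
  by apply/(eigenvalue_lam _ Mh); exists (argmin_lam M); rewrite emb_lamR.
by rewrite -[x]re_emb -kx lamR_ge.
Qed.

Lemma lmin_evec M : M^t* = M -> exists2 u, unit_vec u & qform M u = lmin emb M.
Proof.
move=> Mh; exists (evec M (argmin_lam M)); first exact: unit_evec.
by rewrite q_evec // lminE.
Qed.

(** In an eigenbasis the form is an average of the eigenvalues with weights summing to one. Together
    with [lmin_evec] this is the variational principle by which different matrices are compared. *)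
Lemma lmin_le_q M u : M^t* = M -> unit_vec u -> lmin emb M <= qform M u.
Proof.
move=> Mh u1; rewrite lminE // /qform quad_lam // -subr_ge0.
have -> : re (\sum_k lam M k * `|(specP M *m u) k 0| ^+ 2) - lamR M (argmin_lam M)
  = \sum_k (lamR M k - lamR M (argmin_lam M)) * re (`|(specP M *m u) k 0| ^+ 2).
  have E : 1 = \sum_k re (`|(specP M *m u) k 0| ^+ 2) by rewrite -re_sum unit_specP ?re1.
  rewrite re_sum -[X in _ - X]mulr1 E mulr_sumr -sumrB; apply: eq_bigr => k _.
  by rewrite -emb_lamR // re_embM mulrBl.
apply: sumr_ge0 => k _; apply: mulr_ge0; first by rewrite subr_ge0 lamR_ge.
by rewrite re_ge0 // exprn_ge0.
Qed.

Definition herm M := M^t* = M.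

Lemma hermD A M : herm A -> herm M -> herm (A + M).
Proof. by move=> Ah Mh; rewrite /herm raddfD raddfD /= Ah Mh. Qed.

Lemma hermZ c A : herm A -> herm (emb c *: A).
Proof.
move=> Ah; apply/matrixP => i j; rewrite !mxE rmorphM /= (CrealP (emb_real K c)).
by rewrite -{2}Ah !mxE.
Qed.

Lemma herm1 : herm 1.
Proof. by rewrite /herm trmx1 map_mx1. Qed.

Lemma herm_sum (I : finType) (F : I -> 'M[C]_n.+1) :
  (forall i, herm (F i)) -> herm (\sum_i F i).
Proof. by move=> Fh; apply: big_ind => //; [rewrite /herm trmx0 map_mx0 | exact: hermD]. Qed.

Lemma eigenvalueZ M c x : eigenvalue M x -> eigenvalue (c *: M) (c * x).
Proof.
move=> /eigenvalueP[v vM v0]; apply/eigenvalueP; exists v => //.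
by rewrite -scalemxAr vM scalerA.
Qed.

Definition trexp M : R := \sum_k expR (lamR M k).

Lemma trexp_ge0 M : 0 <= trexp M.
Proof. by apply: sumr_ge0 => k _; exact: expR_ge0. Qed.

Lemma expR_lam_le_trexp M k : expR (lamR M k) <= trexp M.
Proof.
by rewrite /trexp (bigD1 k) //= lerDl; apply: sumr_ge0 => i _; exact: expR_ge0.
Qed.

Lemma trexp_le M c : herm M -> (forall u, unit_vec u -> qform M u <= c) ->
  trexp M <= n.+1%:R * expR c.
Proof.
move=> Mh qc; apply: (@le_trans _ _ (\sum_(k < n.+1) expR c)).
  by apply: ler_sum => k _; rewrite ler_expR -q_evec //; apply/qc/unit_evec.
by rewrite sumr_const card_ord mulr_natl.
Qed.

Lemma lmin_eigenvalue M : herm M -> eigenvalue M (emb (lmin emb M)).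
Proof.
move=> Mh; apply/(eigenvalue_lam _ Mh).
by exists (argmin_lam M); rewrite lminE // emb_lamR.
Qed.

(** With [trexp_le_lmin], the trace exponential determines the minimum eigenvalue up to a factor n +
    1 in exponential scale. The lower bound serves for Y and the upper bound for Z, where the
    dimension enters. *)
Lemma expR_lmin_le_trexp M th : herm M ->
  expR (- th * lmin emb M) <= trexp (emb (- th) *: M).
Proof.
move=> Mh; have := eigenvalueZ (emb (- th)) (lmin_eigenvalue Mh).
rewrite -rmorphM => /(eigenvalue_lam _ (hermZ _ Mh))[k kE].
by rewrite -[X in expR X]re_emb -kE; exact: expR_lam_le_trexp.
Qed.

Lemma trexp_le_lmin M th : herm M -> 0 <= th ->
  trexp (emb (- th) *: M) <= n.+1%:R * expR (- th * lmin emb M).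
Proof.
move=> Mh th0; apply: trexp_le => [|u u1]; first exact: hermZ.
by rewrite qZ !mulNr lerN2 ler_wpM2l // lmin_le_q.
Qed.

Lemma spec_affine M c : herm M ->
  1 + emb c *: M = spec_apply M (fun k => emb (1 + c * lamR M k)).
Proof.
move=> Mh; rewrite -[1](spec_apply1 M) [in LHS]/spec_apply [in X in _ *: X](spectralE Mh) /spec_apply.
rewrite scalemxAl scalemxAr -mulmxDl -mulmxDr; congr (_ *m _ *m _).
apply/matrixP => i j; rewrite !mxE; case: eqVneq => _; last by rewrite !mulr0n mulr0 addr0.
by rewrite !mulr1n rmorphD rmorph1 rmorphM /= emb_lamR.
Qed.

End LMin.

(** * Interpolation inequalities for the trace exponential, by a limit of polynomials *)

Section TraceExp.
Variables (R : realType) (C : numClosedFieldType) (K : scalars R C) (n : nat).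
Local Notation re := (re K).
Local Notation emb := (emb K).
Implicit Types (A H M : 'M[C]_n.+1) (u : 'cV[C]_n.+1).

Lemma emb_ge0 x : 0 <= x -> 0 <= emb x.
Proof.
move=> x0; rewrite -(sqr_sqrtr x0) rmorphXn /=.
by rewrite real_exprn_even_ge0 // emb_real.
Qed.

Lemma tr_mul_spec A M f : \tr (A * spec_apply M f) =
  \sum_k (specP M *m A *m (specP M)^t*) k k * f k.
Proof.
rewrite -mulmxE /spec_apply !mulmxA mxtrace_mulC !mulmxA /mxtrace.
by apply: eq_bigr => k _; rewrite mul_mx_diag !mxE.
Qed.

(** Interpolation takes place over [R], whereas traces of powers have coefficients in [C]; at a real
    point this takes the real part of the value. *)
Definition re_poly (p : {poly C}) : {poly R} := \poly_(i < size p) re p`_i.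

Lemma re_polyE p i : (re_poly p)`_i = re p`_i.
Proof.
by rewrite coef_poly; case: ltnP => // ?; rewrite nth_default // re0.
Qed.

Lemma horner_re_poly p x : (re_poly p).[x] = re p.[emb x].
Proof.
rewrite (horner_coef_wide _ (size_poly _ _)) horner_coef re_sum.
by apply: eq_bigr => i _; rewrite re_polyE -rmorphXn mulrC -re_embM mulrC.
Qed.

Lemma deriv_re_poly p : (re_poly p)^`() = re_poly p^`().
Proof.
apply/polyP => i; rewrite coef_deriv !re_polyE coef_deriv.
have E : emb i.+1%:R = i.+1%:R by rewrite rmorph_nat.
by rewrite -[LHS]mulr_natl -[in RHS]mulr_natl -E re_embM.
Qed.

Lemma derivn_re_poly p k : (re_poly p)^`(k) = re_poly p^`(k).
Proof. by elim: k => // k IH; rewrite !derivnS IH deriv_re_poly. Qed.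

(* [x |-> (1 + x / N)^N] replaces the exponential; [N - 4] has to be odd for
   [tr_wordsum_ge0] to apply to its fourth derivative. *)
Definition odd_deg q := (q.*2.+1 + 4)%N.

Lemma odd_deg_inv : ((odd_deg q)%:R^-1 : R) @[q --> \oo] --> (0 : R).
Proof.
apply: (squeeze_cvgr _ (cvg_cst 0) (@cvg_harmonic R)); apply: nearW => q.
by rewrite invr_ge0 ler0n /= lef_pV2 ?posrE ?ltr0n // ler_nat /odd_deg; lia.
Qed.

Lemma odd_deg_pow (x : R) : (1 + (odd_deg q)%:R^-1 * x) ^+ odd_deg q @[q --> \oo] --> expR x.
Proof.
under eq_fun do rewrite mulrC.
apply: expR_cvg; [by [] | exact: odd_deg_inv |].
by under eq_fun do rewrite divff ?pnatr_eq0 //; exact: cvg_cst.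
Qed.

Lemma odd_deg_pow1 (x : R) : (1 + (odd_deg q)%:R^-1 * x) ^+ (odd_deg q).-1 @[q --> \oo] --> expR x.
Proof.
under eq_fun do rewrite mulrC.
apply: expR_cvg; [by [] | exact: odd_deg_inv |].
under eq_fun => q.
  have -> : (odd_deg q).-1%:R / (odd_deg q)%:R = 1 - (odd_deg q)%:R^-1 :> R.
    by rewrite -subn1 natrB // mulrBl mul1r divff ?pnatr_eq0.
  over.
have : (1 : R) - (odd_deg q)%:R^-1 @[q --> \oo] --> (1 - 0 : R).
  by apply: cvgB; [exact: cvg_cst | exact: odd_deg_inv].
by rewrite subr0.
Qed.

Variables (H A : 'M[C]_n.+1).
Hypotheses (Hh : herm H) (Ah : herm A) (A0 : forall u, unit_vec u -> 0 <= qform K A u).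

Lemma cvg_bigsum (I : finType) (F : I -> nat -> R) (l : I -> R) :
  (forall i, F i q @[q --> \oo] --> l i) ->
  \sum_i F i q @[q --> \oo] --> \sum_i l i.
Proof.
move=> Fl; have -> : (fun q => \sum_i F i q) = \sum_i F i.
  by apply/funext => q; rewrite fct_sumE.
elim/big_ind2 : _ => [|f1 l1 f2 l2 h1 h2|i _]; [exact: cvg_cst | exact: cvgD | exact: Fl].
Qed.

Definition line w := H - emb w *: A.
Definition phi w := trexp K (line w).
(** This is - tr (A exp(H - w A)). It enters as the limit of the derivatives of [approx];
    differentiability of [phi] is never invoked. *)
Definition dphi w := - \sum_k re ((specP (line w) *m A *m (specP (line w))^t*) k k)
   * expR (lamR K (line w) k).

Lemma herm_line w : herm (line w).
Proof. by rewrite /line -scaleNr -rmorphN; apply: hermD => //; exact: hermZ. Qed.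

Lemma q_line w u : qform K (line w) u = qform K H u - w * qform K A u.
Proof. by rewrite /line -scaleNr -rmorphN qD qZ mulNr. Qed.

Definition approx q : {poly R} := re_poly
  (trpow (1 + emb (odd_deg q)%:R^-1 *: H) (emb (odd_deg q)%:R^-1 *: A) (odd_deg q)).

Lemma approx_line q w : 1 + emb (odd_deg q)%:R^-1 *: H - emb w *: (emb (odd_deg q)%:R^-1 *: A)
  = 1 + emb (odd_deg q)%:R^-1 *: line w.
Proof. by rewrite -addrA scalerA mulrC -scalerA -scalerBr. Qed.

Lemma approxE q w : (approx q).[w] =
  \sum_k (1 + (odd_deg q)%:R^-1 * lamR K (line w) k) ^+ odd_deg q.
Proof.
rewrite horner_re_poly trpowE approx_line spec_affine; last exact: herm_line.
rewrite spec_applyX tr_spec_apply re_sum; apply: eq_bigr => k _.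
by rewrite -rmorphXn re_emb.
Qed.

Lemma approx_cvg w : (approx q).[w] @[q --> \oo] --> phi w.
Proof.
under eq_fun do rewrite approxE.
by apply: (cvg_bigsum (F := fun k q => (1 + (odd_deg q)%:R^-1 * _) ^+ odd_deg q)) => k; exact: odd_deg_pow.
Qed.

Lemma approx_derivE q w : (approx q)^`().[w] =
  - \sum_k re ((specP (line w) *m A *m (specP (line w))^t*) k k)
     * (1 + (odd_deg q)%:R^-1 * lamR K (line w) k) ^+ (odd_deg q).-1.
Proof.
rewrite deriv_re_poly horner_re_poly.
have -> B D N x : (0 < N)%N ->
  (trpow B D N)^`().[x] = - \tr (D * (B - x *: D) ^+ N.-1) *+ N.
  by case: N => // N _; exact: trpow_derivE.
rewrite approx_line.
rewrite spec_affine; last exact: herm_line.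
have E : emb (odd_deg q)%:R^-1 * (odd_deg q)%:R = 1.
  by rewrite -[X in _ * X](rmorph_nat emb) -rmorphM mulVf ?rmorph1 ?pnatr_eq0.
have aux (x : C) : (- (emb (odd_deg q)%:R^-1 * x)) *+ odd_deg q = - x.
  by rewrite -[LHS]mulr_natr mulNr mulrAC E mul1r.
rewrite spec_applyX -scalerAl mxtraceZ tr_mul_spec aux.
rewrite reN re_sum; congr (- _); apply: eq_bigr => k _.
by rewrite mulrC -rmorphXn re_embM mulrC.
by []. Qed.

Lemma approx_deriv_cvg w : (approx q)^`().[w] @[q --> \oo] --> dphi w.
Proof.
under eq_fun do rewrite approx_derivE.
apply: cvgN; apply: (cvg_bigsum (F := fun k q => _ * (1 + (odd_deg q)%:R^-1 * _) ^+ (odd_deg q).-1)) => k.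
by apply: cvgM; [exact: cvg_cst | exact: odd_deg_pow1].
Qed.

(** For w in a bounded interval H - w A is bounded below, so 1 + (H - w A) / N is positive
    semidefinite for large N, uniformly in w. *)
Lemma approx_nonneg lo hi : \forall q \near \oo, nonneg_on (approx q)^`(4) lo hi.
Proof.
(* [lmin emb (emb (-1) *: A)] is minus the largest eigenvalue of [A]. *)
pose c := `|lmin emb H| + (`|lo| + `|hi|) * `|lmin emb (emb (-1) *: A)|.
have c0 : 0 <= c by rewrite addr_ge0 // mulr_ge0 // addr_ge0.
have cE w u : lo <= w <= hi -> unit_vec u -> - c <= qform K (line w) u.
  move=> /andP[low whi] u1; rewrite q_line /c.
  have h1 := lmin_le_q K Hh u1.
  have h2 := lmin_le_q K (hermZ K (-1) Ah) u1; rewrite qZ mulN1r in h2.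
  have h3 := A0 u1.
  have wb : `|w| <= `|lo| + `|hi|.
    rewrite ler_norml; apply/andP; split.
      rewrite opprD -[w]addr0 lerD ?oppr_le0 //; apply: le_trans low.
      by rewrite lerNl -normrN ler_norm.
    by apply: (le_trans whi); apply: (le_trans (ler_norm _)); rewrite lerDr.
  have h4 : qform K A u <= `|lmin emb (emb (-1) *: A)|.
    have := ler_norm (- lmin emb (emb (-1) *: A)); rewrite normrN.
    by apply: le_trans; rewrite lerNr.
  have h5 : `|w * qform K A u| <= (`|lo| + `|hi|) * `|lmin emb (emb (-1) *: A)|.
    by rewrite normrM (ger0_norm h3); apply: ler_pM.
  rewrite opprD; apply: lerD; last by rewrite lerN2; apply: le_trans h5; exact: ler_norm.
  by apply: le_trans h1; rewrite lerNl -normrN; exact: ler_norm.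
have : \forall p \near \oo, (odd_deg p)%:R^-1 * c <= (1 : R).
  have : (odd_deg p)%:R^-1 * c @[p --> \oo] --> (0 * c : R).
    by apply: cvgM; [exact: odd_deg_inv | exact: cvg_cst].
  by rewrite mul0r => /cvgr_le; apply.
apply: filterS => p pc w wI; rewrite derivn_re_poly horner_re_poly re_ge0 //.
apply: trpow_deriv4_ge0.
- exact: emb_real.
- by apply: hermD; [exact: herm1 | exact: hermZ].
- exact: hermZ.
move=> k; rewrite approx_line; set M := 1 + _.
have Mh : herm M by apply: hermD; [exact: herm1 | apply/hermZ/herm_line].
rewrite -(emb_lamR K k Mh) -q_evec //.
apply: emb_ge0.
rewrite /M qD qZ q1 ?unit_evec //; last exact: unit_evec.
have := cE w _ wI (unit_evec M k).
have : 0 <= (odd_deg p)%:R^-1 :> R by rewrite invr_ge0.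
move: pc; set x := _^-1; set y := qform K _ _; nra.
Qed.

Lemma cvg_slope (f1 f2 : nat -> R) l1 l2 y1 y2 :
  f1 q @[q --> \oo] --> l1 -> f2 q @[q --> \oo] --> l2 ->
  slope (f1 q) (f2 q) y1 y2 @[q --> \oo] --> slope l1 l2 y1 y2.
Proof. by move=> h1 h2; apply: cvgM; [exact: cvgB | exact: cvg_cst]. Qed.

(** The interpolant is continuous in the data at the nodes, so the inequality for [approx q]
    survives the limit. The interval [lo, hi] encloses the nodes and [w]. *)
Lemma phi_hermite3 (y1 y2 w : R) : y1 < y2 ->
  hermite3 (phi y1) (phi y2) (dphi y1) (dphi y2) y1 y2 w <= phi w.
Proof.
move=> y12.
pose lo := Num.min y1 w; pose hi := Num.max y2 w.
have s12 : slope (approx q).[y1] (approx q).[y2] y1 y2 @[q --> \oo]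
    --> slope (phi y1) (phi y2) y1 y2 by apply: cvg_slope; exact: approx_cvg.
have k1 : dd_left (approx q).[y1] (approx q).[y2] (approx q)^`().[y1] y1 y2 @[q --> \oo]
    --> dd_left (phi y1) (phi y2) (dphi y1) y1 y2.
  by apply: cvgM; [apply: cvgB => //; exact: approx_deriv_cvg | exact: cvg_cst].
have k2 : dd_right (approx q).[y1] (approx q).[y2] (approx q)^`().[y2] y1 y2 @[q --> \oo]
    --> dd_right (phi y1) (phi y2) (dphi y2) y1 y2.
  by apply: cvgM; [apply: cvgB => //; exact: approx_deriv_cvg | exact: cvg_cst].
apply: (@ler_cvg_to _ \oo _ _ (fun q => hermite3 (approx q).[y1] (approx q).[y2]
    (approx q)^`().[y1] (approx q)^`().[y2] y1 y2 w) (fun q => (approx q).[w])).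
- apply: cvgD.
    by apply: cvgD; [exact: approx_cvg | apply: cvgM => //; exact: cvg_cst].
  apply: cvgM; last exact: cvg_cst.
  apply: cvgD => //; apply: cvgM; last exact: cvg_cst.
  by apply: cvgM; [exact: cvgB | exact: cvg_cst].
- exact: approx_cvg.
- apply: filterS (approx_nonneg lo hi) => q p0; apply: (hermite3_le p0 y12).
  + by rewrite ge_min lexx /= le_max (ltW y12).
  + by rewrite ge_min (ltW y12) /= le_max lexx.
  + by rewrite ge_min lexx orbT /= le_max lexx orbT.
Qed.

Lemma phi_hermite2 (y1 y2 z w : R) : y1 < y2 -> y2 < z -> y1 <= w <= z ->
  phi w <= hermite2 (phi y1) (phi y2) (dphi y2) y1 y2 w
    + dd_tail (phi y1) (phi y2) (phi z) (dphi y2) y1 y2 z * ((w - y1) * (w - y2) ^+ 2).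
Proof.
move=> y12 y2z wI.
have s12 : slope (approx q).[y1] (approx q).[y2] y1 y2 @[q --> \oo]
    --> slope (phi y1) (phi y2) y1 y2 by apply: cvg_slope; exact: approx_cvg.
have s1z : slope (approx q).[y1] (approx q).[z] y1 z @[q --> \oo]
    --> slope (phi y1) (phi z) y1 z by apply: cvg_slope; exact: approx_cvg.
have k2 : dd_right (approx q).[y1] (approx q).[y2] (approx q)^`().[y2] y1 y2 @[q --> \oo]
    --> dd_right (phi y1) (phi y2) (dphi y2) y1 y2.
  by apply: cvgM; [apply: cvgB => //; exact: approx_deriv_cvg | exact: cvg_cst].
apply: (@ler_cvg_to _ \oo _ _ (fun q => (approx q).[w])
   (fun q => hermite2 (approx q).[y1] (approx q).[y2] (approx q)^`().[y2] y1 y2 w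
    + dd_tail (approx q).[y1] (approx q).[y2] (approx q).[z] (approx q)^`().[y2] y1 y2 z
      * ((w - y1) * (w - y2) ^+ 2))).
- exact: approx_cvg.
- apply: cvgD.
    apply: cvgD; last by apply: cvgM => //; exact: cvg_cst.
    by apply: cvgD; [exact: approx_cvg | apply: cvgM => //; exact: cvg_cst].
  apply: cvgM; last exact: cvg_cst.
  apply: cvgM; last exact: cvg_cst.
  apply: cvgB => //; apply: cvgM; last exact: cvg_cst.
  exact: cvgB.
- by apply: filterS (approx_nonneg y1 z) => q p0; apply: (hermite2_ge p0).
Qed.
End TraceExp.

(** * The last interpolation node at infinity *)

Section Tail.
Variable R : realType.
Implicit Types (f d y z w s k c D E : R).

Lemma dd_tail_le f1 f2 f3 d2 y1 y2 z c : y1 < y2 -> y2 + 1 <= z -> `|f3| <= c ->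
  dd_tail f1 f2 f3 d2 y1 y2 z <=
  ((c + `|f1|) / (y2 - y1) + `|slope f1 f2 y1 y2| + `|dd_right f1 f2 d2 y1 y2|) / (z - y2).
Proof.
move=> y12 y2z f3c; rewrite /dd_tail; set s := slope f1 f2 _ _; set k := dd_right _ _ _ _ _.
have zy : 1 <= z - y2 by lra.
rewrite ler_pM2r ?invr_gt0; last by lra.
apply: le_trans (ler_norm _) _; apply: le_trans (ler_normB _ _) _.
rewrite lerD2r; rewrite normrM normfV (ger0_norm (_ : 0 <= z - y2)); last by lra.
rewrite ler_pdivrMr; last by lra.
apply: (@le_trans _ _ ((c + `|f1|) / (y2 - y1) + `|s|)); last first.
  rewrite ler_peMr // addr_ge0 // divr_ge0 ?subr_ge0 ?(ltW y12) //.
  by rewrite addr_ge0 // (le_trans _ f3c).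
apply: le_trans (ler_normB _ _) _; rewrite lerD2r /slope normrM normfV.
rewrite (ger0_norm (_ : 0 <= z - y1)); last by lra.
apply: ler_pM => //; first by rewrite invr_ge0; lra.
  by apply: le_trans (ler_normB _ _) _; rewrite lerD2r.
by rewrite lef_pV2 ?posrE; lra.
Qed.

Lemma le_of_tail x D z0 E : 0 <= D -> 0 <= E ->
  (forall z, z0 + 1 <= z -> x <= D / (z - z0) * E) -> x <= 0.
Proof.
move=> D0 E0 H; rewrite leNgt; apply/negP => x0.
(* At z = z0 + t the assumption reads x t <= D E, whereas x t = x + D E. *)
pose t := 1 + D * E / x; have t1 : 1 <= t.
  by rewrite /t lerDl divr_ge0 ?mulr_ge0 // ltW.
have := H (z0 + t); rewrite lerD2l => /(_ t1).
rewrite addrC addKr mulrAC ler_pdivlMr; last by lra.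
by rewrite /t mulrDr mulr1 mulrCA divff ?gt_eqF // mulr1; lra.
Qed.

Lemma quadratic_coef_ge0 f s k y1 y2 : y1 < y2 ->
  (forall w, y1 <= w -> 0 <= f + s * (w - y1) + k * ((w - y1) * (w - y2))) -> 0 <= k.
Proof.
move=> y12 H; rewrite leNgt; apply/negP => k0.
pose d := y2 - y1; have d0 : 0 < d by rewrite subr_gt0.
(* Chosen so that s + k t <= - 1 - |f| / d, which makes f + (d + t)(s + k t) negative. *)
pose t := (1 + `|f| / d + `|s|) / - k.
have t0 : 0 <= t by rewrite divr_ge0 ?oppr_ge0 ?(ltW k0) // !addr_ge0 // divr_ge0 // ltW.
have kt : k * t = - (1 + `|f| / d + `|s|).
  have kn0 : k != 0 by rewrite lt_eqF.
  by rewrite /t; move: (_ + _ + _) => v; field.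
have := H (y2 + t); have -> : y2 + t - y1 = d + t by rewrite /d; ring.
have -> : y2 + t - y2 = t by ring.
have -> : f + s * (d + t) + k * ((d + t) * t) = f + (d + t) * (s + k * t) by ring.
rewrite kt => /(_ _)/wrap[]; first by lra.
apply/negP; rewrite -ltNge.
have h1 : (d + t) * (s - (1 + `|f| / d + `|s|)) <= d * (s - (1 + `|f| / d + `|s|)).
  rewrite ler_wnM2r; last by lra.
    by [].
  have := ler_norm s; have : 0 <= `|f| / d by rewrite divr_ge0 // ltW.
  lra.
have h2 : d * (s - (1 + `|f| / d + `|s|)) = d * (s - `|s|) - d - `|f|.
  by field; rewrite gt_eqF.
have h3 : d * (s - `|s|) <= 0.
  by rewrite pmulr_rle0 // subr_le0 ler_norm.
have := ler_norm f; lra.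
Qed.

End Tail.

Section Phi.
Variables (R : realType) (C : numClosedFieldType) (K : scalars R C) (n : nat).
Local Notation re := (re K).
Local Notation emb := (emb K).
Variables (H A : 'M[C]_n.+1).
Hypotheses (Hh : herm H) (Ah : herm A) (A0 : forall u, unit_vec u -> 0 <= qform K A u).
Local Notation phi := (phi K H A).
Local Notation dphi := (dphi K H A).

Lemma phi_ge0 w : 0 <= phi w. Proof. exact: trexp_ge0. Qed.

Lemma phi_bounded : exists c, forall z, 0 <= z -> `|phi z| <= c.
Proof.
exists (n.+1%:R * expR (- lmin emb (emb (-1) *: H))) => z z0.
rewrite ger0_norm ?phi_ge0 //; apply: trexp_le => [|u u1]; first exact: herm_line.
have := lmin_le_q K (hermZ K (-1) Hh) u1; rewrite qZ mulN1r q_line => h.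
have : 0 <= z * qform K A u by rewrite mulr_ge0 // A0.
lra.
Qed.

(** As z tends to +oo in [phi_hermite2], the tail term disappears because [phi] is bounded. The
    leading coefficient is nonnegative since the quadratic dominates the nonnegative [phi] on a
    half-line. *)
Lemma phi_upper (y1 y2 : R) : y1 < y2 -> exists2 k, 0 <= k & forall w, y1 <= w ->
  phi w <= phi y1 + slope (phi y1) (phi y2) y1 y2 * (w - y1) + k * ((w - y1) * (w - y2)).
Proof.
move=> y12; have [c cE] := phi_bounded.
pose k := dd_right (phi y1) (phi y2) (dphi y2) y1 y2.
have Hk w : y1 <= w -> phi w <= phi y1 + slope (phi y1) (phi y2) y1 y2 * (w - y1)
    + k * ((w - y1) * (w - y2)).
  move=> y1w; rewrite -subr_le0.
  (* The 0 keeps z in the half-line covered by [phi_bounded]. *)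
  pose z0 := Num.max (Num.max y2 w) 0.
  have E0 : 0 <= (w - y1) * (w - y2) ^+ 2 by rewrite mulr_ge0 ?subr_ge0 ?sqr_ge0.
  pose D := (c + `|phi y1|) / (y2 - y1) + `|slope (phi y1) (phi y2) y1 y2| + `|k|.
  have c0 : 0 <= c by apply: le_trans (cE 0 (lexx _)).
  have D0 : 0 <= D.
    have h : 0 <= y2 - y1 by rewrite subr_ge0 ltW.
    by apply: addr_ge0 => //; apply: addr_ge0 => //; apply: divr_ge0 => //; apply: addr_ge0.
  apply: (@le_of_tail _ _ D z0 _ D0 E0) => z zz.
  have z0y2 : y2 <= z0 by rewrite /z0 !le_max lexx.
  have z0w : w <= z0 by rewrite /z0 !le_max lexx orbT.
  have z00 : 0 <= z0 by rewrite /z0 !le_max lexx orbT.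
  have y2z : y2 < z by lra.
  have wz : y1 <= w <= z by rewrite y1w; lra.
  have h := phi_hermite2 Hh Ah A0 y12 y2z wz.
  rewrite lerBlDl (le_trans h) // lerD2l ler_wpM2r //.
  apply: (@le_trans _ _ (D / (z - y2))).
    by apply: dd_tail_le => //; [lra | apply: cE; lra].
  by rewrite ler_wpM2l // lef_pV2 ?posrE; lra.
exists k => //; apply: (quadratic_coef_ge0 y12) => w y1w.
exact: le_trans (phi_ge0 w) (Hk w y1w).
Qed.
End Phi.

(** * Measurability of spectral functions *)

Section Measurability.
Variables (R : realType) (C : numClosedFieldType) (K : scalars R C) (n : nat).
Local Notation re := (re K).
Local Notation emb := (emb K).
Context d (T : measurableType d).

Lemma measurable_bigsum (I : finType) (F : I -> T -> R) :
  (forall i, measurable_fun setT (F i)) ->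
  measurable_fun setT (fun x => \sum_i F i x).
Proof. by move=> h; apply: measurable_sum. Qed.

Variables (N : nat) (t : 'I_N -> T -> R) (A : 'I_N -> 'M[C]_n.+1) (H : 'M[C]_n.+1).
Hypothesis mt : forall i, measurable_fun setT (t i).
Definition mlin x := H + \sum_i emb (t i x) *: A i.

(** The entries are polynomials in the [t i]. As [re] is not multiplicative, [c] is arbitrary so
    that the induction can absorb the complex entries into it. *)
Lemma measurable_mlin_pow (B : 'M[C]_n.+1) r k (i j : 'I_n.+1) (c : C) :
  measurable_fun setT (fun x => re (c * ((B + emb r *: mlin x) ^+ k) i j)).
Proof.
elim: k i j c => [|k IH] i j c.
  rewrite (_ : (fun x => _) = cst (re (c * (1 : 'M[C]_n.+1) i j))); first exact: measurable_cst.
  by apply/funext => x; rewrite expr0.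
have -> : (fun x => re (c * ((B + emb r *: mlin x) ^+ k.+1) i j)) =
  (fun x => \sum_l (re (c * (B i l + emb r * H i l) * ((B + emb r *: mlin x) ^+ k) l j)
    + \sum_m r * t m x * re (c * A m i l * ((B + emb r *: mlin x) ^+ k) l j))).
  apply/funext => x; rewrite exprS -mulmxE mxE mulr_sumr re_sum; apply: eq_bigr => l _.
  rewrite !mxE summxE; set Q := _ l j.
  have -> : \sum_m (emb (t m x) *: A m) i l = \sum_m emb (t m x) * A m i l.
    by apply: eq_bigr => m _; rewrite mxE.
  have -> : c * ((B i l + emb r * (H i l + \sum_m emb (t m x) * A m i l)) * Q)
    = c * (B i l + emb r * H i l) * Q + emb r * c * Q * (\sum_m emb (t m x) * A m i l) by ring.
  rewrite reD mulr_sumr re_sum; congr (_ + _); apply: eq_bigr => m _.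
  by rewrite -re_embM rmorphM; congr re; ring.
apply: measurable_bigsum => l; apply: measurable_funD; first exact: IH.
apply: measurable_bigsum => m; apply: measurable_funM; last exact: IH.
by apply: measurable_funM => //; exact: measurable_cst.
Qed.

Hypotheses (Ah : forall i, herm (A i)) (Hh : herm H).

Lemma herm_mlin x : herm (mlin x).
Proof. by apply: hermD => //; apply: herm_sum => i; exact: hermZ. Qed.

(** Nothing is known on how the spectral decomposition depends on the matrix. The trace exponential
    is therefore reached as a pointwise limit of traces of powers, which are polynomials in the
    coordinates. *)
Lemma measurable_trexp : measurable_fun setT (fun x => trexp K (mlin x)).
Proof.
apply: (@measurable_fun_cvg _ _ _ _
   (fun k x => re (\tr ((1 + emb (odd_deg k)%:R^-1 *: mlin x) ^+ odd_deg k)))).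
  move=> k; have -> : (fun x => re (\tr ((1 + emb (odd_deg k)%:R^-1 *: mlin x) ^+ odd_deg k)))
    = (fun x => \sum_i re (1 * ((1 + emb (odd_deg k)%:R^-1 *: mlin x) ^+ odd_deg k) i i)).
    by apply/funext => x; rewrite re_sum; apply: eq_bigr => i _; rewrite mul1r.
  by apply: measurable_bigsum => i; exact: measurable_mlin_pow.
move=> x _; have -> : (fun k => re (\tr ((1 + emb (odd_deg k)%:R^-1 *: mlin x) ^+ odd_deg k)))
  = (fun k => \sum_i (1 + (odd_deg k)%:R^-1 * lamR K (mlin x) i) ^+ odd_deg k).
  apply/funext => k; rewrite spec_affine; last exact: herm_mlin.
  rewrite spec_applyX tr_spec_apply re_sum; apply: eq_bigr => i _.
  by rewrite -rmorphXn re_emb.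
apply: (cvg_bigsum (F := fun i k => (1 + (odd_deg k)%:R^-1 * _) ^+ odd_deg k)) => i; exact: odd_deg_pow.
Qed.
End Measurability.

Section MeasurabilityLmin.
Variables (R : realType) (C : numClosedFieldType) (K : scalars R C) (n : nat).
Local Notation emb := (emb K).
Context d (T : measurableType d).
Variables (N : nat) (t : 'I_N -> T -> R) (A : 'I_N -> 'M[C]_n.+1).
Hypothesis mt : forall i, measurable_fun setT (t i).
Hypotheses (Ah : forall i, herm (A i)).

Definition pencilsum (x : 'I_N -> R) := \sum_i emb (x i) *: A i.

Lemma herm_pencilsum x : herm (pencilsum x).
Proof. by apply: herm_sum => i; exact: hermZ. Qed.

Lemma measurable_trexp_pencilsum th :
  measurable_fun setT (fun x => trexp K (emb th *: pencilsum (t^~ x))).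
Proof.
have -> : (fun x => trexp K (emb th *: pencilsum (t^~ x)))
  = (fun x => trexp K (mlin K (fun i x => th * t i x) A 0 x)).
  apply/funext => x; rewrite /mlin add0r /pencilsum scaler_sumr; congr trexp.
  by apply: eq_bigr => i _; rewrite scalerA rmorphM.
apply: measurable_trexp => //; last by rewrite /herm trmx0 map_mx0.
by move=> i; apply: measurable_funM => //; exact: measurable_cst.
Qed.

(** The quantity - (1 / k) ln tr exp(- k M) tends to the minimum eigenvalue, with an error of at
    most ln(n + 1) / k. *)
Lemma measurable_lmin : measurable_fun setT (fun x => lmin emb (pencilsum (t^~ x))).
Proof.
pose h k x : R := - (k.+1%:R^-1 * ln (trexp K (emb (- k.+1%:R) *: pencilsum (t^~ x)))).
apply: (@measurable_fun_cvg _ _ _ _ h).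
  move=> k; apply: measurableT_comp => //; apply: measurable_funM; first exact: measurable_cst.
  apply: measurableT_comp; first exact: measurable_ln.
  exact: measurable_trexp_pencilsum.
move=> x _; set M := pencilsum _; have Mh : herm M by exact: herm_pencilsum.
have lo : lmin emb M - ln n.+1%:R * k.+1%:R^-1 @[k --> \oo] --> lmin emb M.
  have : lmin emb M - ln n.+1%:R * k.+1%:R^-1 @[k --> \oo] --> lmin emb M - ln n.+1%:R * 0.
    by apply: cvgB; [exact: cvg_cst | apply: cvgM; [exact: cvg_cst | exact: cvg_harmonic]].
  by rewrite mulr0 subr0.
apply: (squeeze_cvgr _ lo (cvg_cst (lmin emb M))); apply: nearW => k; rewrite /h -/M.
have k0 : 0 < k.+1%:R :> R by rewrite ltr0n.
have h1 := expR_lmin_le_trexp K k.+1%:R Mh.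
have h2 := trexp_le_lmin K Mh (ltW k0).
have T0 : 0 < trexp K (emb (- k.+1%:R) *: M) by apply: lt_le_trans h1; exact: expR_gt0.
have n0 : 0 < n.+1%:R :> R by rewrite ltr0n.
move: h1; rewrite -ler_ln ?posrE ?expR_gt0 // expRK => h1.
move: h2; rewrite -ler_ln ?posrE ?mulr_gt0 ?expR_gt0 // lnM ?posrE ?expR_gt0 // expRK => h2.
move: h1 h2; set l := ln (trexp _ _); set b := ln _; set a := lmin emb M.
clearbody l b a => h1 h2.
have kn : k.+1%:R != 0 :> R by rewrite gt_eqF.
have i0 : 0 <= k.+1%:R^-1 :> R by rewrite invr_ge0 ltW.
have := ler_wpM2l i0 h1; have := ler_wpM2l i0 h2.
rewrite mulrDr !mulNr !mulrN !mulKf //.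
by rewrite [_ * b]mulrC => {}h2 {}h1; rewrite lerNr opprB h2 lerNl h1.
Qed.
End MeasurabilityLmin.

(** * Univariate comparison with a normal variable *)

Section Normal.
Variables (R : realType) (m s : R).
Local Notation mu := (@lebesgue_measure R).

Lemma integral_normal_prob (f : R -> \bar R) : measurable_fun setT f ->
  (forall x, 0 <= f x)%E ->
  (\int[normal_prob m s]_x f x = \int[mu]_x (f x * (normal_pdf m s x)%:E))%E.
Proof.
move=> mf f0.
have dom := normal_prob_dominates m s.
rewrite -(Radon_Nikodym_SigmaFinite.change_of_variables dom)//=.
apply: ae_eq_integral => //.
- apply: emeasurable_funM => //.
  exact: (measurable_int mu (Radon_Nikodym_SigmaFinite.f_integrable dom)).
- by apply: emeasurable_funM => //; apply/measurable_EFinP; exact: measurable_normal_pdf.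
- apply: ae_eqe_mul2l => /=; apply: integral_ae_eq => //=.
  + exact: Radon_Nikodym_SigmaFinite.f_integrable.
  + by apply/measurable_EFinP; exact: measurable_normal_pdf.
  + by move=> E _ mE; rewrite -Radon_Nikodym_SigmaFinite.f_integral.
Qed.

End Normal.

Section GaussMoments.
Variables (R : realType).
Local Notation mu := (@lebesgue_measure R).

Lemma is_derive_expR_comp (g : R -> R) (x dg : R) :
  is_derive x 1 g dg -> is_derive x 1 (expR \o g) (expR (g x) * dg).
Proof.
move=> dgx; have gd : derivable g x 1 by [].
apply: DeriveDef.
  apply/derivable1_diffP/differentiable_comp; first exact/derivable1_diffP.
  exact/derivable1_diffP/derivable_expR.
rewrite -derive1E (derive1_comp gd (@derivable_expR R (g x))).
congr (_ * _); rewrite derive1E; last by have [_] := dgx.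
by have [_] := is_derive_expR (g x).
Qed.

Lemma is_derive_poly_exp (p e : {poly R}) (x : R) :
  is_derive x 1 (fun y => p.[y] * expR e.[y]) ((p^`() + p * e^`()).[x] * expR e.[x]).
Proof.
have H := is_deriveM (is_derive_poly p x) (is_derive_expR_comp (is_derive_poly e x)).
apply: (is_derive_eq H) => /=; rewrite hornerD hornerM /GRing.scale /=; ring.
Qed.

Lemma continuous_poly_exp (p e : {poly R}) : continuous (fun y => p.[y] * expR e.[y]).
Proof.
move=> x; apply/differentiable_continuous/derivable1_diffP.
by have [] := is_derive_poly_exp p e x.
Qed.

Lemma integral_poly_exp (p e : {poly R}) (a b : R) : a < b ->
  (\int[mu]_(x in `[a, b]) ((p^`() + p * e^`()).[x] * expR e.[x])%:E
   = (p.[b] * expR e.[b] - p.[a] * expR e.[a])%:E)%E.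
Proof.
move=> ab; pose F := fun y => p.[y] * expR e.[y].
rewrite (@continuous_FTC2 _ _ F) // ?EFinB //.
- by apply: continuous_subspaceT; exact: continuous_poly_exp.
- split.
  + by move=> x _; have [] := is_derive_poly_exp p e x.
  + by apply: cvg_at_right_filter; exact: continuous_poly_exp.
  + by apply: cvg_at_left_filter; exact: continuous_poly_exp.
- move=> x _; rewrite derive1E.
  by have [_] := is_derive_poly_exp p e x.
Qed.

Variables (m s : R).
Hypothesis s0 : s != 0.
Local Notation v := (s ^+ 2).

Definition gexp : {poly R} := - ((v *+ 2)^-1 *: ('X - m%:P) ^+ 2).

Lemma normal_pdf_poly x : normal_pdf m s x = normal_peak s * expR gexp.[x].
Proof.
rewrite normal_pdfE // /normal_fun; congr (_ * expR _).
by rewrite /gexp hornerN hornerZ horner_exp hornerXsubC mulNr mulrC.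
Qed.

(** On an interval symmetric about m the odd terms cancel and (x - m)^2 - v integrates to a boundary
    term. This exact formula on bounded intervals replaces the moments of the normal law. *)
Lemma integral_normal_cubic (N a b k beta : R) : 0 < N ->
  (\int[mu]_(x in `[(m - N)%R, (m + N)%R])
     ((a + b * (x - m) + (k + beta * (x - m)) * ((x - m) ^+ 2 - v))%R * normal_pdf m s x)%:E
   = a%:E * \int[mu]_(x in `[(m - N)%R, (m + N)%R]) (normal_pdf m s x)%:E
     - (2 * v * k * N * normal_pdf m s (m + N)%R)%:E)%E.
Proof.
move=> N0; have ab : m - N < m + N by lra.
pose y : {poly R} := 'X - m%:P.
(* The density g satisfies g' = - (x - m) g / v; accordingly [p] exp([gexp]) is a primitive of the
   integrand without its constant term [a]. *)
pose p : {poly R} := (- (v * normal_peak s))%:P * (b%:P + k *: y + beta *: (y ^+ 2 + v%:P)).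
have yd : y^`() = 1 by rewrite /y derivXsubC.
have pd x : p^`().[x] = - (v * normal_peak s) * (k + beta * (2 * (x - m))).
  rewrite /p derivM derivC mul0r add0r !(derivD, derivZ, derivC, deriv_exp, yd).
  by rewrite /y /= !(derivX, derivN, derivC, hornerX, hornerN, hornerD, hornerM, hornerZ, hornerC, horner_exp, hornerMn) /=; ring.
have ed x : gexp^`().[x] = - ((x - m) / v).
  rewrite /gexp derivN derivZ deriv_exp derivXsubC mul1r /= hornerN hornerZ hornerMn.
  by rewrite expr1 hornerXsubC; field; rewrite s0.
have px x : p.[x] = - (v * normal_peak s) * (b + k * (x - m) + beta * ((x - m) ^+ 2 + v)).
  by rewrite /p /y !(hornerD, hornerM, hornerZ, hornerC, horner_exp, hornerX, hornerN).
have E x : (b * (x - m) + (k + beta * (x - m)) * ((x - m) ^+ 2 - v)) * normal_pdf m s x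
    = (p^`() + p * gexp^`()).[x] * expR gexp.[x].
  rewrite normal_pdf_poly mulrA; congr (_ * _).
  by rewrite hornerD hornerM pd ed px; field; rewrite s0.
transitivity (\int[mu]_(x in `[(m - N)%R, (m + N)%R]) ((a * normal_pdf m s x)%:E
   + ((p^`() + p * gexp^`()).[x] * expR gexp.[x])%:E))%E.
  by apply: eq_integral => x _; rewrite -EFinD -E; congr EFin; ring.
have ipdf : mu.-integrable `[(m - N)%R, (m + N)%R] (fun x => (normal_pdf m s x)%:E).
  by apply: (integrableS _ _ (subsetT _)) => //; exact: integrable_normal_pdf.
rewrite integralD //=; last 2 first.
- exact: (integrableZl _ a ipdf).
- apply: continuous_compact_integrable; first exact: segment_compact.
  by apply: continuous_subspaceT; exact: continuous_poly_exp.
rewrite integral_poly_exp //; congr (_ + _)%E.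
  by under eq_integral do rewrite EFinM; rewrite integralZl.
congr EFin.
have -> : gexp.[m - N] = gexp.[m + N].
  by rewrite /gexp !(hornerN, hornerZ, horner_exp, hornerXsubC); ring.
by rewrite normal_pdf_poly !px; ring.
Qed.
End GaussMoments.

Section LeIntegral.
Context d (T : measurableType d) (R : realType).
Variable nu : {measure set T -> \bar R}.

(* Unlike [le_integral], the majorant need not be integrable. *)
Lemma le_integral_ge0 (D : set T) (f g : T -> \bar R) : measurable D ->
  measurable_fun D f -> measurable_fun D g -> (forall x, D x -> 0 <= g x)%E ->
  (forall x, D x -> f x <= g x)%E -> (\int[nu]_(x in D) f x <= \int[nu]_(x in D) g x)%E.
Proof.
move=> mD mf mg g0 fg; rewrite [leLHS]integralE.
apply: (@le_trans _ _ (\int[nu]_(x in D) f^\+ x)%E).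
  by rewrite geeDl // oppe_le0; exact: integral_ge0.
apply: ge0_le_integral => //; first exact: measurable_funepos.
by move=> x Dx; rewrite funeposE ge_max fg // g0.
Qed.
End LeIntegral.

Section NormalLower.
Variables (R : realType) (m s : R).
Hypothesis s0 : s != 0.
Local Notation v := (s ^+ 2).
Local Notation mu := (@lebesgue_measure R).
Local Notation I q := `[(m - q.+1%:R)%R, (m + q.+1%:R)%R]%classic.

Lemma normal_tail_cvg : q.+1%:R * normal_pdf m s (m + q.+1%:R) @[q --> \oo] --> (0 : R).
Proof.
have v0 : 0 < v by rewrite exprn_even_gt0.
pose c : R := normal_peak s * (v *+ 2).
have ub : c * harmonic q @[q --> \oo] --> (0 : R).
  have : c * harmonic q @[q --> \oo] --> (c * 0 : R).
    by apply: cvgM; [exact: cvg_cst | exact: cvg_harmonic].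
  by rewrite mulr0.
apply: (squeeze_cvgr _ (cvg_cst 0) ub); apply: nearW => q.
have q0 : 0 < q.+1%:R :> R by rewrite ltr0n.
rewrite mulr_ge0 ?normal_pdf_ge0 ?ler0n //=.
rewrite normal_pdfE // /normal_fun addrC addKr /harmonic /=.
set N := q.+1%:R in q0 *.
have -> : - N ^+ 2 / (v *+ 2) = - (N ^+ 2 / (v *+ 2)) by rewrite mulNr.
have w0 : 0 < v *+ 2 by rewrite mulrn_wgt0.
have key : N ^+ 2 <= v *+ 2 * expR (N ^+ 2 / (v *+ 2)).
  have := expR_ge1Dx (N ^+ 2 / (v *+ 2)); rewrite -(ler_pM2l w0); apply: le_trans.
  by rewrite mulrDr mulrCA divff ?gt_eqF // !mulr1 lerDr ltW.
rewrite expRN /c mulrCA -[X in _ <= X]mulrA; apply: ler_wpM2l; first exact: normal_peak_ge0.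
by rewrite ler_pdivrMr ?expR_gt0 // mulrAC ler_pdivlMr // -expr2.
Qed.

Definition normal_mass q := fine (normal_prob m s (I q)).

Lemma normal_massE q : (normal_mass q)%:E = normal_prob m s (I q).
Proof. by rewrite fineK // fin_num_measure. Qed.

Lemma normal_mass_cvg : normal_mass q @[q --> \oo] --> (1 : R).
Proof.
apply: (@fine_cvg _ _ _ _ (fun q => normal_prob m s (I q))).
have <- : normal_prob m s (\bigcup_q I q) = 1%:E.
  rewrite -(@probability_setT _ _ _ (normal_prob m s)); congr (normal_prob _ _ _).
  apply/seteqP; split => // x _.
  exists (Num.truncn `|x - m|) => //=; rewrite in_itv /=.
  have := truncnS_gt `|x - m|; rewrite ltr_norml => /andP[h1 h2].
  by apply/andP; split; lra.
apply: nondecreasing_cvg_mu.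
- by move=> q; exact: measurable_itv.
- by apply: bigcup_measurable => q _; exact: measurable_itv.
- move=> p q pq; apply/subsetPset => x /=; rewrite !in_itv /= => /andP[h1 h2].
  have : p.+1%:R <= q.+1%:R :> R by rewrite ler_nat.
  by move=> h; apply/andP; split; lra.
Qed.

Lemma normal_lower (phi : R -> R) a b k beta :
  measurable_fun setT phi -> (forall x, 0 <= phi x) ->
  (forall x, a + b * (x - m) + (k + beta * (x - m)) * ((x - m) ^+ 2 - v) <= phi x) ->
  (a%:E <= \int[normal_prob m s]_x (phi x)%:E)%E.
Proof.
move=> mphi phi0 cphi.
have lo q : ((a * normal_mass q - 2 * v * k * (q.+1%:R * normal_pdf m s (m + q.+1%:R)))%:E
    <= \int[normal_prob m s]_x (phi x)%:E)%E.
  rewrite integral_normal_prob //; last by apply/measurable_EFinP.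
  have q0 : 0 < q.+1%:R :> R by rewrite ltr0n.
  rewrite EFinB EFinM normal_massE mulrA -(@integral_normal_cubic _ m s s0 _ a b k beta q0).
  apply: (@le_trans _ _ (\int[mu]_(x in I q) ((phi x)%:E * (normal_pdf m s x)%:E))%E); last first.
    apply: ge0_subset_integral => //.
    - by apply: emeasurable_funM; apply/measurable_EFinP => //; exact: measurable_normal_pdf.
    - by move=> x _; rewrite -EFinM lee_fin mulr_ge0 // normal_pdf_ge0.
  have mcub : measurable_fun setT (fun x : R => (a + b * (x - m)
      + (k + beta * (x - m)) * ((x - m) ^+ 2 - v))).
    have my : measurable_fun setT (fun x : R => x - m) by exact: measurable_funB.
    apply: measurable_funD.
      by apply: measurable_funD => //; apply: measurable_funM.
    apply: measurable_funM; first by apply: measurable_funD => //; apply: measurable_funM.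
    by apply: measurable_funB => //; exact: measurable_funX.
  apply: le_integral_ge0 => //.
  - apply/measurable_funTS/measurable_EFinP; apply: measurable_funM => //.
    exact: measurable_normal_pdf.
  - apply/measurable_funTS/emeasurable_funM; apply/measurable_EFinP => //.
    exact: measurable_normal_pdf.
  - by move=> x _; rewrite -EFinM lee_fin mulr_ge0 // normal_pdf_ge0.
  - by move=> x _; rewrite -EFinM lee_fin ler_wpM2r // normal_pdf_ge0.
have cv : a * normal_mass q - 2 * v * k * (q.+1%:R * normal_pdf m s (m + q.+1%:R)) @[q --> \oo] --> a.
  have : a * normal_mass q - 2 * v * k * (q.+1%:R * normal_pdf m s (m + q.+1%:R)) @[q --> \oo]
    --> a * 1 - 2 * v * k * 0.
    apply: cvgB; apply: cvgM; [exact: cvg_cst | exact: normal_mass_cvg | exact: cvg_cst | exact: normal_tail_cvg].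
  by rewrite mulr1 mulr0 subr0.
move: lo; case: (\int[normal_prob m s]_x (phi x)%:E)%E => [r lo | _ | /(_ 0%N)].
- rewrite lee_fin; apply: (ler_cvg_to cv (cvg_cst r)); apply: nearW => q.
  by have := lo q; rewrite lee_fin.
- by rewrite leey.
- by rewrite leeNy_eq.
Qed.
End NormalLower.

Section Law.
Context d (T : measurableType d) (R : realType) (P : probability T R).
Variable X : T -> R.
Hypothesis mX : measurable_fun setT X.

Lemma integral_law (nu : {measure set (measurableTypeR R) -> \bar R}) (f : R -> \bar R) :
  (forall B, measurable B -> P (X @^-1` B) = nu B) ->
  measurable_fun setT f -> (forall x, 0 <= f x)%E ->
  (\int[P]_x f (X x) = \int[nu]_x f x)%E.
Proof.
move=> Xnu mf f0.
have mX' : measurable_fun setT (X : T -> measurableTypeR R) := mX.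
pose X' : {mfun T >-> measurableTypeR R} := HB.pack X (isMeasurableFun.Build _ _ _ _ _ mX').
rewrite -[LHS]/(\int[P]_(x in X' @^-1` setT) (f \o X') x)%E -ge0_integral_pushforward //.
by apply: eq_measure_integral => A mA _; exact: Xnu.
Qed.
End Law.

Section Square.
Context d (T : measurableType d) (R : realType) (P : probability T R).
Variable W : T -> R.
Hypothesis mW : measurable_fun setT W.
Hypothesis W2 : ('E_P[fun x => (W x ^+ 2)%R] < +oo)%E.

Lemma integrable_sqr : P.-integrable setT (fun x => (W x ^+ 2)%:E).
Proof.
apply/integrableP; split; first by apply/measurable_EFinP; exact: measurable_funX.
under eq_integral do rewrite gee0_abs ?lee_fin ?sqr_ge0 //.
by move: W2; rewrite unlock.
Qed.

Lemma integrable_one : P.-integrable setT (fun=> 1%:E).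
Proof. exact: finite_measure_integrable_cst. Qed.

Lemma integrable_of_sqr : P.-integrable setT (fun x => (W x)%:E).
Proof.
apply: (@le_integrable _ _ _ _ _ measurableT _ (fun x => 1%:E + (W x ^+ 2)%:E)%E).
- by apply/measurable_EFinP.
- move=> x _; rewrite -EFinD !abse_EFin lee_fin [leRHS]ger0_norm ?addr_ge0 ?sqr_ge0 //.
  rewrite -[W x ^+ 2]real_normK ?num_real //.
  have := sqr_ge0 (`|W x| - 1); have := normr_ge0 (W x); nra.
- by apply: integrableD => //; [exact: integrable_one | exact: integrable_sqr].
Qed.

Definition mean := fine 'E_P[W].
Definition second_moment := fine 'E_P[fun x => (W x ^+ 2)%R].

Lemma meanE : (\int[P]_x (W x)%:E = mean%:E)%E.
Proof.
rewrite /mean unlock fineK //; apply: integrable_fin_num => //; exact: integrable_of_sqr.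
Qed.

Lemma second_momentE : (\int[P]_x (W x ^+ 2)%:E = second_moment%:E)%E.
Proof.
rewrite /second_moment unlock fineK //; apply: integrable_fin_num => //; exact: integrable_sqr.
Qed.

Lemma integral_quadratic a b c :
  (\int[P]_x (a + b * W x + c * W x ^+ 2)%:E = (a + b * mean + c * second_moment)%:E)%E.
Proof.
under eq_integral do rewrite !EFinD !EFinM.
have i1 := integrable_of_sqr; have i2 := integrable_sqr.
have ia : P.-integrable setT (fun=> a%:E) by exact: finite_measure_integrable_cst.
have ib : P.-integrable setT (fun x => b%:E * (W x)%:E)%E by exact: integrableZl.
have ic : P.-integrable setT (fun x => c%:E * (W x ^+ 2)%:E)%E by exact: integrableZl.
rewrite integralD //; last by exact: integrableD.
rewrite integralD // !integralZl // meanE second_momentE integral_cst //.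
by rewrite [X in (_ * X)%E]probability_setT mule1.
Qed.

Lemma mean_sqr_le : mean ^+ 2 <= second_moment.
Proof.
have : (0 <= \int[P]_x ((W x - mean) ^+ 2)%:E)%E.
  by apply: integral_ge0 => x _; rewrite lee_fin sqr_ge0.
under eq_integral.
  move=> x _; rewrite (_ : (W x - mean) ^+ 2 = mean ^+ 2 + (- 2 * mean) * W x + 1 * W x ^+ 2).
    over.
  by ring.
by rewrite integral_quadratic lee_fin; lra.
Qed.

Lemma second_moment_ge0 : 0 <= second_moment.
Proof. by apply: le_trans mean_sqr_le; exact: sqr_ge0. Qed.
End Square.

Section Comparison.
Variable R : realType.

(* The two-sided quadrature condition: [phi] lies below a quadratic and above a cubic,
   both interpolating it at [y1] and [y2]; it follows from a nonpositive third and a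
   nonnegative fourth derivative. *)
Record quadrature_convex (phi : R -> R) : Prop := QuadratureConvex {
  qc_ge0 : forall x, 0 <= phi x;
  qc_meas : measurable_fun setT phi;
  qc_upper : forall y1 y2 : R, y1 < y2 -> exists2 k, 0 <= k & forall w, y1 <= w ->
    phi w <= phi y1 + slope (phi y1) (phi y2) y1 y2 * (w - y1) + k * ((w - y1) * (w - y2));
  qc_lower : forall y1 y2 : R, y1 < y2 -> exists k b, forall w,
    phi y1 + slope (phi y1) (phi y2) y1 y2 * (w - y1)
    + (k + b * (w - y1)) * ((w - y1) * (w - y2)) <= phi w }.

Variables (phi : R -> R).
Hypothesis qc : quadrature_convex phi.
Context d (T : measurableType d) (P : probability T R) (W : T -> R).
Hypotheses (mW : measurable_fun setT W) (W0 : forall x, 0 <= W x)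
  (W2 : ('E_P[fun x => (W x ^+ 2)%R] < +oo)%E).
Local Notation m := (mean P W).
Local Notation v := (second_moment P W).
Local Notation s := (Num.sqrt v).

(** The linear interpolant at the mean is the average of the two values, and the quadratic term
    contributes k (E (W - m)^2 - s^2) = - k m^2 <= 0. *)
Lemma two_point_upper : 0 < v ->
  (\int[P]_x (phi (W x))%:E <= ((phi (m - s) + phi (m + s)) / 2)%:E)%E.
Proof.
move=> v0; have s0 : 0 < s by rewrite sqrtr_gt0.
have ms : m - s < m + s by lra.
have s2 : s ^+ 2 = v by rewrite sqr_sqrtr // ltW.
have m_s : m <= s.
  apply: le_trans (ler_norm _) _; rewrite -sqrtr_sqr ler_wsqrtr //.
  exact: mean_sqr_le.
have [k k0 kE] := qc_upper qc ms.
set y1 := m - s in kE ms *; set y2 := m + s in kE ms *.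
pose sl := slope (phi y1) (phi y2) y1 y2.
apply: (@le_trans _ _ (\int[P]_x ((phi y1 - sl * y1 + k * (y1 * y2))
   + (sl - k * (y1 + y2)) * W x + k * W x ^+ 2)%:E)%E).
  apply: ge0_le_integral => //.
  - by move=> x _; rewrite lee_fin qc_ge0.
  - by apply/measurable_EFinP; apply: measurableT_comp => //; exact: qc_meas.
  - apply/measurable_EFinP; apply: measurable_funD; last first.
      by apply: measurable_funM => //; exact: measurable_funX.
    by apply: measurable_funD => //; exact: measurable_funM.
  - move=> x _; rewrite lee_fin; apply: le_trans (kE (W x) _) _; last by rewrite -/sl; lra.
    by apply: le_trans (W0 x); rewrite /y1; lra.
rewrite integral_quadratic // lee_fin.
have slE : sl * (2 * s) = phi y2 - phi y1.
  rewrite /sl /slope /y1 /y2; field; rewrite gt_eqF //; lra.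
have -> : phi y1 - sl * y1 + k * (y1 * y2) + (sl - k * (y1 + y2)) * m + k * v
  = phi y1 + (sl * (2 * s)) / 2 - k * m ^+ 2 + k * (v - s ^+ 2).
  by rewrite /y1 /y2; field.
rewrite s2 subrr mulr0 addr0 slE; have : 0 <= k * m ^+ 2 by rewrite mulr_ge0 // sqr_ge0.
lra.
Qed.

Context d' (T' : measurableType d') (P' : probability T' R) (X : T' -> R).
Hypotheses (mX : measurable_fun setT X) (lawX : has_normal_law P' X m v).

Lemma two_point_lower : 0 < v ->
  (((phi (m - s) + phi (m + s)) / 2)%:E <= \int[P']_x (phi (X x))%:E)%E.
Proof.
move=> v0; have s0 : 0 < s by rewrite sqrtr_gt0.
have ms : m - s < m + s by lra.
have s2 : s ^+ 2 = v by rewrite sqr_sqrtr // ltW.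
rewrite (@integral_law _ _ _ P' _ mX (normal_prob m s) (fun x => (phi x)%:E)); last 3 first.
- by move=> B mB; rewrite lawX // gt_eqF.
- by apply/measurable_EFinP; exact: qc_meas.
- by move=> x; rewrite lee_fin qc_ge0.
have [k [b kE]] := qc_lower qc ms.
set y1 := m - s in kE ms *; set y2 := m + s in kE ms *.
pose sl := slope (phi y1) (phi y2) y1 y2.
have slE : sl * (2 * s) = phi y2 - phi y1.
  rewrite /sl /slope /y1 /y2; field; rewrite gt_eqF //; lra.
(* The cubic is recentred at m: x - y1 = (x - m) + s and (x - y1)(x - y2) = (x - m)^2 - s^2. *)
apply: (@normal_lower _ _ _ (lt0r_neq0 s0) phi _ sl (k + b * s) b).
- exact: qc_meas.
- by move=> x; rewrite qc_ge0.
- move=> x; apply: le_trans (kE x); rewrite -/sl.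
  have -> : phi y1 + sl * (x - y1) = (phi y1 + phi y2) / 2 + sl * (x - m).
    have -> : phi y2 = phi y1 + sl * (2 * s) by rewrite slE; ring.
    by rewrite /y1; field.
  rewrite lerD2l /y1 /y2 le_eqVlt; apply/orP; left; apply/eqP; ring.
Qed.

Lemma comparison_univariate :
  (\int[P]_x (phi (W x))%:E <= \int[P']_x (phi (X x))%:E)%E.
Proof.
have := second_moment_ge0 mW W2; rewrite le_eqVlt => /orP[/eqP v0|v0]; last first.
  by apply: le_trans (two_point_upper v0) (two_point_lower v0).
(* If E W^2 = 0, then W vanishes almost surely and X has the Dirac law at m = 0. *)
have Wae : ae_eq P setT (fun x => (W x ^+ 2)%:E) (cst 0%E).
  apply/ae_eq_integral_abs => //; first by apply/measurable_EFinP; exact: measurable_funX.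
  under eq_integral do rewrite gee0_abs ?lee_fin ?sqr_ge0 //.
  by rewrite (second_momentE mW W2) -v0.
have m0 : m = 0.
  by have := mean_sqr_le mW W2; rewrite -v0 => h; apply/eqP; rewrite -sqrf_eq0 eq_le h sqr_ge0.
have mphi := qc_meas qc.
have -> : (\int[P]_x (phi (W x))%:E = \int[P]_x (phi 0)%:E)%E.
  apply: ae_eq_integral => //; first by apply/measurable_EFinP; apply: measurableT_comp.
  apply: filterS Wae => x /= /(_ I) /eqP; rewrite eqe sqrf_eq0 => /eqP -> //.
rewrite (@integral_law _ _ _ P' _ mX (@dirac _ (measurableTypeR R) m R) (fun x => (phi x)%:E)); last 3 first.
- by move=> B mB; rewrite lawX // -v0 eqxx.
- by apply/measurable_EFinP.
- by move=> x; rewrite lee_fin qc_ge0.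
rewrite integral_dirac //; last by apply/measurable_EFinP.
rewrite integral_cst // [X in (_ * X)%E]probability_setT mule1 diracT mul1e m0.
exact: lexx.
Qed.
End Comparison.

(** * Exchange of independent coordinates *)

Section Boxes.
Variables (R : realType) (n : nat).

Definition box (B : 'I_n -> set R) : set (n.-tuple R) := [set t | forall i, B i (tnth t i)].
Definition boxes : set (set (n.-tuple R)) :=
  [set A | exists2 B, (forall i, measurable (B i)) & A = box B].

Lemma boxes_setI : setI_closed boxes.
Proof.
move=> _ _ [B mB ->] [D mD ->]; exists (fun i => B i `&` D i).
  by move=> i; exact: measurableI.
apply/seteqP; split => t /=; first by move=> [h1 h2] i; split; [exact: h1|exact: h2].
by move=> h; split => i; have [] := h i.
Qed.

Lemma boxes_setT : boxes setT.
Proof.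
exists (fun=> setT); first by move=> i; exact: measurableT.
by apply/seteqP; split.
Qed.

Lemma measurable_boxes : @measurable _ (n.-tuple R) = <<s boxes >>.
Proof.
apply/seteqP; split.
- apply: smallest_sub; first exact: smallest_sigma_algebra.
  move=> A; rewrite -bigcup_seq /= => -[i _ [B mB <-]]; apply: sub_sigma_algebra.
  exists (fun j => if j == i then B else setT).
    by move=> j; case: eqP => _ //; exact: measurableT.
  rewrite setTI; apply/seteqP; split => t /=.
    by move=> h j; case: eqP => // ->.
  by move=> h; have := h i; rewrite eqxx.
- apply: smallest_sub; first exact: sigma_algebra_measurable.
  move=> _ [B mB ->].
  have -> : box B = \bigcap_(i in [set` 'I_n]) ((fun t => tnth t i) @^-1` B i).
    by apply/seteqP; split => t /= h i; [move=> _|]; exact: h.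
  apply: fin_bigcap_measurable => // i _.
  by rewrite -[X in measurable X]setTI; apply: (measurable_tnth i).
Qed.
End Boxes.

Section Split.
Context d (T : measurableType d) (R : realType) (P : probability T R).
Variables (n : nat) (X : 'I_n.+1 -> T -> R).
Hypothesis iX : indep_rvs P X.

Definition rv_tail (x : T) : n.-tuple R := [tuple X (lift ord0 i) x | i < n].

Lemma measurable_rv_tail : measurable_fun setT rv_tail.
Proof.
apply/measurable_fun_tnthP => i; rewrite (_ : _ \o _ = X (lift ord0 i)); first by have [] := iX.
by apply/funext => x /=; rewrite tnth_mktuple.
Qed.

Lemma indep_rv_tail : indep_rvs P (fun i => X (lift ord0 i)).
Proof.
have [mX iP] := iX; split=> [i|B mB]; first exact: mX.
pose B' i := if unlift ord0 i is Some j then B j else setT.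
have mB' i : measurable (B' i).
  by rewrite /B'; case: unliftP => [j _|_]; [exact: mB | exact: measurableT].
have := iP B' mB'; rewrite big_ord_recl /B' unlift_none preimage_setT probability_setT mul1e.
under eq_bigr do rewrite liftK.
move=> <-; congr (P _); apply/seteqP; split => x /= h i _.
- by case: unliftP => [j ->|_] //=; exact: h.
- by have := h (lift ord0 i) I; rewrite liftK.
Qed.

(** Independence is given on boxes only. For fixed [A] both sides are finite measures in [B] that
    agree on boxes, a generating family stable under intersection. *)
Lemma indep_head_tail (A : set R) (B : set (n.-tuple R)) : measurable A -> measurable B ->
  P (X ord0 @^-1` A `&` rv_tail @^-1` B) = (P (X ord0 @^-1` A) * P (rv_tail @^-1` B))%E.
Proof.
move=> mA mB; have [mX iP] := iX.
have mXA : measurable (X ord0 @^-1` A) by rewrite -[X in measurable X]setTI; exact: mX.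
pose rv_tail' : {mfun T >-> n.-tuple R} := HB.pack rv_tail (isMeasurableFun.Build _ _ _ _ _ measurable_rv_tail).
have [c c0 pA] : exists2 c, 0 <= c & P (X ord0 @^-1` A) = c%:E.
  by exists (fine (P (X ord0 @^-1` A))); rewrite ?fine_ge0 // fineK // fin_num_measure.
pose m1f : {measure set (n.-tuple R) -> \bar R} :=
  pushforward (mrestr P mXA) rv_tail'.
pose m1 := m1f measurable_rv_tail.
pose m2 : {measure set (n.-tuple R) -> \bar R} :=
  mscale (NngNum c0) (distribution P rv_tail').
have e1 D : m1 D = P (rv_tail @^-1` D `&` X ord0 @^-1` A) by [].
have e2 D : m2 D = (c%:E * P (rv_tail @^-1` D))%E by [].
suff : m1 B = m2 B by rewrite e1 e2 -pA setIC.
apply: (measure_unique (@boxes R n) (fun=> setT)) => //.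
- exact: measurable_boxes.
- exact: boxes_setI.
- by move=> _; exact: boxes_setT.
- by apply/seteqP; split => // x _; exists 0%N.
- move=> _ [D mD ->]; rewrite e1 e2 -pA setIC.
  have tlD : rv_tail @^-1` box D = \bigcap_i ((X (lift ord0 i)) @^-1` D i).
    by apply/seteqP; split => x /= h i; [move=> _; have := h i | have := h i I];
      rewrite tnth_mktuple.
  rewrite tlD indep_rv_tail.2 //.
  pose B' i := if unlift ord0 i is Some j then D j else A.
  have mB' i : measurable (B' i) by rewrite /B'; case: unliftP => [j _|_]; [exact: mD|].
  have := iP B' mB'; rewrite big_ord_recl /B' unlift_none.
  under eq_bigr do rewrite liftK.
  move=> <-; congr (P _); apply/seteqP; split => x /=.
    by move=> [h1 h2] i _; case: unliftP => [j ->|->] //=; exact: h2.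
  move=> h; split; first by have := h ord0 I; rewrite unlift_none.
  by move=> i _; have := h (lift ord0 i) I; rewrite liftK.
- move=> _; rewrite e1 preimage_setT setTI.
  by rewrite pA ltry.
Qed.

(** The law of the pair is the product of the two laws. After Tonelli both are realised on the same
    space, the inner variable acting as an independent copy. *)
Lemma integral_indep_split (F : R * n.-tuple R -> \bar R) :
  measurable_fun setT F -> (forall z, 0 <= F z)%E ->
  (\int[P]_x F (X ord0 x, rv_tail x) = \int[P]_x \int[P]_y F (X ord0 x, rv_tail y))%E.
Proof.
move=> mF F0; have [mX iP] := iX.
have mZ : measurable_fun setT (fun x => (X ord0 x, rv_tail x)).
  by apply: measurable_fun_pair; [exact: mX | exact: measurable_rv_tail].
pose Z' : {mfun T >-> (R * n.-tuple R)%type} := HB.pack (fun x => (X ord0 x, rv_tail x))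
  (isMeasurableFun.Build _ _ _ _ _ mZ).
pose rv_tail' : {mfun T >-> n.-tuple R} := HB.pack rv_tail (isMeasurableFun.Build _ _ _ _ _ measurable_rv_tail).
pose X0 : {mfun T >-> R} := HB.pack (X ord0) (isMeasurableFun.Build _ _ _ _ _ (mX ord0)).
pose m1 : probability R R := distribution P X0.
pose m2 : probability (n.-tuple R) R := distribution P rv_tail'.
pose m : probability (R * n.-tuple R)%type R := distribution P Z'.
rewrite -[LHS]/(\int[P]_x (F \o Z') x)%E -ge0_integral_distribution //.
transitivity (\int[m1 \x m2]_z F z)%E.
  apply: eq_measure_integral => A mA _; apply/esym.
  apply: (product_measure_unique (m1 := m1) (m2 := m2) (m' := m)) => // B D mB mD.
  rewrite /m /m1 /m2 /distribution /pushforward /=.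
  by rewrite -indep_head_tail //; congr (P _).
rewrite fubini_tonelli1 // /fubini_F.
rewrite ge0_integral_distribution //; last 2 first.
- exact: measurable_fun_fubini_tonelli_F.
- by move=> x; apply: integral_ge0.
apply: eq_integral => x _ /=.
by rewrite ge0_integral_distribution //; exact: measurableT_comp.
Qed.
End Split.

Section Lindeberg.
Variables (R : realType) (C : numClosedFieldType) (K : scalars R C) (n : nat).
Local Notation emb := (emb K).

Lemma mlinE d (T : measurableType d) N (t : 'I_N -> T -> R) (A : 'I_N -> 'M[C]_n.+1) H x :
  mlin K (fun i x => - t i x) A H x = H - \sum_i emb (t i x) *: A i.
Proof.
by rewrite /mlin -sumrN; congr (_ + _); apply: eq_bigr => i _; rewrite rmorphN scaleNr.
Qed.

Lemma measurable_trexp_sub d (T : measurableType d) N (t : 'I_N -> T -> R)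
  (A : 'I_N -> 'M[C]_n.+1) H : (forall i, measurable_fun setT (t i)) ->
  (forall i, herm (A i)) -> herm H ->
  measurable_fun setT (fun x => trexp K (H - \sum_i emb (t i x) *: A i)).
Proof.
move=> mt Ah Hh; under eq_fun do rewrite -mlinE.
by apply: measurable_trexp => // i; exact: measurable_funN.
Qed.

Lemma phi_quadrature_convex (H A : 'M[C]_n.+1) : herm H -> herm A ->
  (forall u, unit_vec u -> 0 <= qform K A u) -> quadrature_convex (phi K H A).
Proof.
move=> Hh Ah A0; split.
- exact: phi_ge0.
- have := @measurable_trexp_sub _ _ 1 (fun _ (x : R) => x) (fun=> A) H
    (fun=> @measurable_id _ _ setT) (fun=> Ah) Hh.
  by under eq_fun do rewrite big_ord1.
- by move=> y1 y2; exact: phi_upper.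
- move=> y1 y2 y12; eexists _, _ => w; exact: (phi_hermite3 Hh Ah A0 w y12).
Qed.

Lemma lindeberg N (A : 'I_N -> 'M[C]_n.+1) (H : 'M[C]_n.+1)
  d (T : measurableType d) (P : probability T R) (W : 'I_N -> T -> R)
  d' (T' : measurableType d') (P' : probability T' R) (X : 'I_N -> T' -> R) :
  herm H -> (forall i, herm (A i)) -> (forall i u, unit_vec u -> 0 <= qform K (A i) u) ->
  indep_rvs P W -> indep_rvs P' X -> (forall i x, 0 <= W i x) ->
  (forall i, ('E_P[fun x => (W i x ^+ 2)%R] < +oo)%E) ->
  (forall i, has_normal_law P' (X i) (mean P (W i)) (second_moment P (W i))) ->
  (\int[P]_x (trexp K (H - \sum_i emb (W i x) *: A i))%:E
   <= \int[P']_x (trexp K (H - \sum_i emb (X i x) *: A i))%:E)%E.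
Proof.
elim: N A H W X => [|N IH] A H W X Hh Ah A0 iW iX W0 W2 lX.
  under eq_integral do rewrite big_ord0 subr0.
  under [leRHS]eq_integral do rewrite big_ord0 subr0.
  by rewrite !integral_cst // [X in (_ * X <= _)%E]probability_setT [X in (_ <= _ * X)%E]probability_setT.
pose A' i := A (lift ord0 i).
pose Phi (z : R * N.-tuple R) := (trexp K (H - emb z.1 *: A ord0 - \sum_i emb (tnth z.2 i) *: A' i))%:E.
have hH r : herm (H - emb r *: A ord0) by exact: herm_line.
have mPhi : measurable_fun setT Phi.
  apply/measurable_EFinP.
  have := @measurable_trexp_sub _ (R * N.-tuple R)%type N.+1
    (fun i z => if unlift ord0 i is Some j then tnth z.2 j else z.1) A H _ Ah Hh.
  have E z : H - \sum_(i < N.+1) emb (if unlift ord0 i is Some j then tnth z.2 j else z.1) *: A i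
    = H - emb z.1 *: A ord0 - \sum_i emb (tnth z.2 i) *: A' i.
    rewrite big_ord_recl unlift_none opprD addrA; congr (_ - _).
    by apply: eq_bigr => i _; rewrite liftK.
  under eq_fun do rewrite E; apply => i; case: unliftP => [j _|_]; last exact: measurable_fst.
  by apply: (@measurableT_comp _ _ _ _ _ _ (fun t => tnth t j)) => //; exact: measurable_tnth.
have Phi0 z : (0 <= Phi z)%E by rewrite lee_fin trexp_ge0.
have PhiE d0 (T0 : measurableType d0) (V : 'I_N.+1 -> T0 -> R) r y :
   Phi (r, rv_tail V y) = (trexp K (H - emb r *: A ord0
     - \sum_i emb (V (lift ord0 i) y) *: A' i))%:E.
  rewrite /Phi; congr (trexp _ (_ - _))%:E.
  by apply: eq_bigr => i _; rewrite tnth_mktuple.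
have splitE d0 (T0 : measurableType d0) (Q : probability T0 R) (V : 'I_N.+1 -> T0 -> R) :
  indep_rvs Q V ->
  (\int[Q]_x (trexp K (H - \sum_i emb (V i x) *: A i))%:E
   = \int[Q]_x \int[Q]_y Phi (V ord0 x, rv_tail V y))%E.
  move=> iV; transitivity (\int[Q]_x Phi (V ord0 x, rv_tail V x))%E; last first.
    exact: (integral_indep_split iV mPhi Phi0).
  apply: eq_integral => x _.
  by rewrite PhiE big_ord_recl opprD addrA.
have mX : forall i, measurable_fun setT (X i) by case: iX.
have mW : forall i, measurable_fun setT (W i) by case: iW.
have mcomp d1 (T1 : measurableType d1) d2 (T2 : measurableType d2)
   (f : T1 -> R) (g : T2 -> N.-tuple R) : measurable_fun setT f -> measurable_fun setT g ->
   measurable_fun setT (fun z : T1 * T2 => Phi (f z.1, g z.2)).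
  move=> mf mg; apply: measurableT_comp => //.
  by apply: measurable_fun_pair; apply: measurableT_comp.
rewrite (splitE _ _ _ _ iW) (splitE _ _ _ _ iX).
(* The hybrid combines the head of W with the tail of X. *)
apply: (@le_trans _ _ (\int[P]_x \int[P']_y Phi (W ord0 x, rv_tail X y))%E).
  apply: ge0_le_integral => //.
  - by move=> x _; apply: integral_ge0.
  - apply: (measurable_fun_fubini_tonelli_F (fun z => Phi (W ord0 z.1, rv_tail W z.2))) => //.
    by apply: mcomp => //; [exact: (measurable_rv_tail iW) || exact: (measurable_rv_tail iX)].
  - apply: (measurable_fun_fubini_tonelli_F (fun z => Phi (W ord0 z.1, rv_tail X z.2))) => //.
    by apply: mcomp => //; [exact: (measurable_rv_tail iW) || exact: (measurable_rv_tail iX)].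
  - move=> x _.
    have e d0 (T0 : measurableType d0) (Q : probability T0 R) (V : 'I_N.+1 -> T0 -> R) :
        (\int[Q]_y Phi (W ord0 x, rv_tail V y) = \int[Q]_y (trexp K (H - emb (W ord0 x) *: A ord0
          - \sum_i emb (V (lift ord0 i) y) *: A' i))%:E)%E.
      by apply: eq_integral => y _; rewrite PhiE.
    rewrite (e _ _ P W) (e _ _ P' X); apply: (IH A' (H - emb (W ord0 x) *: A ord0)
      (fun i => W (lift ord0 i)) (fun i => X (lift ord0 i))) => //.
    + by move=> i; exact: Ah.
    + by move=> i; exact: A0.
    + exact: indep_rv_tail.
    + exact: indep_rv_tail.
(* Exchanging the integrals freezes the tail, so that the univariate comparison applies to the
   head. *)
rewrite (fubini_tonelli (fun z => Phi (W ord0 z.1, rv_tail X z.2))) //=; last first.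
  by apply: mcomp => //; [exact: (measurable_rv_tail iW) || exact: (measurable_rv_tail iX)].
rewrite [leRHS](fubini_tonelli (fun z => Phi (X ord0 z.1, rv_tail X z.2))) //=; last first.
  by apply: mcomp => //; [exact: (measurable_rv_tail iW) || exact: (measurable_rv_tail iX)].
apply: ge0_le_integral => //.
- by move=> x _; apply: integral_ge0.
- apply: (measurable_fun_fubini_tonelli_G (fun z => Phi (W ord0 z.1, rv_tail X z.2))) => //.
  by apply: mcomp => //; [exact: (measurable_rv_tail iW) || exact: (measurable_rv_tail iX)].
- apply: (measurable_fun_fubini_tonelli_G (fun z => Phi (X ord0 z.1, rv_tail X z.2))) => //.
  by apply: mcomp => //; [exact: (measurable_rv_tail iW) || exact: (measurable_rv_tail iX)].
- move=> y _; pose H' := H - \sum_i emb (X (lift ord0 i) y) *: A' i.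
  have H'h : herm H'.
    rewrite /H' -sumrN; apply: hermD => //; apply: herm_sum => i.
    by rewrite -scaleNr -rmorphN; apply: hermZ; exact: Ah.
  have E r : Phi (r, rv_tail X y) = (phi K H' (A ord0) r)%:E.
    by rewrite PhiE /phi /line /H' addrAC.
  under eq_integral do rewrite E; under [leRHS]eq_integral do rewrite E.
  by apply: comparison_univariate => //; apply: phi_quadrature_convex => //; exact: A0.
Qed.
End Lindeberg.

(** * The Prekopa-Leindler inequality *)

Section LayerCake.
Variable R : realType.
Local Notation mu := (@lebesgue_measure R).
Local Notation mR := (measurableTypeR R).
Variable h : R -> R.
Hypothesis mh : measurable_fun setT h.

Let S : set (mR * mR) := [set z | 0 < z.2 < 1 /\ z.2 < h z.1].

Let mS : measurable S.
Proof.
pose f1 (p : mR * mR) := (0 < p.2).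
pose f2 (p : mR * mR) := (p.2 < 1).
pose f3 (p : mR * mR) := (p.2 < h p.1).
rewrite (_ : S = f1 @^-1` [set true] `&` f2 @^-1` [set true] `&` f3 @^-1` [set true]); last first.
  by apply/seteqP; split => p /=; rewrite /f1 /f2 /f3 => -[]; [move=> /andP[-> ->] -> | move=> [h1 h2] h3; split => //; apply/andP].
apply: measurableI; first apply: measurableI.
- rewrite -[X in measurable X]setTI; apply: measurable_fun_ltr => //.
- rewrite -[X in measurable X]setTI; apply: measurable_fun_ltr => //.
- rewrite -[X in measurable X]setTI; apply: measurable_fun_ltr => //.
  exact: (measurableT_comp mh measurable_fst).
Qed.

Lemma superlevelE (t : R) :
  (fubini_G mu (EFin \o \1_S) t
   = if (0 < t < 1)%R then mu [set x | (t < h x)%R] else 0)%E.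
Proof.
rewrite indic_fubini_tonelli_GE //=.
rewrite /ysection; case: ifPn => t01.
  congr (mu _); apply/seteqP; split => x /=; rewrite inE /S /=; first by case.
  by move=> ?; split.
rewrite (_ : [set _ | _] = set0) ?measure0 //.
by apply/seteqP; split => x //=; rewrite inE /S /= (negbTE t01) => -[].
Qed.

Lemma measurable_superlevel :
  measurable_fun setT (fun t : R => if (0 < t < 1)%R then mu [set x | (t < h x)%R] else 0)%E.
Proof.
under eq_fun do rewrite -superlevelE.
exact: (@indic_measurable_fun_fubini_tonelli_G _ _ mR mR R mu S mS).
Qed.

Hypothesis h0 : forall x, 0 < h x.

(** Tonelli on the region below the graph. Levels stop at 1, whence the truncation; at these levels
    a function of supremum 1 has nonempty superlevel sets. *)
Lemma layer_cake :
  (\int[mu]_t (if (0 < t < 1)%R then mu [set x | (t < h x)%R] else 0)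
   = \int[mu]_x (Num.min (h x) 1)%:E)%E.
Proof.
under eq_integral do rewrite -superlevelE.
transitivity (\int[mu]_x fubini_F mu (EFin \o \1_S) x)%E.
  by rewrite indic_fubini_tonelli.
apply: eq_integral => x _; rewrite indic_fubini_tonelli_FE //=.
rewrite (_ : xsection S x = `]0, Num.min (h x) 1[%classic); last first.
  apply/seteqP; split => t /=; rewrite /xsection /= inE /S /= in_itv /=; rewrite lt_min.
    by move=> [/andP[-> ->] ->].
  by move=> /and3P[-> -> ->].
rewrite lebesgue_measure_itv /= lte_fin lt_min h0 ltr01 /= sube0 //.
Qed.
End LayerCake.

Section Sets.
Variable R : realType.
Local Notation mu := (@lebesgue_measure R).
Local Notation mR := (measurableTypeR R).

Lemma lebesgue_measure_le_diam (E : set mR) (D : R) : measurable E -> E !=set0 ->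
  (forall x y, E x -> E y -> y - x <= D) -> (mu E <= D%:E)%E.
Proof.
move=> mE [e Ee] ED.
have hs : has_sup (E : set R).
  by split; [exists e | exists (e + D) => y Ey; rewrite -lerBlDl; exact: ED].
have hi : has_inf (E : set R).
  by split; [exists e | exists (e - D) => y Ey; rewrite lerBlDr -lerBlDl; exact: ED].
have sub : E `<=` `[inf (E : set R), sup (E : set R)].
  by move=> x Ex /=; rewrite in_itv /= ge_inf ?ub_le_sup //; [exact: hs.2 | exact: hi.2].
apply: (@le_trans _ _ (mu `[inf (E : set R), sup (E : set R)])).
  by apply: le_measure => //; rewrite inE.
have ie : inf (E : set R) <= sup (E : set R).
  by apply: (@le_trans _ _ e); [apply: ge_inf => //; exact: hi.2 | apply: ub_le_sup => //; exact: hs.2].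
have [lt|ge] := ltP (inf (E : set R)) (sup (E : set R)).
  rewrite lebesgue_measure_itv /= lte_fin lt -EFinB lee_fin.
  rewrite lerBlDr; apply: ge_sup; first by exists e.
  move=> y Ey; rewrite -lerBlDl; apply: lb_le_inf; first by exists e.
  by move=> x Ex; rewrite lerBlDr -lerBlDl; exact: ED.
rewrite lebesgue_measure_itv /= lte_fin ltNge ge /= lee_fin.
by have := ED e e Ee Ee; rewrite subrr.
Qed.

(** The one-dimensional Brunn-Minkowski inequality for an interval [G]. Two points of [G] bound its
    measure below by their distance, so the diameters of [E] and [F] obey the inequality, and a
    measure is at most a diameter. *)
Lemma lebesgue_measure_weighted_sum (k : R) (E F G : set mR) : 0 < k ->
  measurable E -> measurable F -> measurable G -> E !=set0 -> F !=set0 ->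
  is_interval (G : set R) ->
  (forall x y, E x -> F y -> G ((x + k * y) / (k + 1))) ->
  (mu E + k%:E * mu F <= (k + 1)%:E * mu G)%E.
Proof.
move=> k0 mE mF mG E0 F0 iG EFG; have k1 : 0 < k + 1 by lra.
have [->|] := eqVneq (mu G) +oo%E.
  by rewrite gt0_muley ?lte_fin // leey.
move=> Gfin; have : mu G \is a fin_num by rewrite ge0_fin_numE // lt_neqAle Gfin leey.
move=> /fineK; set g := fine _ => <-.
have diam e1 e2 f1 f2 : E e1 -> E e2 -> F f1 -> F f2 -> (e2 - e1) + k * (f2 - f1) <= (k + 1) * g.
  move=> Ee1 Ee2 Ff1 Ff2; set z1 := (e1 + k * f1) / (k + 1); set z2 := (e2 + k * f2) / (k + 1).
  have zz : z2 - z1 <= g.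
    rewrite -lee_fin [g%:E]fineK; last by rewrite ge0_fin_numE // lt_neqAle Gfin leey.
    have [le12|lt21] := leP z2 z1; first by apply: (@le_trans _ _ 0%E) => //; rewrite lee_fin subr_le0.
    have sub : `[z1, z2] `<=` G.
      by move=> z; rewrite /= in_itv /= => zz; apply: (iG z1 z2) => //; exact: EFG.
    apply: (@le_trans _ _ (mu `[z1, z2])).
      by rewrite lebesgue_measure_itv /= lte_fin lt21 -EFinB.
    by apply: le_measure => //; rewrite inE.
  rewrite (_ : e2 - e1 + k * (f2 - f1) = (k + 1) * (z2 - z1)).
    by rewrite ler_pM2l.
  by rewrite /z1 /z2; field; rewrite gt_eqF.
have [f0 Ff0] := F0.
have muE f1 f2 : F f1 -> F f2 -> (mu E <= ((k + 1) * g - k * (f2 - f1))%:E)%E.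
  move=> Ff1 Ff2; apply: lebesgue_measure_le_diam => // x y Ex Ey.
  by have := diam x y f1 f2 Ex Ey Ff1 Ff2; lra.
have : mu E \is a fin_num.
  by rewrite ge0_fin_numE //; apply: le_lt_trans (muE _ _ Ff0 Ff0) _; rewrite ltry.
move=> /fineK muEE.
have : (mu F <= (((k + 1) * g - fine (mu E)) / k)%:E)%E.
  apply: lebesgue_measure_le_diam => // x y Fx Fy.
  have := muE x y Fx Fy; rewrite -muEE lee_fin => h; rewrite ler_pdivlMr //.
  by rewrite [leLHS]mulrC lerBrDl -lerBrDr.
move=> muF; rewrite -muEE -EFinM.
apply: (@le_trans _ _ ((fine (mu E))%:E + k%:E * (((k + 1) * g - fine (mu E)) / k)%:E)%E).
  by apply: leeD => //; apply: lee_wpmul2l => //; rewrite lee_fin ltW.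
rewrite -EFinM -EFinD lee_fin mulrCA divff ?mulr1; last by rewrite gt_eqF.
lra.
Qed.
End Sets.

Section PL.
Variable R : realType.
Local Notation mu := (@lebesgue_measure R).
Local Notation mR := (measurableTypeR R).

Lemma measurable_superlevel_set (h : R -> R) t : measurable_fun setT h ->
  measurable ([set x | t < h x] : set mR).
Proof.
move=> mh; have := measurable_fun_ltr (measurable_cst t) mh.
by move=> /(_ measurableT [set true] Logic.I); rewrite setTI.
Qed.

(** The inequality for superlevel sets, integrated over the levels in ]0, 1[. Suprema equal to 1
    keep the sets of [p] and [r] nonempty there; with an empty set the inequality can fail. *)
Lemma prekopa_leindler_normalized (k : R) (p r g : R -> R) : 0 < k ->
  measurable_fun setT p -> measurable_fun setT r -> measurable_fun setT g ->
  (forall x, 0 < p x <= 1) -> (forall x, 0 < r x <= 1) -> (forall x, 0 < g x) ->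
  (forall t, t < 1 -> exists x, t < p x) -> (forall t, t < 1 -> exists x, t < r x) ->
  (forall t, is_interval [set x | t < g x]) ->
  (forall t x y, 0 < t -> t < p x -> t < r y -> t < g ((x + k * y) / (k + 1))) ->
  (\int[mu]_x (p x)%:E + k%:E * \int[mu]_x (r x)%:E <= (k + 1)%:E * \int[mu]_x (g x)%:E)%E.
Proof.
move=> k0 mp mr mg p01 r01 g0 supp supr ig prg; have k1 : 0 < k + 1 by lra.
have lc (h : R -> R) : measurable_fun setT h -> (forall x, 0 < h x <= 1) ->
  (\int[mu]_x (h x)%:E = \int[mu]_t (if (0 < t < 1)%R then mu [set x | (t < h x)%R] else 0))%E.
  move=> mh h01; rewrite layer_cake //; last by move=> x; have /andP[] := h01 x.
  apply: eq_integral => x _; rewrite min_l //; by have /andP[] := h01 x.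
have F0 (h : R -> R) t : (0 <= if (0 < t < 1)%R then mu [set x | (t < h x)%R] else 0)%E.
  by case: ifP.
rewrite (lc p) // (lc r) // -ge0_integralZl //; last 2 first.
- exact: measurable_superlevel.
- by rewrite lee_fin ltW.
rewrite -ge0_integralD //; last 3 first.
- exact: measurable_superlevel.
- by move=> t _; rewrite mule_ge0 // lee_fin ltW.
- by apply: emeasurable_funM => //; exact: measurable_superlevel.
apply: (@le_trans _ _ ((k + 1)%:E * \int[mu]_x (Num.min (g x) 1)%:E)%E); last first.
  apply: lee_wpmul2l; first by rewrite lee_fin ltW.
  apply: ge0_le_integral => //.
  - by move=> x _; rewrite lee_fin le_min (ltW (g0 x)) ler01.
  - by apply/measurable_EFinP; exact: measurable_minr.
  - exact/measurable_EFinP.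
  - by move=> x _; rewrite lee_fin ge_min lexx.
rewrite -layer_cake // -ge0_integralZl //; last 2 first.
- exact: measurable_superlevel.
- by rewrite lee_fin ltW.
apply: ge0_le_integral => //.
- by move=> t _; rewrite adde_ge0 // mule_ge0 // lee_fin ltW.
- apply: emeasurable_funD; first exact: measurable_superlevel.
  by apply: emeasurable_funM => //; exact: measurable_superlevel.
- by apply: emeasurable_funM => //; exact: measurable_superlevel.
move=> t _; case: ifPn => [/andP[t0 t1]|_]; last by rewrite !mule0 adde0.
apply: lebesgue_measure_weighted_sum => //; try exact: measurable_superlevel_set.
- exact: supp.
- exact: supr.
- by move=> x y; exact: prg.
Qed.
End PL.

Lemma weighted_AGM (R : realFieldType) (K : nat) (a b : R) : 0 <= a -> 0 <= b ->
  a * b ^+ K <= ((a + K%:R * b) / K.+1%:R) ^+ K.+1.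
Proof.
move=> a0 b0.
have := @leif_AGM R 'I_K.+1 predT (fun i => if i == ord0 then a else b).
rewrite cardT size_enum_ord => /(_ _)[]; first by move=> i _; case: ifP.
move=> + _; rewrite !big_ord_recl /= prodr_const sumr_const !card_ord.
by rewrite -(mulr_natl b K).
Qed.

Section PL.
Variable R : realType.
Local Notation mu := (@lebesgue_measure R).
Local Notation mR := (measurableTypeR R).

Lemma sup_range_normalize (h : R -> R) (D : R) : measurable_fun setT h ->
  (forall x, 0 < h x <= D) -> exists2 M, 0 < M &
  [/\ measurable_fun setT (fun x => h x / M), forall x, 0 < h x / M <= 1,
      forall t, t < 1 -> exists x, t < h x / M &
      (\int[mu]_x (h x)%:E = M%:E * \int[mu]_x (h x / M)%:E)%E].
Proof.
move=> mh hD; pose M := sup (range h).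
have hs : has_sup (range h).
  by split; [exists (h 0), 0 | exists D => _ [x _ <-]; have /andP[] := hD x].
have h0 x : 0 < h x by have /andP[] := hD x.
have M0 : 0 < M by apply: lt_le_trans (h0 0) _; apply: ub_le_sup; [exact: hs.2 | exists 0].
have mhM : measurable_fun setT (fun x => h x / M) by exact: measurable_funM.
exists M => //; split => //.
- move=> x; rewrite divr_gt0 //= ler_pdivrMr // mul1r.
  by apply: ub_le_sup; [exact: hs.2 | exists x].
- move=> t t1; have e0 : 0 < M * (1 - t) by rewrite mulr_gt0 // subr_gt0.
  have [_ [x _ <-] lt] := sup_adherent e0 hs.
  by exists x; rewrite ltr_pdivlMr //; apply: le_lt_trans lt; rewrite -/M; lra.
rewrite -ge0_integralZl //.
- by apply: eq_integral => x _; rewrite -EFinM mulrCA divff ?mulr1 // gt_eqF.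
- exact/measurable_EFinP.
- by move=> x _; rewrite lee_fin divr_ge0 // ltW.
- by rewrite lee_fin ltW.
Qed.

(** Integer weights 1 : K keep all exponents natural. Once the suprema are normalised, the
    arithmetic-geometric mean inequality turns the additive bound into the multiplicative one. *)
Lemma prekopa_leindler (K : nat) (p r g : R -> R) (B : R) : (0 < K)%N ->
  measurable_fun setT p -> measurable_fun setT r -> measurable_fun setT g ->
  (forall x, 0 < p x) -> (forall x, 0 < r x) -> (forall x, 0 < g x <= B) ->
  (forall t, is_interval [set x | t < g x]) -> (\int[mu]_x (g x)%:E = 1)%E ->
  (forall x y, p x * r y ^+ K <= g ((x + K%:R * y) / K.+1%:R) ^+ K.+1) ->
  exists a b, [/\ 0 <= a, 0 <= b, (\int[mu]_x (p x)%:E = a%:E)%E, (\int[mu]_x (r x)%:E = b%:E)%E &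
    a * b ^+ K <= 1].
Proof.
move=> K0 mp mr mg p0 r0 gB ig g1 prg.
have g0 x : 0 < g x by have /andP[] := gB x.
have B0 : 0 < B by have /andP[h1 h2] := gB 0; exact: lt_le_trans h2.
have prB x y : p x * r y ^+ K <= B ^+ K.+1.
  apply: le_trans (prg x y) _; apply: lerXn2r; rewrite ?nnegrE ?(ltW (g0 _)) ?(ltW B0) //.
  by have /andP[] := gB ((x + K%:R * y) / K.+1%:R).
have pD x : 0 < p x <= B ^+ K.+1 / r 0 ^+ K.
  by rewrite p0 ler_pdivlMr ?prB ?exprn_gt0.
(* Only r^K is bounded directly, and r <= r^K where r > 1; hence the added 1. *)
have rD x : 0 < r x <= 1 + B ^+ K.+1 / p 0.
  rewrite r0 /=; have [le|lt] := leP (r x) 1.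
    by apply: le_trans le _; rewrite lerDl divr_ge0 ?(ltW (p0 0)) // ?exprn_ge0 // ltW.
  apply: (@le_trans _ _ (r x ^+ K)); first by apply: ler_eXnr => //; exact: ltW.
  by rewrite -[leLHS]add0r lerD ?ler_pdivlMr ?[_ * p 0]mulrC ?prB.
have [Mp Mp0 [mp' p'1 psup pE]] := sup_range_normalize mp pD.
have [Mr Mr0 [mr' r'1 rsup rE]] := sup_range_normalize mr rD.
(* The geometric mean of the suprema with weights 1 : K, for which p r^K <= g^(K+1) is preserved by
   the normalisation. *)
pose c := expR ((ln Mp + K%:R * ln Mr) / K.+1%:R).
have c0 : 0 < c by exact: expR_gt0.
have cK : c ^+ K.+1 = Mp * Mr ^+ K.
  rewrite -expRM_natr divfK ?pnatr_eq0 // expRD expRM_natl !lnK //.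
have K0' : 0 < K%:R :> R by rewrite ltr0n.
have K1 : K%:R + 1 = K.+1%:R :> R by rewrite natr1.
have key : (\int[mu]_x (p x / Mp)%:E + K%:R%:E * \int[mu]_x (r x / Mr)%:E
  <= (K%:R + 1)%:E * \int[mu]_x (g x / c)%:E)%E.
  apply: prekopa_leindler_normalized => //.
  - exact: measurable_funM.
  - by move=> x; rewrite divr_gt0.
  - move=> t; have -> : [set x | t < g x / c] = [set x | t * c < g x] by
      apply/seteqP; split => x /=; rewrite ltr_pdivlMr.
    exact: ig.
  - move=> t x y t0 tp tr; rewrite K1 ltNge; apply/negP => gt.
    set z := (x + _) / _ in gt.
    have : t ^+ K.+1 < p x / Mp * (r y / Mr) ^+ K.
      rewrite exprS; apply: ltr_pM => //; rewrite ?exprn_ge0 ?(ltW t0) //.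
      by rewrite ltrXn2r -?lt0n // ltW.
    rewrite expr_div_n mulf_div -cK ltr_pdivlMr ?exprn_gt0 // => lt.
    have := lt_le_trans lt (prg x y); rewrite -/z => {}lt.
    have : g z ^+ K.+1 <= (t * c) ^+ K.+1.
      by apply: lerXn2r; rewrite ?nnegrE ?mulr_ge0 ?(ltW t0) ?(ltW c0) ?(ltW (g0 z)) // -ler_pdivrMr.
    by rewrite exprMn leNgt lt.
have gc : (\int[mu]_x (g x / c)%:E = (c^-1)%:E)%E.
  under eq_integral do rewrite mulrC EFinM.
  rewrite ge0_integralZl ?g1 ?mule1 //; first exact/measurable_EFinP.
  - by move=> x _; rewrite lee_fin ltW.
  - by rewrite lee_fin invr_ge0 ltW.
have p'0 : (0 <= \int[mu]_x (p x / Mp)%:E)%E.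
  by apply: integral_ge0 => x _; rewrite lee_fin divr_ge0 // ltW.
have r'0 : (0 <= \int[mu]_x (r x / Mr)%:E)%E.
  by apply: integral_ge0 => x _; rewrite lee_fin divr_ge0 // ltW.
move: pE rE key p'0 r'0; rewrite gc -EFinM.
move: (\int[mu]_x (p x / Mp)%:E)%E (\int[mu]_x (r x / Mr)%:E)%E.
(* The right-hand side of [key] is finite, so neither integral can be infinite. *)
move=> [al||] [be||] // pE rE. 
  all: try by rewrite gt0_muley ?lte_fin.
rewrite -EFinM -EFinD !lee_fin => key al0 be0.
exists (Mp * al), (Mr * be); split; rewrite ?mulr_ge0 ?(ltW Mp0) ?(ltW Mr0) //.
rewrite exprMn mulrACA -cK; apply: (@le_trans _ _ (c ^+ K.+1 * (c^-1) ^+ K.+1)).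
  apply: ler_wpM2l; first by rewrite exprn_ge0 // ltW.
  apply: le_trans (weighted_AGM K al0 be0) _.
  apply: lerXn2r; rewrite ?nnegrE ?divr_ge0 ?addr_ge0 ?mulr_ge0 ?ler0n ?invr_ge0 ?(ltW c0) //.
  by rewrite ler_pdivrMr ?ltr0n // [leRHS]mulrC -K1.
by rewrite -exprMn divff ?expr1n // gt_eqF.
Qed.
End PL.

Lemma integral_gt0 d (T : measurableType d) (R : realType) (P : probability T R) (f : T -> R) :
  measurable_fun setT f -> (forall x, 0 < f x) -> (0 < \int[P]_x (f x)%:E)%E.
Proof.
move=> mf f0.
have ge0 : (0 <= \int[P]_x (f x)%:E)%E by apply: integral_ge0 => x _; rewrite lee_fin ltW.
rewrite lt_neqAle ge0 andbT eq_sym; apply/eqP => I0.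
have : ae_eq P setT (EFin \o f) (cst 0%E).
  apply/ae_eq_integral_abs => //; first exact/measurable_EFinP.
  by rewrite -[RHS]I0; apply: eq_integral => x _; rewrite /= gtr0_norm.
move=> [N [mN N0 sub]].
have : P setT = 0%E.
  apply/eqP; rewrite eq_le measure_ge0 andbT -N0; apply: le_measure; rewrite ?inE //.
  by apply: subset_trans sub => x _ /= /(_ I) [] /eqP; rewrite gt_eqF.
by move=> /eqP; rewrite probability_setT onee_eq0.
Qed.

Section GaussianPL.
Variable R : realType.
Local Notation mu := (@lebesgue_measure R).

Lemma is_interval_normal_pdf (m s t : R) : s != 0 -> is_interval [set x | t < normal_pdf m s x].
Proof.
move=> s0 x y /= tx ty z /andP[xz zy].
have mono a b : (a - m) ^+ 2 <= (b - m) ^+ 2 -> normal_pdf m s b <= normal_pdf m s a.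
  move=> ab; rewrite !normal_pdfE // /normal_fun ler_wpM2l ?normal_peak_ge0 // ler_expR.
  by rewrite !mulNr lerN2 ler_wpM2r // invr_ge0 mulrn_wge0 // sqr_ge0.
have [zm|mz] := leP z m.
  by apply: lt_le_trans tx _; apply: mono; nra.
by apply: lt_le_trans ty _; apply: mono; nra.
Qed.

(* The Gaussian exponents of [u g] and [w g], [g] the density, combine by the identity
   [K (a - b)^2 / (K + 1) = a^2 + K b^2 - (a + K b)^2 / (K + 1)]. *)
Lemma gaussian_prekopa_leindler (K : nat) (m s : R) (u w : R -> R) : (0 < K)%N -> 0 < s ->
  measurable_fun setT u -> measurable_fun setT w -> (forall x, 0 < u x) -> (forall x, 0 < w x) ->
  (forall a b, u (m + s * a) * w (m + s * b) ^+ K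
     <= expR (K%:R / K.+1%:R * ((a - b) ^+ 2 / 2))) ->
  exists a b, [/\ 0 <= a, 0 <= b, (\int[normal_prob m s]_x (u x)%:E = a%:E)%E,
    (\int[normal_prob m s]_x (w x)%:E = b%:E)%E & a * b ^+ K <= 1].
Proof.
move=> K0 s0 mu' mw u0 w0 H.
have sn0 : s != 0 by rewrite gt_eqF.
have pdf0 x : 0 < normal_pdf m s x.
  by rewrite normal_pdfE // /normal_fun mulr_gt0 ?expR_gt0 // normal_peak_gt0.
have mpdf := measurable_normal_pdf m s.
have K0' : 0 < K%:R :> R by rewrite ltr0n.
have pdfB x : 0 < normal_pdf m s x <= normal_peak s.
  by rewrite pdf0; exact: normal_pdf_ub.
have conv x y : u x * normal_pdf m s x * (w y * normal_pdf m s y) ^+ K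
  <= normal_pdf m s ((x + K%:R * y) / K.+1%:R) ^+ K.+1.
  rewrite exprMn mulrACA.
  pose al := (x - m) / s; pose be := (y - m) / s.
  have xal : m + s * al = x by rewrite /al; field.
  have ybe : m + s * be = y by rewrite /be; field.
  have {}H := H al be; rewrite xal ybe in H.
  have gE z : normal_pdf m s z = normal_peak s * expR (- ((z - m) / s) ^+ 2 / 2).
    rewrite normal_pdfE // /normal_fun; congr (_ * expR _).
    by rewrite -mulr_natr; field.
  rewrite !gE; set pk := normal_peak s.
  set zz := (_ + _) / _ - m; have -> : zz / s = (al + K%:R * be) / K.+1%:R.
    rewrite /zz /al /be -natr1; field; rewrite sn0 /=; lra.
  rewrite -/al -/be; clearbody al be; rewrite !exprMn -!expRM_natl.
  rewrite [pk * _ * (pk ^+ K * _)]mulrACA -exprS -expRD mulrCA ler_pM2l ?exprn_gt0 ?normal_peak_gt0 //.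
  apply: le_trans (ler_wpM2r (ltW (expR_gt0 _)) H) _.
  rewrite -expRD ler_expR le_eqVlt; apply/orP; left; apply/eqP.
  rewrite -natr1; field; lra.
have [a [b [a0 b0 ea eb ab]]] := @prekopa_leindler R K (fun x => u x * normal_pdf m s x)
  (fun x => w x * normal_pdf m s x) (normal_pdf m s) (normal_peak s) K0
  (measurable_funM mu' mpdf) (measurable_funM mw mpdf) mpdf
  (fun x => mulr_gt0 (u0 x) (pdf0 x)) (fun x => mulr_gt0 (w0 x) (pdf0 x)) pdfB
  (fun t => @is_interval_normal_pdf m s t sn0) (integral_normal_pdf m s) conv.
have E (h : R -> R) : measurable_fun setT h -> (forall x, 0 < h x) ->
  (\int[normal_prob m s]_x (h x)%:E = \int[mu]_x (h x * normal_pdf m s x)%:E)%E.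
  move=> mh h0; rewrite (@integral_normal_prob _ m s (fun x => (h x)%:E)) //.
    exact/measurable_EFinP.
  by move=> x; rewrite lee_fin ltW.
by exists a, b; split => //; rewrite E.
Qed.
End GaussianPL.

(** * Tensorisation over the Gaussian coordinates *)

Section Tensor.
Context d (T : measurableType d) (R : realType) (P : probability T R).

(** The point with standardised coordinates [a]. Distances are measured in [a], which keeps
    coordinates of zero variance harmless. *)
Definition affine n (m v a : 'I_n -> R) : n.-tuple R :=
  [tuple m i + Num.sqrt (v i) * a i | i < n].

Definition consf n (x : R) (a : 'I_n -> R) (i : 'I_n.+1) : R :=
  if unlift ord0 i is Some j then a j else x.

Lemma affine_cons n (m v : 'I_n.+1 -> R) x (a : 'I_n -> R) :
  affine m v (consf x a) = [tuple of m ord0 + Num.sqrt (v ord0) * x ::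
    affine (fun i => m (lift ord0 i)) (fun i => v (lift ord0 i)) a].
Proof.
apply: eq_from_tnth => i; rewrite tnth_mktuple /consf; case: unliftP => [j|] ->.
  by rewrite tnthS tnth_mktuple.
by rewrite tnth0.
Qed.

Lemma sum_consf n (x y : R) (a b : 'I_n -> R) :
  \sum_i (consf x a i - consf y b i) ^+ 2 = (x - y) ^+ 2 + \sum_i (a i - b i) ^+ 2.
Proof.
rewrite big_ord_recl /consf unlift_none; congr (_ + _).
by apply: eq_bigr => i _; rewrite liftK.
Qed.

Definition rv n (X : 'I_n -> T -> R) (x : T) : n.-tuple R := [tuple X i x | i < n].

Lemma rv_cons n (X : 'I_n.+1 -> T -> R) x : rv X x = [tuple of X ord0 x :: rv_tail X x].
Proof.
apply: eq_from_tnth => i; rewrite tnth_mktuple.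
by case: (unliftP ord0 i) => [j|] ->; rewrite ?tnthS ?tnth_mktuple ?tnth0.
Qed.

(** For fixed first coordinates the slices satisfy the hypothesis in one dimension less, up to a
    factor depending on these coordinates. The resulting bound on the partial integrals is the
    one-dimensional hypothesis. *)
Lemma gaussian_vector_prekopa_leindler (K : nat) n (m v : 'I_n -> R) (X : 'I_n -> T -> R)
  (u w : n.-tuple R -> R) : (0 < K)%N ->
  (forall i, 0 <= v i) -> indep_rvs P X -> (forall i, has_normal_law P (X i) (m i) (v i)) ->
  measurable_fun setT u -> measurable_fun setT w -> (forall x, 0 < u x) -> (forall x, 0 < w x) ->
  (forall a b, u (affine m v a) * w (affine m v b) ^+ K
     <= expR (K%:R / K.+1%:R * ((\sum_i (a i - b i) ^+ 2) / 2))) ->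
  exists a b, [/\ (\int[P]_x (u (rv X x))%:E = a%:E)%E, (\int[P]_x (w (rv X x))%:E = b%:E)%E,
    0 < a, 0 < b & a * b ^+ K <= 1].
Proof.
move=> K0; elim: n m v X u w => [|n IH] m v X u w v0 iX lX mu' mw u0 w0 H.
  have t0 (t : 0.-tuple R) : t = [tuple] by exact: tuple0.
  have E f : (\int[P]_x (f (rv X x))%:E = (f [tuple] : R)%:E)%E.
    under eq_integral do rewrite (t0 (rv X _)).
    by rewrite integral_cst // [X in (_ * X)%E]probability_setT mule1.
  exists (u [tuple]), (w [tuple]); rewrite !E; split => //.
  have := H (fun=> 0) (fun=> 0); rewrite !(t0 (affine _ _ _)) big_ord0 mul0r mulr0 expR0 //.
have mX : forall i, measurable_fun setT (X i) by case: iX.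
pose m' i := m (lift ord0 i); pose v' i := v (lift ord0 i).
pose X' i := X (lift ord0 i).
have v'0 i : 0 <= v' i by exact: v0.
have iX' : indep_rvs P X' by exact: indep_rv_tail.
have lX' i : has_normal_law P (X' i) (m' i) (v' i) by exact: lX.
have mcons (f : n.+1.-tuple R -> R) x : measurable_fun setT f ->
    measurable_fun setT (fun t : n.-tuple R => f [tuple of x :: t]).
  move=> mf; apply: measurableT_comp => //; apply: measurable_cons => //.
have split_int (f : n.+1.-tuple R -> R) : measurable_fun setT f -> (forall t, 0 < f t) ->
  [/\ measurable_fun setT (fun r : R => \int[P]_y (f [tuple of r :: rv X' y])%:E)%E &
   (\int[P]_x (f (rv X x))%:E = \int[P]_x \int[P]_y (f [tuple of X ord0 x :: rv X' y])%:E)%E].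
  move=> mf f0.
  pose F (z : R * n.-tuple R) := (f [tuple of z.1 :: z.2])%:E.
  have mF : measurable_fun setT F.
    apply/measurable_EFinP; apply: measurableT_comp => //; apply: measurable_cons => //.
  split; last first.
    under eq_integral do rewrite rv_cons.
    rewrite -[LHS]/(\int[P]_x F (X ord0 x, rv_tail X x))%E.
    rewrite (integral_indep_split iX mF) // => z; by rewrite lee_fin ltW.
  apply: (measurable_fun_fubini_tonelli_F (fun z : R * T => F (z.1, rv X' z.2))) => //.
  - apply: measurableT_comp => //; apply: measurable_fun_pair => //.
    by apply: measurableT_comp => //; exact: (measurable_rv_tail iX).
  - by move=> z; rewrite lee_fin ltW.
have slice (r1 r2 c : R) : 0 < c ->
   (forall a b, c * (u [tuple of r1 :: affine m' v' a] * w [tuple of r2 :: affine m' v' b] ^+ K)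
     <= expR (K%:R / K.+1%:R * ((\sum_i (a i - b i) ^+ 2) / 2))) ->
   exists a b, [/\ (\int[P]_y (u [tuple of r1 :: rv X' y])%:E = a%:E)%E,
     (\int[P]_y (w [tuple of r2 :: rv X' y])%:E = b%:E)%E,
     0 < a, 0 < b & c * (a * b ^+ K) <= 1].
  move=> c0 Hc.
  have [a [b [ea eb a0 b0 ab]]] := IH m' v' X' (fun t => c * u [tuple of r1 :: t])
    (fun t => w [tuple of r2 :: t]) v'0 iX' lX'
    (measurable_funM (measurable_cst c) (mcons u r1 mu')) (mcons w r2 mw)
    (fun t => mulr_gt0 c0 (u0 _)) (fun t => w0 _)
    (fun a b => eq_ind _ (fun z => z <= _) (Hc a b) _ (mulrA _ _ _)).
  exists (a / c), b; rewrite divr_gt0 //; split => //.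
  - move: ea; under eq_integral do rewrite EFinM.
    rewrite ge0_integralZl //; last 3 first.
    + apply/measurable_EFinP; apply: (measurableT_comp (mcons u r1 mu')).
      exact: (measurable_rv_tail iX).
    + by move=> x _; rewrite lee_fin ltW.
    + by rewrite lee_fin ltW.
    move=> /(congr1 (fun z => c^-1%:E * z)%E).
    by rewrite muleA -!EFinM mulVf ?gt_eqF // mul1e [c^-1 * a]mulrC.
  - by rewrite mulrA mulrCA divff ?gt_eqF // mulr1.
have [mU uE] := split_int u mu' u0; have [mW wE] := split_int w mw w0.
(* With zero variance the first coordinate has the Dirac law at [m ord0]; both slices are taken
   there, at no cost. *)
have [vE|vn0] := eqVneq (v ord0) 0.
  have dirac_int (F : R -> \bar R) : measurable_fun setT F -> (forall x, 0 <= F x)%E ->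
     (\int[P]_x F (X ord0 x) = F (m ord0))%E.
    move=> mF F0.
    rewrite (@integral_law _ _ _ P _ (mX ord0) (@dirac _ (measurableTypeR R) (m ord0) R)) //.
      by rewrite integral_dirac // diracT mul1e.
    by move=> B mB; have := lX ord0 B mB; rewrite vE eqxx.
  have ge0 (f : n.+1.-tuple R -> R) (r : R) : (forall t, 0 < f t) ->
     (0 <= \int[P]_y (f [tuple of r :: rv X' y])%:E)%E.
    by move=> f0; apply: integral_ge0 => y _; rewrite lee_fin ltW.
  rewrite uE wE (dirac_int _ mU (fun r => ge0 u r u0)) (dirac_int _ mW (fun r => ge0 w r w0)).
  have [|a [b [ea eb a0 b0 ab]]] := slice (m ord0) (m ord0) 1 ltr01.
    move=> a b; rewrite mul1r.
    have := H (consf 0 a) (consf 0 b); rewrite !affine_cons vE sqrtr0 mul0r addr0.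
    by rewrite sum_consf subrr expr0n add0r.
  by exists a, b; split => //; rewrite mul1r in ab.
have s0 : 0 < Num.sqrt (v ord0) by rewrite sqrtr_gt0 lt_neqAle eq_sym vn0 v0.
set s := Num.sqrt _ in s0.
have slice2 a0 b0 : exists a b,
    [/\ (\int[P]_y (u [tuple of m ord0 + s * a0 :: rv X' y])%:E = a%:E)%E,
     (\int[P]_y (w [tuple of m ord0 + s * b0 :: rv X' y])%:E = b%:E)%E,
     0 < a, 0 < b & a * b ^+ K <= expR (K%:R / K.+1%:R * ((a0 - b0) ^+ 2 / 2))].
  set D := _ * (_ / 2).
  (* The factor exp(- D) cancels the cost of the first coordinate. *)
  have [|a [b [ea eb ag0 bg0 ab]]] := slice (m ord0 + s * a0) (m ord0 + s * b0) (expR (- D))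
    (expR_gt0 _).
    move=> a b; have := H (consf a0 a) (consf b0 b); rewrite !affine_cons sum_consf.
    rewrite mulrDl mulrDr expRD -/D -/s => h.
    by rewrite expRN mulrC ler_pdivrMr ?expR_gt0 // [leRHS]mulrC.
  by exists a, b; split => //; move: ab; rewrite expRN mulrC ler_pdivrMr ?expR_gt0 // mul1r.
have xE x : m ord0 + s * ((x - m ord0) / s) = x by field; rewrite gt_eqF.
pose U r := fine (\int[P]_y (u [tuple of r :: rv X' y])%:E).
pose W r := fine (\int[P]_y (w [tuple of r :: rv X' y])%:E).
have UE r : (\int[P]_y (u [tuple of r :: rv X' y])%:E = (U r)%:E)%E.
  by rewrite /U; have [a [b []]] := slice2 ((r - m ord0) / s) 0; rewrite xE => ->.
have WE r : (\int[P]_y (w [tuple of r :: rv X' y])%:E = (W r)%:E)%E.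
  by rewrite /W; have [a [b [_]]] := slice2 0 ((r - m ord0) / s); rewrite xE => ->.
have U0 r : 0 < U r.
  by have [a [b [+ _ a0 _ _]]] := slice2 ((r - m ord0) / s) 0; rewrite xE UE => -[->].
have W0 r : 0 < W r.
  by have [a [b [_ + _ b0 _]]] := slice2 0 ((r - m ord0) / s); rewrite xE WE => -[->].
have mU' : measurable_fun setT U.
  by apply/measurable_EFinP; move: mU; under eq_fun do rewrite UE.
have mW' : measurable_fun setT W.
  by apply/measurable_EFinP; move: mW; under eq_fun do rewrite WE.
have UW a b : U (m ord0 + s * a) * W (m ord0 + s * b) ^+ K
    <= expR (K%:R / K.+1%:R * ((a - b) ^+ 2 / 2)).
  have [a' [b' [ea eb _ _ h]]] := slice2 a b.
  by move: ea eb; rewrite UE WE => -[->] [->].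
have [a [b [a0 b0 ea eb ab]]] := gaussian_prekopa_leindler K0 s0 mU' mW' U0 W0 UW.
have law_int (f : R -> R) : measurable_fun setT f -> (forall r, 0 < f r) ->
   (\int[P]_x (f (X ord0 x))%:E = \int[normal_prob (m ord0) s]_r (f r)%:E)%E.
  move=> mf f0; apply: (@integral_law _ _ _ P _ (mX ord0) _ (fun r => (f r)%:E)) => //.
  - by move=> B mB; have := lX ord0 B mB; rewrite (negbTE vn0).
  - exact/measurable_EFinP.
  - by move=> r; rewrite lee_fin ltW.
exists a, b; rewrite uE wE.
under eq_integral do rewrite UE.
under [in X in [/\ _, X, _, _ & _]]eq_integral do rewrite WE.
rewrite !law_int // -!lte_fin -ea -eb; split => //; exact: integral_gt0.
Qed.
End Tensor.

Lemma ler_harmonic_limit (R : realType) (x a c : R) :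
  (forall k : nat, x <= a + c * k.+1%:R^-1) -> x <= a.
Proof.
move=> H.
have lim : a + c * k.+1%:R^-1 @[k --> \oo] --> a + c * 0.
  by apply: cvgD; [exact: cvg_cst | apply: cvgM; [exact: cvg_cst | exact: cvg_harmonic]].
rewrite mulr0 addr0 in lim.
by apply: (@ler_cvg_to _ \oo _ _ (fun=> x) (fun k => a + c * k.+1%:R^-1)) => //;
  [exact: cvg_cst | exact: nearW].
Qed.

(** * Gaussian concentration *)

Section Concentration.
Context d (T : measurableType d) (R : realType) (P : probability T R).

(** The tangent line of exp at [l], composed with [f], has integral exp(l). The right-hand side may
    be infinite. *)
Lemma jensen_expR (f : T -> R) (l : R) : P.-integrable setT (EFin \o f) ->
  (\int[P]_x (f x)%:E = l%:E)%E -> ((expR l)%:E <= \int[P]_x (expR (f x))%:E)%E.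
Proof.
move=> intf El.
have mf : measurable_fun setT f by apply/measurable_EFinP; exact: measurable_int intf.
have iexp : (\int[P]_x (expR l * (1 - l) + expR l * f x)%:E = (expR l)%:E)%E.
  under eq_integral do rewrite EFinD [(expR l * f _)%:E]EFinM.
  rewrite integralD //; last 2 first.
  - exact: finite_measure_integrable_cst.
  - exact: integrableZl.
  rewrite integral_cst // [X in (_ * X)%E]probability_setT mule1 integralZl // El.
  by rewrite -EFinM -EFinD; congr (_%:E); ring.
rewrite -[leLHS]iexp; apply: le_integral_ge0 => //.
- by apply/measurable_EFinP; apply: measurable_funD => //; apply: measurable_funM.
- by apply/measurable_EFinP; exact: measurableT_comp.
move=> x _; rewrite lee_fin -mulrDr -[in leRHS](subrKC l (f x)) expRD.
by rewrite ler_pM2l ?expR_gt0 // -addrA [- l + _]addrC; exact: expR_ge1Dx.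
Qed.

Variables (n : nat) (m v : 'I_n -> R) (X : 'I_n -> T -> R) (L : n.-tuple R -> R) (S2 : R).
Hypotheses (v0 : forall i, 0 <= v i) (iX : indep_rvs P X).
Hypothesis lX : forall i, has_normal_law P (X i) (m i) (v i).
Hypothesis mL : measurable_fun setT L.
(** Young's form of a Lipschitz condition with constant sqrt(S2) in the standardised coordinates. *)
Hypothesis lipL : forall th a b, th * (L (affine m v a) - L (affine m v b))
  <= (\sum_i (a i - b i) ^+ 2) / 2 + th ^+ 2 * S2 / 2.

(* Prekopa-Leindler with weights [1 : N] bounds the exponential moment of [s * th * L],
   [s = N / (N + 1)], by that of [- th * L / (N + 1)], and [N -> oo] gives the sharp constant. *)
Lemma gaussian_mgf_pl (N : nat) (th : R) : (0 < N)%N -> exists a b,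
  [/\ (\int[P]_x (expR (N%:R / N.+1%:R * (th * L (rv X x) - th ^+ 2 * S2 / 2)))%:E = a%:E)%E,
      (\int[P]_x (expR (- (th * L (rv X x)) / N.+1%:R))%:E = b%:E)%E,
      0 < a, 0 < b & a * b ^+ N <= 1].
Proof.
move=> N0; pose s : R := N%:R / N.+1%:R.
apply: (gaussian_vector_prekopa_leindler (m := m) (v := v) (X := X)
  (u := fun t => expR (s * (th * L t - th ^+ 2 * S2 / 2)))
  (w := fun t => expR (- (th * L t) / N.+1%:R))) => //.
- apply: measurableT_comp => //; apply: measurable_funM => //.
  by apply: measurable_funB => //; apply: measurable_funM.
- apply: measurableT_comp => //; apply: measurable_funM => //.
  by apply: measurableT_comp => //; apply: measurable_funM.
- by move=> t; exact: expR_gt0.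
- by move=> t; exact: expR_gt0.
move=> a b; rewrite -expRM_natl -expRD ler_expR -/s.
have -> : s * (th * L (affine m v a) - th ^+ 2 * S2 / 2) + N%:R * (- (th * L (affine m v b)) / N.+1%:R)
  = s * (th * (L (affine m v a) - L (affine m v b)) - th ^+ 2 * S2 / 2).
  by rewrite /s; field; rewrite addrC natr1 pnatr_eq0.
apply: ler_wpM2l; first by rewrite divr_ge0.
by rewrite lerBlDr.
Qed.

Lemma measurable_rv : measurable_fun setT (rv X).
Proof.
apply/measurable_fun_tnthP => i; rewrite (_ : _ \o _ = X i); first by case: iX.
by apply/funext => x /=; rewrite tnth_mktuple.
Qed.

Let mLX : measurable_fun setT (fun x => L (rv X x)).
Proof. exact: (measurableT_comp mL measurable_rv). Qed.

Lemma gaussian_mgf_lty th : (\int[P]_x (expR (th * L (rv X x)))%:E < +oo)%E.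
Proof.
(* For N = 1 the weight is 1 / 2, which 2 th compensates. *)
have [a [_ [ea _ _ _ _]]] := @gaussian_mgf_pl 1 (2 * th) isT.
set c := (2 * th) ^+ 2 * S2 / 2 in ea.
have : (\int[P]_x ((expR (c / 2))%:E * (expR (1 / 2 * (2 * th * L (rv X x) - c)))%:E) = (expR (c / 2) * a)%:E)%E.
  rewrite ge0_integralZl ?ea //.
  - by apply/measurable_EFinP; apply: measurableT_comp => //; apply: measurable_funM => //;
    apply: measurable_funB => //; apply: measurable_funM.
rewrite (eq_integral (fun x => (expR (th * L (rv X x)))%:E)); first by move=> ->; rewrite ltry.
by move=> x _; rewrite -EFinM -expRD; congr (expR _)%:E; field.
Qed.

(* [lipL] holds for both signs of [th], so [expR L] and [expR (- L)] are integrable. *)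
Lemma integrable_gaussian_lipschitz : P.-integrable setT (fun x => (L (rv X x))%:E).
Proof.
apply: (@le_integrable _ _ _ _ _ measurableT _
  (fun x => (expR (1 * L (rv X x)))%:E + (expR (- 1 * L (rv X x)))%:E)%E).
- exact/measurable_EFinP.
- move=> x _; rewrite -EFinD !abse_EFin lee_fin [leRHS]ger0_norm ?addr_ge0 ?expR_ge0 //.
  rewrite mul1r mulN1r; set y := L _.
  have := expR_ge1Dx y; have := expR_ge1Dx (- y); have := expR_ge0 y; have := expR_ge0 (- y).
  by case: (ger0P y); lra.
have int th : P.-integrable setT (fun x => (expR (th * L (rv X x)))%:E).
  apply/integrableP; split.
    by apply/measurable_EFinP; apply: measurableT_comp => //; apply: measurable_funM.
  apply: le_lt_trans (gaussian_mgf_lty th); rewrite le_eqVlt; apply/orP; left; apply/eqP.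
  by apply: eq_integral => x _; rewrite abse_EFin ger0_norm // expR_ge0.
by apply: integrableD => //; exact: int.
Qed.

(** With t = th / s the first integral is, up to a constant factor, the exponential moment at th.
    Jensen bounds the second below by exp(- t l / (N + 1)), whose N-th power is exp(- th l). The
    exponent left is th^2 S2 / 2 times 1 / s = 1 + 1 / N. *)
Lemma gaussian_mgf_le th (l : R) : (\int[P]_x (L (rv X x))%:E = l%:E)%E ->
  (\int[P]_x (expR (th * L (rv X x)))%:E <= (expR (th * l + th ^+ 2 * S2 / 2))%:E)%E.
Proof.
move=> El.
have M0 : (0 < \int[P]_x (expR (th * L (rv X x)))%:E)%E.
  apply: integral_gt0 => [|x]; last exact: expR_gt0.
  by apply: measurableT_comp => //; apply: measurable_funM.
have : (\int[P]_x (expR (th * L (rv X x)))%:E)%E \is a fin_num.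
  by rewrite ge0_fin_numE ?(ltW M0) // gaussian_mgf_lty.
move: M0 => + /fineK MM; rewrite -MM lte_fin; set M := fine _ in MM * => M0.
rewrite lee_fin -[M]lnK // ler_expR.
apply: (@ler_harmonic_limit _ _ _ (th ^+ 2 * S2 / 2)) => k.
pose N := k.+1; have N0 : N%:R != 0 :> R by rewrite pnatr_eq0.
have N1 : N.+1%:R != 0 :> R by rewrite pnatr_eq0.
pose s : R := N%:R / N.+1%:R; have s0 : s != 0 by rewrite mulf_neq0 // invr_eq0.
pose t := th / s; have st : s * t = th by rewrite mulrC divfK.
have [a [b [ea eb a0 b0 ab]]] := @gaussian_mgf_pl N t isT.
have eaM : a = M * expR (- (s * (t ^+ 2 * S2 / 2))).
  have : (\int[P]_x ((expR (- (s * (t ^+ 2 * S2 / 2))))%:E * (expR (th * L (rv X x)))%:E) = a%:E)%E.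
    rewrite -ea; apply: eq_integral => x _; rewrite -EFinM -expRD; congr (expR _)%:E.
    by rewrite -/s -st; ring.
  rewrite ge0_integralZl //; last first.
    by apply/measurable_EFinP; apply: measurableT_comp => //; apply: measurable_funM.
  by rewrite -MM -EFinM => -[<-]; rewrite mulrC.
have bl : expR (- (t * l) / N.+1%:R) <= b.
  rewrite -lee_fin -eb; apply: jensen_expR.
    rewrite (_ : _ \o _ = fun x => ((- t / N.+1%:R)%:E * (L (rv X x))%:E)%E); last first.
      by apply/funext => x /=; rewrite -EFinM; congr (_%:E); ring.
    exact: (integrableZl measurableT _ integrable_gaussian_lipschitz).
  transitivity (\int[P]_x ((- t / N.+1%:R)%:E * (L (rv X x))%:E))%E.
    by apply: eq_integral => x _; rewrite -EFinM; congr (_%:E); ring.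
  rewrite (integralZl measurableT integrable_gaussian_lipschitz) El -EFinM; congr (_%:E); ring.
have : M * expR (- (s * (t ^+ 2 * S2 / 2))) * expR (- (t * l) / N.+1%:R) ^+ N <= 1.
  apply: le_trans ab; rewrite -eaM; apply: ler_wpM2l; first exact: ltW.
  by apply: lerXn2r; rewrite ?nnegrE ?expR_ge0 // ltW.
rewrite -expRM_natl -mulrA -expRD -[M]lnK // -expRD expR_le1 => h.
rewrite -subr_le0; apply: le_trans h; rewrite lnK // le_eqVlt; apply/orP; left; apply/eqP.
rewrite /t /s /N -!natr1; field.
by rewrite !natr1 !pnatr_eq0.
Qed.
End Concentration.

(** The value th = x / S maximises th x - th^2 S / 2. For S = 0 the choice th = (D + 1) / x excludes
    x > 0. *)
Lemma le_sqrt_of_quadratic (R : realType) (x D S : R) : 0 <= D -> 0 <= S ->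
  (forall th, 0 <= th -> th * x <= D + th ^+ 2 * S / 2) -> x <= Num.sqrt (2 * S * D).
Proof.
move=> D0 S0 H; have [x0|x0] := leP x 0; first exact: le_trans (sqrtr_ge0 _).
have [SE|Sn0] := eqVneq S 0.
  have := H ((D + 1) / x); rewrite divr_ge0 ?addr_ge0 ?(ltW x0) // SE.
  rewrite divfK ?gt_eqF // mulr0 mul0r addr0 => /(_ isT); lra.
have Sp : 0 < S by rewrite lt_neqAle eq_sym Sn0.
have h := H (x / S) (divr_ge0 (ltW x0) (ltW Sp)).
rewrite -[x]ger0_norm ?(ltW x0) // -sqrtr_sqr ler_wsqrtr //.
have : S * (x / S * x) <= S * (D + (x / S) ^+ 2 * S / 2) by rewrite ler_pM2l.
have -> : S * (x / S * x) = x ^+ 2 by field.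
have -> : S * (D + (x / S) ^+ 2 * S / 2) = S * D + x ^+ 2 / 2 by field.
lra.
Qed.

(** * Exponential moments of the minimum eigenvalue and the two bounds *)

Section Core.
Variables (R : realType) (C : numClosedFieldType) (K : scalars R C) (n N : nat).
Local Notation emb := (emb K).
Variables (A : 'I_N -> 'M[C]_n.+1) (v : 'I_N -> R) (S2 : R).
Hypotheses (Ah : forall i, herm (A i)) (v0 : forall i, 0 <= v i).
Hypothesis S2A : forall u, unit_vec u -> \sum_i v i * qform K (A i) u ^+ 2 <= S2.

Let L (t : N.-tuple R) := lmin emb (pencilsum K A (tnth t)).

(** A minimising vector for the matrix at [b] is a trial vector for the matrix at [a]. The
    difference is then linear in a - b, and Young's inequality is applied to each term. *)
Lemma lmin_lipschitz m (c : R) a b : 0 <= c -> c * (L (affine m v a) - L (affine m v b))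
  <= (\sum_i (a i - b i) ^+ 2) / 2 + c ^+ 2 * S2 / 2.
Proof.
move=> c0; have hp x : herm (pencilsum K A x) by exact: herm_pencilsum.
have [u u1 uE] := lmin_evec K (hp (tnth (affine m v b))).
have le : L (affine m v a) - L (affine m v b) <= \sum_i Num.sqrt (v i) * (a i - b i) * qform K (A i) u.
  rewrite /L -uE; apply: le_trans (lerD (lmin_le_q K (hp _) u1) (lexx _)) _.
  rewrite /pencilsum !q_sum -sumrB le_eqVlt; apply/orP; left; apply/eqP.
  by apply: eq_bigr => i _; rewrite !qZ !tnth_mktuple; ring.
apply: le_trans (ler_wpM2l c0 le) _.
apply: (@le_trans _ _ ((\sum_i (a i - b i) ^+ 2) / 2 + c ^+ 2 * (\sum_i v i * qform K (A i) u ^+ 2) / 2)); last first.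
  by rewrite lerD2l ler_wpM2r // ler_wpM2l ?sqr_ge0 //; exact: S2A.
rewrite -mulrA mulrCA -[leRHS]/(_ + _) mulr_suml !mulr_sumr mulr_suml -big_split /=.
apply: ler_sum => i _; have := sqr_sqrtr (v0 i); set s := Num.sqrt _ => <-.
move: (a i - b i) (qform K (A i) u) => y z.
rewrite -subr_ge0 (_ : _ - _ = (y - c * s * z) ^+ 2 / 2); last by field.
by rewrite divr_ge0 ?sqr_ge0.
Qed.

Lemma lmin_young m th a b : th * (L (affine m v a) - L (affine m v b))
  <= (\sum_i (a i - b i) ^+ 2) / 2 + th ^+ 2 * S2 / 2.
Proof.
have [th0|th0] := leP 0 th; first exact: lmin_lipschitz.
have := @lmin_lipschitz m (- th) b a; rewrite oppr_ge0 (ltW th0) => /(_ isT).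
rewrite sqrrN mulNr -mulrN opprB => h; apply: le_trans h _.
by rewrite lerD2r ler_wpM2r // le_eqVlt; apply/orP; left; apply/eqP;
  apply: eq_bigr => i _; rewrite -sqrrN opprB.
Qed.

Context d (T : measurableType d) (P : probability T R) (W : 'I_N -> T -> R).
Context d' (T' : measurableType d') (P' : probability T' R) (X : 'I_N -> T' -> R).
Hypotheses (A0 : forall i u, unit_vec u -> 0 <= qform K (A i) u).
Hypotheses (iW : indep_rvs P W) (iX : indep_rvs P' X) (W0 : forall i x, 0 <= W i x).
Hypothesis W2 : forall i, ('E_P[fun x => (W i x ^+ 2)%R] < +oo)%E.
Hypothesis vE : forall i, v i = second_moment P (W i).
Hypothesis lX : forall i, has_normal_law P' (X i) (mean P (W i)) (v i).

Let lY x := lmin emb (pencilsum K A (W^~ x)).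
Let lZ x := lmin emb (pencilsum K A (X^~ x)).

Let mX i : measurable_fun setT (X i). Proof. by case: iX. Qed.
Let mW i : measurable_fun setT (W i). Proof. by case: iW. Qed.
Let mlY : measurable_fun setT lY. Proof. exact: measurable_lmin. Qed.
Let mlZ : measurable_fun setT lZ. Proof. exact: measurable_lmin. Qed.

Let LrvE x : L (rv X x) = lZ x.
Proof.
rewrite /L /lZ; congr (lmin emb (pencilsum K A _)).
by apply/funext => i; rewrite tnth_mktuple.
Qed.

Let mL : measurable_fun setT L.
Proof.
apply: (@measurable_lmin _ _ K _ _ (N.-tuple R) N (fun i t => tnth t i)) => // i.
exact: measurable_tnth.
Qed.

Lemma integrable_lmin_gaussian : P'.-integrable setT (EFin \o lZ).
Proof.
have := integrable_gaussian_lipschitz v0 iX lX mL (@lmin_young (fun i => mean P (W i))).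
by under eq_fun do rewrite LrvE.
Qed.

Definition mean_lmin_gaussian := fine (\int[P']_x (lZ x)%:E)%E.
Local Notation l := mean_lmin_gaussian.

Lemma mean_lmin_gaussianE : (\int[P']_x (lZ x)%:E = l%:E)%E.
Proof. by rewrite fineK // integrable_fin_num //; exact: integrable_lmin_gaussian. Qed.

Lemma mgf_lmin th : 0 <= th ->
  (\int[P]_x (expR (- th * lY x))%:E <= (n.+1%:R * expR (- th * l + th ^+ 2 * S2 / 2))%:E)%E.
Proof.
move=> th0.
(* The factor th >= 0 moves into the [A i], which stay positive semidefinite, and the comparison is
   used with H = 0. *)
have scaleE x : emb (- th) *: pencilsum K A x = 0 - \sum_i emb (x i) *: (emb th *: A i).
  rewrite rmorphN scaleNr sub0r /pencilsum scaler_sumr; congr (- _); apply: eq_bigr => i _.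
  by rewrite !scalerA mulrC.
have mexp d0 (T0 : measurableType d0) (f : T0 -> R) : measurable_fun setT f ->
    measurable_fun setT (fun x => (expR (- th * f x))%:E).
  move=> mf; apply/measurable_EFinP; apply: measurableT_comp => //; exact: measurable_funM.
apply: (@le_trans _ _ (\int[P]_x (trexp K (0 - \sum_i emb (W i x) *: (emb th *: A i)))%:E)%E).
  apply: ge0_le_integral => //.
  - exact: mexp.
  - by apply/measurable_EFinP; under eq_fun do rewrite -scaleE; exact: measurable_trexp_pencilsum.
  move=> x _; rewrite lee_fin -scaleE; apply: expR_lmin_le_trexp => //; exact: herm_pencilsum.
have h0 : herm (0 : 'M[C]_n.+1) by rewrite /herm trmx0 map_mx0.
apply: (@le_trans _ _ (\int[P']_x (trexp K (0 - \sum_i emb (X i x) *: (emb th *: A i)))%:E)%E).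
  have hA i : herm (emb th *: A i) by exact: hermZ.
  have qA i u : unit_vec u -> 0 <= qform K (emb th *: A i) u by move=> u1; rewrite qZ mulr_ge0 ?A0.
  have lX' i : has_normal_law P' (X i) (mean P (W i)) (second_moment P (W i)).
    by rewrite -vE; exact: lX.
  exact: (lindeberg h0 hA qA iW iX W0 W2 lX').
apply: (@le_trans _ _ (\int[P']_x (n.+1%:R%:E * (expR (- th * lZ x))%:E))%E).
  apply: ge0_le_integral => //.
  - by move=> x _; rewrite lee_fin trexp_ge0.
  - by apply/measurable_EFinP; under eq_fun do rewrite -scaleE; exact: measurable_trexp_pencilsum.
  - by apply: emeasurable_funM => //; exact: mexp.
  move=> x _; rewrite -scaleE -EFinM lee_fin; apply: trexp_le_lmin => //; exact: herm_pencilsum.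
rewrite ge0_integralZl //; last exact: mexp.
rewrite EFinM; apply: lee_wpmul2l => //.
have El : (\int[P']_x (L (rv X x))%:E = l%:E)%E.
  by under eq_integral do rewrite LrvE; exact: mean_lmin_gaussianE.
have h := gaussian_mgf_le v0 iX lX mL (@lmin_young (fun i => mean P (W i))) (- th) El.
rewrite sqrrN in h; apply: le_trans h; rewrite le_eqVlt; apply/orP; left; apply/eqP.
by apply: eq_integral => x _; rewrite LrvE.
Qed.

Let S20 : 0 <= S2.
Proof.
apply: le_trans (S2A (unit_evec 0 ord0)); apply: sumr_ge0 => i _.
by rewrite mulr_ge0 ?sqr_ge0.
Qed.

(* For [S2 = 0] the right-hand side is [n.+1], as [/ 0 = 0]. *)
Lemma lmin_tail (t : R) : 0 <= t ->
  (P [set x | (lY x <= l - t)%R] <= (n.+1%:R * expR (- t ^+ 2 / (2 * S2)))%:E)%E.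
Proof.
move=> t0; set E := [set _ | _].
have mE : measurable E.
  rewrite (_ : E = lY @^-1` `]-oo, (l - t)%R]%classic).
    by rewrite -[X in measurable X]setTI; apply: mlY => //; exact: measurable_itv.
  by apply/seteqP; split => x; rewrite /E /= in_itv.
have [->|Sn0] := eqVneq S2 0.
  rewrite mulr0 invr0 mulr0 expR0 mulr1; apply: le_trans (probability_le1 _ mE) _.
  by rewrite lee_fin ler1n.
have Sp : 0 < S2 by rewrite lt_neqAle eq_sym Sn0.
(* This minimises the exponent - th t + th^2 S2 / 2. *)
pose th := t / S2; have th0 : 0 <= th by rewrite divr_ge0.
pose c := expR (- th * (l - t)).
have mexp : measurable_fun setT (fun x => (expR (- th * lY x))%:E).
  by apply/measurable_EFinP; apply: measurableT_comp => //; exact: measurable_funM.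
have : (c%:E * P E <= (n.+1%:R * expR (- th * l + th ^+ 2 * S2 / 2))%:E)%E.
  apply: le_trans (mgf_lmin th0); rewrite -integral_cst //.
  apply: (@le_trans _ _ (\int[P]_(x in E) (expR (- th * lY x))%:E)%E).
    apply: ge0_le_integral => //.
    - by move=> x _; rewrite lee_fin expR_ge0.
    - exact: measurable_funTS mexp.
    - by move=> x /= Ex; rewrite lee_fin ler_expR !mulNr lerN2 ler_wpM2l.
  by apply: ge0_subset_integral => // x _; rewrite lee_fin expR_ge0.
rewrite -[P E]fineK ?fin_num_measure // -EFinM !lee_fin => h.
rewrite -(ler_pM2l (expR_gt0 (- th * (l - t)))) -/c; apply: le_trans h _.
rewrite mulrCA ler_pM2l ?ltr0n // /c -expRD ler_expR le_eqVlt; apply/orP; left; apply/eqP.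
by rewrite /th; field.
Qed.

(** Let y be the mean of [lY], assumed finite. Jensen's inequality and [mgf_lmin] give th (l - y) <=
    ln(n + 1) + th^2 S2 / 2 for all th >= 0, which is then optimised. As [lY] is nonnegative, its
    mean is otherwise +oo. *)
Lemma lmin_mean : ((l - Num.sqrt (2 * S2 * ln n.+1%:R))%:E <= \int[P]_x (lY x)%:E)%E.
Proof.
have lY0 x : 0 <= lY x.
  rewrite /lY; set M := pencilsum _ _ _; have Mh : herm M by exact: herm_pencilsum.
  have [u u1 <-] := lmin_evec K Mh.
  by rewrite q_sum; apply: sumr_ge0 => i _; rewrite qZ mulr_ge0 ?W0 ?A0.
have [->|fin] := eqVneq (\int[P]_x (lY x)%:E)%E +oo%E; first exact: leey.
have I0 : (0 <= \int[P]_x (lY x)%:E)%E by apply: integral_ge0 => x _; rewrite lee_fin.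
have : (\int[P]_x (lY x)%:E)%E \is a fin_num.
  by rewrite ge0_fin_numE // lt_neqAle fin leey.
move=> /fineK; set y := fine _ => yE; rewrite -yE lee_fin lerBlDr -lerBlDl.
have ilY : P.-integrable setT (EFin \o lY).
  apply/integrableP; split; first exact/measurable_EFinP.
  under eq_integral do rewrite /= ger0_norm ?lY0 //.
  by rewrite -yE ltry.
have D0 : 0 <= ln n.+1%:R :> R by rewrite ln_ge0 // ler1n.
apply: le_sqrt_of_quadratic => // th th0.
have ithY : P.-integrable setT (EFin \o (fun x => - th * lY x)).
  rewrite (_ : _ \o _ = fun x => ((- th)%:E * (lY x)%:E)%E).
    exact: (integrableZl measurableT _ ilY).
  by apply/funext => x /=; rewrite EFinM.
have := jensen_expR (l := - th * y) ithY.
under eq_integral do rewrite EFinM.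
rewrite integralZl // -yE -EFinM => /(_ erefl) h.
have := le_trans h (mgf_lmin th0); rewrite lee_fin -{1}[n.+1%:R]lnK ?posrE ?ltr0n //.
rewrite -expRD ler_expR; lra.
Qed.
End Core.

(** * The real and complex cases *)

Section CoreBound.
Variables (R : realType) (C : numClosedFieldType) (K : scalars R C) (n N : nat).
Local Notation emb := (emb K).

(** The supremum in [sigma_star2] is an upper bound only for a bounded set. Each form is at most the
    largest eigenvalue of [A i], written as minus the smallest one of - [A i]. *)
Lemma quadratic_bounded (A : 'I_N -> 'M[C]_n.+1) (v : 'I_N -> R) :
  (forall i, herm (A i)) -> (forall i u, unit_vec u -> 0 <= qform K (A i) u) -> (forall i, 0 <= v i) ->
  exists B, forall u, unit_vec u -> \sum_i v i * qform K (A i) u ^+ 2 <= B.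
Proof.
move=> Ah A0 v0; exists (\sum_i v i * (- lmin emb (emb (- 1) *: A i)) ^+ 2) => u u1.
apply: ler_sum => i _; apply: ler_wpM2l => //.
have := lmin_le_q K (hermZ K (- 1) (Ah i)) u1; rewrite qZ mulN1r lerNr => h.
by apply: lerXn2r => //; rewrite nnegrE; [|apply: le_trans h]; exact: A0.
Qed.

(** [S2] is any bound over complex unit vectors, so that the real case can insert the supremum over
    real ones. *)
Lemma lmin_gaussian_comparison (A : 'I_N -> 'M[C]_n.+1) (S2 : R)
  d (T : measurableType d) (P : probability T R) (W : 'I_N -> T -> R)
  d' (T' : measurableType d') (P' : probability T' R) (X : 'I_N -> T' -> R) :
  let v i := second_moment P (W i) in
  (forall i, herm (A i)) -> (forall i u, unit_vec u -> 0 <= qform K (A i) u) ->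
  indep_rvs P W -> (forall i x, 0 <= W i x) ->
  (forall i, ('E_P[fun x => (W i x ^+ 2)%R] < +oo)%E) -> indep_rvs P' X ->
  (forall i, has_normal_law P' (X i) (mean P (W i)) (v i)) ->
  (forall u, unit_vec u -> \sum_i v i * qform K (A i) u ^+ 2 <= S2) ->
  let lY x := lmin emb (pencilsum K A (W^~ x)) in
  let lZ x := lmin emb (pencilsum K A (X^~ x)) in
  ('E_P[lY] >= 'E_P'[lZ] - (Num.sqrt (2 * S2 * ln n.+1%:R))%:E)%E /\
  forall t : R, 0 <= t ->
    (P [set x | (lY x)%:E <= 'E_P'[lZ] - t%:E]
       <= (n.+1%:R * expR (- t ^+ 2 / (2 * S2)))%:E)%E.
Proof.
move=> v Ah A0 iW W0 W2 iX lX S2A lY lZ.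
have v0 i : 0 <= v i by apply: second_moment_ge0 => //; case: iW.
have El : ('E_P'[lZ] = (mean_lmin_gaussian K A P' X)%:E)%E.
  by rewrite unlock; exact: (mean_lmin_gaussianE Ah v0 S2A iX lX).
rewrite El; split.
  rewrite -EFinB unlock; exact: (lmin_mean Ah v0 S2A A0 iW iX W0 W2 (fun=> erefl) lX).
move=> t t0; rewrite -EFinB.
exact: (lmin_tail Ah v0 S2A A0 iW iX W0 W2 (fun=> erefl) lX t0).
Qed.
End CoreBound.

Section Instance.
Variable R : realType.

(** Kept transparent so that its fields reduce to the concrete real part and embedding. *)
Definition scalarsC : scalars R R[i].
Proof.
apply: (@Scalars R R[i] (@complex.Re R) (real_complex R)).
- by move=> [a b] [c d].
- by move=> x [a b]; rewrite /= mul0r subr0.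
- by move=> [a b]; rewrite lecE /= => /andP[].
- by move=> z /complex_realP[k ->].
- by move=> x; apply/complex_realP; exists x.
- by [].
Defined.

Lemma complex_case : thm21_for (@conj_C R) (@re_C R) (@emb_C R).
Proof.
move=> n [//|d] A _ Apsd dT T P W iW W0 W2 dT' T' P' X iX lX v Y Z s2.
have Ah i : herm (A i).
  have [sa _] := Apsd i; by rewrite /herm -[RHS]sa; apply/matrixP => j k; rewrite !mxE.
have quadE M (u : 'cV[R[i]]_d.+1) : quadf (@conj_C R) M u = quad M u.
  by rewrite /quadf /quad -adjvE.
have A0 i u : unit_vec u -> 0 <= qform scalarsC (A i) u.
  move=> u1; apply: (re_ge0 scalarsC); rewrite -quadE; exact: (Apsd i).2.
have v0 i : 0 <= v i by apply: second_moment_ge0 => //; case: iW.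
have [B BP] := quadratic_bounded Ah A0 v0.
apply: (lmin_gaussian_comparison (K := scalarsC) Ah A0 iW W0 W2 iX lX) => u u1.
apply: ub_le_sup.
  exists B => _ [w [w1 ->]]; have := BP w; rewrite /unit_vec -adjvE => /(_ w1).
  apply: le_trans; rewrite le_eqVlt; apply/orP; left; apply/eqP.
  by apply: eq_bigr => i _; rewrite quadE.
exists u; split; first by move: u1; rewrite /unit_vec -adjvE.
by apply: eq_bigr => i _; rewrite quadE.
Qed.

Local Notation rc := (real_complex R).
Local Notation quadR := (quadf (@id_R R)).

Lemma lmin_map d (M : 'M[R]_d) : lmin (@id_R R) M = lmin rc (map_mx rc M).
Proof.
by rewrite /lmin; congr inf; apply/seteqP; split => x /=; rewrite eigenvalue_map.
Qed.

Lemma pencilsum_map d N (A : 'I_N -> 'M[R]_d.+1) (x : 'I_N -> R) :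
  pencilsum scalarsC (fun i => map_mx rc (A i)) x = map_mx rc (\sum_i id_R (x i) *: A i).
Proof.
apply/matrixP => j k; rewrite [RHS]mxE !summxE rmorph_sum; apply: eq_bigr => i _.
by rewrite !mxE rmorphM.
Qed.

Lemma quadRE d (M : 'M[R]_d) (a : 'cV[R]_d) : quadR M a = \sum_i \sum_j a j 0 * M j i * a i 0.
Proof.
rewrite /quadf mxE; apply: eq_bigr => i _; rewrite mxE mulr_suml.
by apply: eq_bigr => j _; rewrite !mxE.
Qed.

(** For u = a + i b and a real matrix the cross terms are purely imaginary. *)
Lemma q_map_real d (M : 'M[R]_d.+1) (u : 'cV[R[i]]_d.+1) :
  qform scalarsC (map_mx rc M) u
  = quadR M (map_mx (@complex.Re R) u) + quadR M (map_mx (@complex.Im R) u).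
Proof.
rewrite /qform /quad mxE re_sum !quadRE -big_split /=; apply: eq_bigr => i _.
rewrite mxE mulr_suml -[complex.Re _]/(re scalarsC _) re_sum -big_split /=.
apply: eq_bigr => j _; rewrite !mxE.
by case: (u j 0) (u i 0) => [a b] [c e]; simpl; ring.
Qed.

Lemma unit_vec_Re_Im d (u : 'cV[R[i]]_d.+1) : unit_vec u ->
  quadR 1%:M (map_mx (@complex.Re R) u) + quadR 1%:M (map_mx (@complex.Im R) u) = 1.
Proof.
by move=> u1; rewrite -q_map_real map_mx1; exact: (q1 scalarsC u1).
Qed.

Lemma quadRZ d (M : 'M[R]_d) c (a : 'cV[R]_d) : quadR M (c *: a) = c ^+ 2 * quadR M a.
Proof.
rewrite !quadRE mulr_sumr; apply: eq_bigr => i _; rewrite mulr_sumr.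
by apply: eq_bigr => j _; rewrite !mxE; ring.
Qed.

Lemma quadR1E d (a : 'cV[R]_d) : quadR 1%:M a = \sum_i a i 0 ^+ 2.
Proof.
rewrite /quadf mulmx1 mxE; apply: eq_bigr => i _; by rewrite !mxE.
Qed.

Lemma unitvE d (a : 'cV[R]_d) : unitv (@id_R R) a <-> quadR 1%:M a = 1.
Proof. by rewrite /unitv /quadf mulmx1. Qed.

Lemma quadR_normalize d (a : 'cV[R]_d.+1) : exists2 e, unitv (@id_R R) e &
  forall M, quadR M a = quadR 1%:M a * quadR M e.
Proof.
have a0 : 0 <= quadR 1%:M a by rewrite quadR1E; apply: sumr_ge0 => i _; exact: sqr_ge0.
have [aE|an0] := eqVneq (quadR 1%:M a) 0.
  (* For a = 0 both sides vanish and any unit vector serves. *)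
  exists (delta_mx ord0 0).
    apply/unitvE; rewrite quadR1E (bigD1 ord0) //= big1 ?mxE ?eqxx ?expr1n ?addr0 // => i i0.
    by rewrite mxE (negbTE i0) expr0n.
  move=> M; rewrite aE mul0r; suff -> : a = 0 *: a by rewrite quadRZ expr0n mul0r.
  apply/matrixP => i j; rewrite ord1 !mxE mul0r.
  move: aE; rewrite quadR1E => /eqP; rewrite psumr_eq0; last by move=> k _; exact: sqr_ge0.
  by move=> /allP /(_ i (mem_index_enum _)); rewrite sqrf_eq0 => /eqP.
set r := quadR 1%:M a in a0 an0 *.
have r2 : Num.sqrt r ^+ 2 = r by rewrite sqr_sqrtr.
exists ((Num.sqrt r)^-1 *: a).
  by apply/unitvE; rewrite quadRZ exprVn r2 mulVf.
by move=> M; rewrite quadRZ exprVn r2 mulVKf.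
Qed.

(* A complex unit vector [a + i b] gives [A] the value of [a] plus that of [b]; the weak
   variance is convex under this splitting, so complexification does not increase it. *)
Lemma real_case : thm21_for (@id_R R) (@id_R R) (@id_R R).
Proof.
move=> n [//|d] A _ Apsd dT T P W iW W0 W2 dT' T' P' X iX lX v Y Z s2.
pose A' i := map_mx rc (A i).
have Ah i : herm (A' i).
  have [sa _] := Apsd i; rewrite /herm /A' -[in RHS]sa; apply/matrixP => j k; rewrite !mxE.
  by rewrite /id_R; apply/eqP; rewrite eq_complex /= oppr0 !eqxx.
have A0 i u : unit_vec u -> 0 <= qform scalarsC (A' i) u.
  by move=> _; rewrite q_map_real addr_ge0 //; exact: (Apsd i).2.
have v0 i : 0 <= v i by apply: second_moment_ge0 => //; case: iW.
have [B BP] := quadratic_bounded Ah A0 v0.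
have s2P e : unitv (@id_R R) e -> \sum_i v i * quadR (A i) e ^+ 2 <= s2.
  move=> e1; apply: ub_le_sup; last by exists e.
  exists B => _ [w [w1 ->]]; apply: le_trans (BP (map_mx rc w) _).
    rewrite le_eqVlt; apply/orP; left; apply/eqP; apply: eq_bigr => i _.
    have -> : quadR (A i) w = qform scalarsC (A' i) (map_mx rc w); last by [].
    rewrite q_map_real (_ : map_mx (@complex.Re R) _ = w).
      rewrite (_ : map_mx (@complex.Im R) _ = 0 *: w) ?quadRZ ?expr0n ?mul0r ?addr0 //.
      by apply/matrixP => j k; rewrite !mxE mul0r.
    by apply/matrixP => j k; rewrite !mxE.
  rewrite /unit_vec; apply: etrans (_ : rc ((adjv (@id_R R) w *m w) 0 0) = 1); last by rewrite w1.
  rewrite !mxE rmorph_sum; apply: eq_bigr => j _; rewrite !mxE rmorphM /=; congr (_ * _).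
  by apply/eqP; rewrite eq_complex /= oppr0 !eqxx.
have lE (x : 'I_n -> R) : lmin (@id_R R) (\sum_i id_R (x i) *: A i) = lmin rc (pencilsum scalarsC A' x).
  by rewrite lmin_map pencilsum_map.
have S2 u : unit_vec u -> \sum_i v i * qform scalarsC (A' i) u ^+ 2 <= s2.
  move=> u1; have := unit_vec_Re_Im u1.
  under eq_bigr do rewrite q_map_real.
  have [e e1 eE] := quadR_normalize (map_mx (@complex.Re R) u).
  have [f f1 fE] := quadR_normalize (map_mx (@complex.Im R) u).
  under eq_bigr do rewrite eE fE.
  set al := quadR _ _; set be := quadR _ _ => ab.
  have al0 : 0 <= al by rewrite /al quadR1E; apply: sumr_ge0 => i _; exact: sqr_ge0.
  have be0 : 0 <= be by rewrite /be quadR1E; apply: sumr_ge0 => i _; exact: sqr_ge0.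
  apply: (@le_trans _ _ (al * \sum_i v i * quadR (A i) e ^+ 2 + be * \sum_i v i * quadR (A i) f ^+ 2)).
    rewrite !mulr_sumr -big_split /=; apply: ler_sum => i _.
    move: (quadR (A i) e) (quadR (A i) f) (v i) (v0 i) => x y w w0.
    have -> : al = 1 - be by lra.
    rewrite -subr_ge0 (_ : _ - _ = w * (be * (1 - be) * (x - y) ^+ 2)); last by ring.
    by rewrite mulr_ge0 // mulr_ge0 ?sqr_ge0 // mulr_ge0 // -ab addrK.
  rewrite -[leRHS]mul1r -ab mulrDl; apply: lerD; apply: ler_wpM2l => //; exact: s2P.
have [h1 h2] := lmin_gaussian_comparison (K := scalarsC) Ah A0 iW W0 W2 iX lX S2.
have eY : (fun x => lmin (@id_R R) (Y x)) = (fun x => lmin rc (pencilsum scalarsC A' (W^~ x))).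
  by apply/funext => x; rewrite -lE.
have eZ : (fun x => lmin (@id_R R) (Z x)) = (fun x => lmin rc (pencilsum scalarsC A' (X^~ x))).
  by apply/funext => x; rewrite -lE.
rewrite eY eZ; split; first exact: h1.
move=> t t0; apply: le_trans (h2 t t0); rewrite le_eqVlt; apply/orP; left; apply/eqP.
by congr (P _); apply/seteqP; split => x /=; rewrite -lE.
Qed.
End Instance.

(* F = R (conj = id, re = id) and F = C = R[i] *)
Theorem theorem2p1 (R : realType) :
  thm21_for (@id_R R) (@id_R R) (@id_R R) /\
  thm21_for (@conj_C R) (@re_C R) (@emb_C R).
Proof. by split; [exact: real_case | exact: complex_case]. Qed.
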